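(* Let $A$ be a unital $C^*$-algebra and let $\psi$ be a symmetric state on $\mathfrak A=\ast_1^\infty A$. (i) If the restriction of $\hat\psi$ to $\mathcal T_\psi$ has faithful GNS representation, then $\mathcal N_\psi=\mathcal M_\psi$. Thus, the conditional expectation $F_\psi:\mathcal Q_\psi\to\mathcal T_\psi$ has an extension to a normal conditional expectation $E_\psi:\mathcal M_\psi\to\mathcal T_\psi$ onto $\mathcal T_\psi$. (ii) If the restriction of $\hat\psi$ to $\mathcal F_\psi$ has faithful GNS representation, then $\mathcal P_\psi=\mathcal M_\psi$. Thus, the conditional expectation $G_\psi:\mathcal R_\psi\to\mathcal F_\psi$ has an extension to a normal conditional expectation $H_\psi:\mathcal M_\psi\to\mathcal F_\psi$ onto $\mathcal F_\psi$. (iii) If the restrictions of $\hat\psi$ to $\mathcal F_\psi$ and to $\mathcal T_\psi$ both have faithful GNS representations (for example, if the restriction of $\hat\psi$ to $\mathcal F_\psi$ is faithful), then $\mathcal T_\psi=\mathcal F_\psi$.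
   Context: $\mathfrak A=\ast_{i=1}^\infty A$ is the universal unital free product $C^*$-algebra of infinitely many copies of $A$, with canonical embeddings $\lambda_i:A\to\mathfrak A$. A state $\psi$ on $\mathfrak A$ is symmetric if $\psi(\lambda_{i(1)}(a_1)\cdots\lambda_{i(n)}(a_n))=\psi(\lambda_{\sigma(i(1))}(a_1)\cdots\lambda_{\sigma(i(n))}(a_n))$ for all $n$, $i(j)\in\mathbf N$, $a_j\in A$ and all permutations $\sigma$ of $\mathbf N$. For symmetric $\psi$: $\pi_\psi$ is the GNS representation on $L^2(\mathfrak A,\psi)$ with canonical map $a\mapsto\hat a$; $\pi_i=\pi_\psi\circ\lambda_i$; $\mathcal M_\psi=\pi_\psi(\mathfrak A)''$; $\hat\psi=\langle\,\cdot\,\hat1,\hat1\rangle$ on $\mathcal M_\psi$. Tail algebra: $\mathcal T_\psi=\bigcap_{N\ge1}W^*(\bigcup_{i\ge N}\pi_i(A))$. For a finite permutation $\sigma\in S_\infty$ of $\mathbf N$, $\beta_\sigma\in\mathrm{Aut}(\mathfrak A)$ is given by $\beta_\sigma\circ\lambda_i=\lambda_{\sigma(i)}$, $U_\sigma\hat x=\widehat{\beta_\sigma(x)}$, and $\hat\beta_\sigma=\mathrm{Ad}(U_\sigma)$ on $\mathcal M_\psi$; the fixed point algebra $\mathcal F_\psi\supseteq\mathcal T_\psi$ is the set of $x\in\mathcal M_\psi$ fixed by all $\hat\beta_\sigma$. $\mathcal R_\psi$ (resp. $\mathcal Q_\psi$) is the $C^*$-subalgebra of $\mathcal M_\psi$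 generated by $\pi_\psi(\mathfrak A)\cup\mathcal F_\psi$ (resp. $\pi_\psi(\mathfrak A)\cup\mathcal T_\psi$). $\alpha$ is the unique $*$-endomorphism of $\mathcal R_\psi$ with $\alpha\circ\pi_i=\pi_{i+1}$ and $\alpha|_{\mathcal F_\psi}=\mathrm{id}$. $G_\psi:\mathcal R_\psi\to\mathcal F_\psi$ is the conditional expectation $G_\psi(x)=\mathrm{WOT}\text{-}\lim_n\alpha^n(x)$ and $F_\psi=G_\psi|_{\mathcal Q_\psi}:\mathcal Q_\psi\to\mathcal T_\psi$ is also a conditional expectation. Definition of $\mathcal N_\psi$: let $\kappa$ be a normal faithful $*$-representation of $\mathcal T_\psi$ on a Hilbert space $\mathcal V$, let $\mathcal W=L^2(\mathcal Q_\psi,F_\psi)\otimes_\kappa\mathcal V$ be the interior tensor product with the right Hilbert $\mathcal T_\psi$-module $L^2(\mathcal Q_\psi,F_\psi)$, let $\sigma_\psi(x)=\pi_{F_\psi}(x)\otimes\mathrm{id}_{\mathcal V}$, where $\pi_{F_\psi}$ is the left action of $\mathcal Q_\psi$ on $L^2(\mathcal Q_\psi,F_\psi)$, and let $\mathcal N_\psi=\sigma_\psi(\mathcal Q_\psi)''$; up to isomorphism this does not depend on $\kappa$. $\mathcal P_\psi$, with $\eta_\psi:\mathcal R_\psi\to\mathcal P_\psi$, is defined by the same construction with $(\mathcal R_\psi,\mathcal F_\psi,G_\psi)$ replacing $(\mathcal Q_\psi,\mathcal T_\psi,F_\psi)$. Here $\mathcal N_\psi=\mathcal M_\psi$ (resp.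 $\mathcal P_\psi=\mathcal M_\psi$) means that $\sigma_\psi$ (resp. $\eta_\psi$) extends to a normal $*$-isomorphism from $\mathcal M_\psi$ onto $\mathcal N_\psi$ (resp. $\mathcal P_\psi$). *)

(* Defs.v *)
From HB Require Import structures.
From mathcomp Require Import all_boot all_order all_algebra.
From mathcomp Require Import complex.
From mathcomp Require Import all_classical all_reals all_analysis.
From mathcomp Require Import ring lra.

Set Implicit Arguments.
Unset Strict Implicit.
Unset Printing Implicit Defensive.

Import Order.TTheory GRing.Theory Num.Theory.
Import numFieldNormedType.Exports.

Local Open Scope classical_set_scope.
Local Open Scope ring_scope.

HB.mixin Record hasStar (R : realType) A of GRing.Algebra R[i] A := {
  star : A -> A;
  starK : involutive star;
  starD : {morph star : x y / x + y};
  starZ : forall (c : R[i]) x, star (c *: x) = c^* *: star x;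
  starM : forall x y, star (x * y) = star y * star x
}.

#[short(type="starAlgType")]
HB.structure Definition StarAlgebra (R : realType) :=
  {A of GRing.Algebra R[i] A & hasStar R A}.

(* The norm is a field of its own, with values in R: the hierarchy has no join
   of rings and normed modules other than numDomainType. *)
HB.mixin Record isCStarAlgebra (R : realType) A of StarAlgebra R A := {
  cnorm : A -> R;
  cnormD : forall x y, cnorm (x + y) <= cnorm x + cnorm y;
  cnormZ : forall (c : R[i]) x, cnorm (c *: x) = complex.Re `|c| * cnorm x;
  cnorm0_eq0 : forall x, cnorm x = 0 -> x = 0;
  cnormM : forall x y, cnorm (x * y) <= cnorm x * cnorm y;
  cnorm_cstar : forall x, cnorm (star x * x) = cnorm x ^+ 2;
  cnorm_complete : forall u : nat -> A,
    (forall e : R, 0 < e -> exists N, forall m n,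
       (N <= m)%N -> (N <= n)%N -> cnorm (u m - u n) < e) ->
    exists l, forall e : R, 0 < e -> exists N, forall n,
       (N <= n)%N -> cnorm (u n - l) < e
}.

#[short(type="cstarAlgType")]
HB.structure Definition CStarAlgebra (R : realType) :=
  {A of StarAlgebra R A & isCStarAlgebra R A}.

(* The inner product is linear in the first variable.  Hilbert spaces are
   nonzero, because an algType (here: the algebra of bounded operators) is a
   nonzero ring. *)
HB.mixin Record hasInner (R : realType) H of CompleteNormedModule R[i] H := {
  inner : H -> H -> R[i];
  innerDl : forall x y z, inner (x + y) z = inner x z + inner y z;
  innerZl : forall (c : R[i]) x z, inner (c *: x) z = c * inner x z;
  innerC : forall x y, inner y x = (inner x y)^*;
  norm_inner : forall x : H, `|x| ^+ 2 = inner x x;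
  hilbert_nz : exists x : H, x != 0
}.

#[short(type="hilbertType")]
HB.structure Definition Hilbert (R : realType) :=
  {H of CompleteNormedModule R[i] H & hasInner R H}.

Section InnerTheory.
Context (R : realType) (H : hilbertType R).
Implicit Types (x y z : H) (c : R[i]).

Lemma innerDr x y z : inner x (y + z) = inner x y + inner x z.
Proof. by rewrite innerC innerDl rmorphD /= -!innerC. Qed.

Lemma innerZr c x y : inner x (c *: y) = c^* * inner x y.
Proof. by rewrite innerC innerZl rmorphM /= -innerC. Qed.

Lemma inner0l y : inner 0 y = 0.
Proof. by have := innerZl 0 (0 : H) y; rewrite scale0r mul0r. Qed.

Lemma inner0r y : inner y 0 = 0.
Proof. by rewrite innerC inner0l rmorph0. Qed.

Lemma innerNl x y : inner (- x) y = - inner x y.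
Proof. by rewrite -scaleN1r innerZl mulN1r. Qed.

Lemma innerNr x y : inner x (- y) = - inner x y.
Proof. by rewrite innerC innerNl rmorphN /= -innerC. Qed.

Lemma innerBl x y z : inner (x - y) z = inner x z - inner y z.
Proof. by rewrite innerDl innerNl. Qed.

Lemma innerBr x y z : inner x (y - z) = inner x y - inner x z.
Proof. by rewrite innerDr innerNr. Qed.

Lemma inner_ge0 x : 0 <= inner x x.
Proof. by rewrite -norm_inner exprn_ge0. Qed.

Lemma inner_eq0 x : (inner x x == 0) = (x == 0).
Proof. by rewrite -norm_inner sqrf_eq0 normr_eq0. Qed.

Lemma inner_inj x y : (forall z, inner z x = inner z y) -> x = y.
Proof.
by move=> e; apply/eqP; rewrite -subr_eq0 -inner_eq0 innerBr e subrr.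
Qed.

Lemma inner_proj x y : y != 0 ->
  let t := inner x y / inner y y in
  inner (x - t *: y) (x - t *: y) =
    inner x x - `|inner x y| ^+ 2 / inner y y.
Proof.
move=> y0 t; have q0 : inner y y != 0 by rewrite inner_eq0.
have e : inner (x - t *: y) y = 0.
  by rewrite innerBl innerZl /t divfK // subrr.
rewrite innerBr innerZr e mulr0 subr0 innerBl innerZl; congr (_ - _).
by rewrite /t mulrAC normCK (innerC x y).
Qed.

Lemma inner_CS x y : `|inner x y| <= `|x| * `|y|.
Proof.
have [->|y0] := eqVneq y 0; first by rewrite inner0r !normr0 mulr0.
have q0 : 0 < inner y y by rewrite lt_neqAle eq_sym inner_eq0 y0 inner_ge0.
have := inner_ge0 (x - (inner x y / inner y y) *: y).
rewrite inner_proj // subr_ge0 ler_pdivrMr // -!norm_inner -exprMn.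
by rewrite ler_pXn2r // ?nnegrE ?mulr_ge0.
Qed.

Lemma parallelogram x y : inner (x - y) (x - y) =
  2 * inner x x + 2 * inner y y - inner (x + y) (x + y).
Proof. rewrite !(innerBl, innerBr, innerDl, innerDr); ring. Qed.

End InnerTheory.

Section Riesz.
Context (R : realType) (H : hilbertType R).
Variables (f : H -> R[i]).
Hypothesis f_linear : scalar f.
Hypothesis f_bounded : exists c : R[i], forall x, `|f x| <= c * `|x|.

Let q (x : H) : R := complex.Re (inner x x).

Let qE x : inner x x = (q x)%:C%C.
Proof. by rewrite -[LHS]RRe_real ?ger0_real ?inner_ge0. Qed.

Let q_ge0 x : 0 <= q x.
Proof. by rewrite -lecR -qE inner_ge0. Qed.

Let fB x y : f (x - y) = f x - f y.
Proof. by rewrite addrC -scaleN1r f_linear mulN1r addrC. Qed.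

Let fZ c x : f (c *: x) = c * f x.
Proof.
have f0 : f 0 = 0 by have := fB 0 0; rewrite subrr subrr.
by rewrite -[c *: x]addr0 f_linear f0 addr0.
Qed.

Lemma riesz : exists z, forall x, f x = inner x z.
Proof.
have [f0|/existsNP[x0 /eqP fx0]] := pselect (forall x, f x = 0).
  by exists 0 => x; rewrite f0 inner0r.
pose S := [set x | f x = 1].
pose A := q @` S.
have A0 : has_inf A.
  split; last by exists 0 => _ [x _ <-]; exact: q_ge0.
  by exists (q ((f x0)^-1 *: x0)); exists ((f x0)^-1 *: x0) => //; rewrite /S /= fZ mulVf.
pose d := inf A.
have dP x : f x = 1 -> d <= q x.
  by move=> fx; apply: ge_inf; [case: A0|exists x].
have /choice[u uP] n : exists x, f x = 1 /\ q x < d + n.+1%:R^-1.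
  have [_ [x Sx <-] xd] := @inf_adherent _ A n.+1%:R^-1 ltac:(by rewrite invr_gt0) A0.
  by exists x.
have q_par x y : q (x - y) = 2 * q x + 2 * q y - q (x + y).
  have := parallelogram x y; rewrite !qE.
  rewrite -(rmorph_nat (real_complex R) 2) -!rmorphM -!rmorphD -!rmorphB.
  by move/complexI.
have qZ c x : q (c%:C%C *: x) = c ^+ 2 * q x.
  have := inner_ge0 x; move: (qE (c%:C%C *: x)).
  rewrite innerZl innerZr conj_Creal ?complex_real // qE -!rmorphM => /complexI <-.
  by rewrite mulrA.
have u_close m n : q (u m - u n) <= 2 * (m.+1%:R^-1 + n.+1%:R^-1).
  have [fm um] := uP m; have [fn un] := uP n.
  have h : q (u m + u n) = 4 * q (2^-1%:C%C *: (u m + u n)).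
    by rewrite qZ; field.
  have : d <= q (2^-1%:C%C *: (u m + u n)).
    apply: dP; rewrite fZ -[u n]opprK fB -[- u n]add0r fB fm fn.
    have f0 : f 0 = 0 by have := fB 0 0; rewrite subr0 subrr.
    rewrite f0 sub0r opprK -(rmorph1 (real_complex R)) -rmorphD -rmorphM.
    by congr (_%:C%C); field.
  rewrite q_par h.
  move: um un; move: (m.+1%:R^-1) (n.+1%:R^-1) (q (u m)) (q (u n)) (q _).
  move=> a b e g k ? ? ?; lra.
have q_norm x : `|x| ^+ 2 = (q x)%:C%C by rewrite norm_inner qE.
have posP (e : R[i]) : 0 < e -> exists2 r : R, 0 < r & e = r%:C%C.
  by move=> e0; exists (complex.Re e); rewrite -?ltcR ?RRe_real ?gtr0_real.
have lt_norm x (r : R) : 0 < r -> (`|x| < r%:C%C) = (q x < r ^+ 2).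
  move=> r0; rewrite -ltcR rmorphXn -q_norm ltr_pXn2r ?nnegrE //.
  by rewrite ltW // ltcR.
have inv_lt (r : R) : 0 < r -> exists N, forall n, (N <= n)%N -> n.+1%:R^-1 < r.
  move=> r0; have [N _ NP] := near_infty_natSinv_lt (PosNum r0).
  by exists N => n /NP.
have u_cvg : cvgn (u : nat -> H).
  apply/cauchy_cvgP/cauchy_ballP => _ /posP[r r0 ->].
  have [N NP] := inv_lt (r ^+ 2 / 4) ltac:(by rewrite divr_gt0 ?exprn_gt0).
  exists (u @` [set n | (N <= n)%N], u @` [set n | (N <= n)%N]) => /=.
    by split; exists N => // n Nn; exists n.
  move=> [_ _] /= [[m Nm <-] [n Nn <-]]; rewrite -ball_normE /= lt_norm //.
  apply: (le_lt_trans (u_close _ _)); move: (NP _ Nm) (NP _ Nn).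
  by move: (m.+1%:R^-1) (n.+1%:R^-1) (r ^+ 2) => a b c ? ?; lra.
pose z := limn u.
have uz (e : R[i]) : 0 < e -> exists N, forall n, (N <= n)%N -> `|z - u n| < e.
  move=> e0; have /cvgrPdist_lt/(_ _ e0)[N _ NP] : u @ \oo --> z by exact: u_cvg.
  by exists N => n /NP.
have fz : f z = 1.
  apply/eqP; rewrite -subr_eq0 -normr_eq0 -[_ == 0]negbK; apply/negP => a0.
  have [c cP] := f_bounded.
  have c0 : 0 <= c.
    have x00 : x0 != 0 by apply: contraNneq fx0 => ->; have := fB 0 0; rewrite subrr subrr => ->.
    have := le_trans (normr_ge0 _) (cP x0); rewrite pmulr_lge0 //.
    by rewrite normr_gt0.
  have c1 : 0 < c + 1 by rewrite ltr_wpDl.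
  have [N /(_ N (leqnn N))] := uz (`|f z - 1| / (c + 1)) ltac:(by rewrite divr_gt0 // lt_def a0 /=).
  rewrite ltr_pdivlMr //; apply/negP; rewrite -real_leNgt ?ger0_real ?mulr_ge0 ?(ltW c1) //.
  rewrite -[1](proj1 (uP N)) -fB (le_trans (cP _)) // mulrC ler_wpM2l //.
  by rewrite (proj1 (uP N)) lerDl ler01.
have z_orth k : f k = 0 -> inner k z = 0.
  move=> fk; apply/eqP; rewrite -normr_eq0 -[_ == 0]negbK; apply/negP => a0.
  have k0 : k != 0 by apply: contraNneq a0 => ->; rewrite inner0l normr0.
  have qk0 : 0 < inner k k by rewrite lt_def inner_eq0 k0 inner_ge0.
  have k0' : 0 < `|k| by rewrite normr_gt0.
  have a0' : 0 < `|inner k z| by rewrite lt_def a0 /=.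
  have a2 : 0 < `|inner k z| / 2 by rewrite divr_gt0.
  have [N1 NP1] := uz (`|inner k z| / 2 / `|k|) ltac:(by rewrite divr_gt0).
  have [r r0 rE] := posP _ a2.
  have qk0' : 0 < q k by rewrite -ltcR -qE.
  have [N2 NP2] := inv_lt (r ^+ 2 / q k) ltac:(by rewrite divr_gt0 // exprn_gt0).
  pose n := maxn N1 N2.
  have := NP1 n (leq_maxl _ _); rewrite ltr_pdivlMr // => h1.
  have := NP2 n (leq_maxr _ _); rewrite ltr_pdivlMr // => h2.
  have [fn un] := uP n.
  have h3 : `|inner k (u n)| < r%:C%C.
    have r0C : 0 < r%:C%C :> R[i] by rewrite ltcR.
    rewrite -(@ltr_pXn2r _ 2) ?nnegrE ?normr_ge0 ?(ltW r0C) //.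
    have := inner_proj (u n) k0.
    set t := _ / _ => /= ht.
    have : d <= q (u n - t *: k) by apply: dP; rewrite fB fZ fk mulr0 subr0.
    rewrite -lecR -qE ht qE lerBrDr -lerBrDl -rmorphB => h4.
    have {h4} : `|inner (u n) k| ^+ 2 / inner k k < (n.+1%:R^-1)%:C%C.
      by apply: (le_lt_trans h4); rewrite ltcR ltrBlDl.
    rewrite ltr_pdivrMr // qE -rmorphM => h5.
    by rewrite innerC norm_conjC (lt_trans h5) // -rmorphXn ltcR.
  have h6 : `|inner k z| <= `|inner k (z - u n)| + `|inner k (u n)|.
    have -> : inner k z = inner k (z - u n) + inner k (u n).
      by rewrite innerBr subrK.
    exact: ler_normD.
  have h7 : `|inner k (z - u n)| < r%:C%C.
    by rewrite -rE (le_lt_trans (inner_CS _ _)) // mulrC.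
  by have := le_lt_trans h6 (ltrD h7 h3); rewrite -rE -splitr ltxx.
have qz0 : inner z z != 0.
  by rewrite inner_eq0; apply: contraNneq (oner_neq0 R[i]) => z0; rewrite -fz z0; have := fB 0 0; rewrite subrr subrr => ->.
exists ((inner z z)^-1 *: z) => x.
have := z_orth (x - f x *: z); rewrite fB fZ fz mulr1 subrr => /(_ erefl).
rewrite innerBl innerZl => /eqP; rewrite subr_eq0 => /eqP xz.
rewrite innerZr fmorphV /= -innerC xz mulrC mulfK //.
Qed.

End Riesz.

Record bop (R : realType) (H : hilbertType R) := Bop {
  bop_fun :> H -> H;
  bop_linear : linear bop_fun;
  bop_bounded : exists c : R[i], forall x, `|bop_fun x| <= c * `|x|
}.

Section BopAlgebra.
Context (R : realType) (H : hilbertType R).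
Implicit Types (S T : bop H) (c : R[i]).

Lemma bopP S T : (forall x, S x = T x) -> S = T.
Proof.
case: S => s ls bs; case: T => t lt bt /= /funext e.
rewrite e in ls bs *; congr Bop; exact: Prop_irrelevance.
Qed.

HB.instance Definition _ := gen_eqMixin (bop H).
HB.instance Definition _ := gen_choiceMixin (bop H).

Lemma bopD T x y : T (x + y) = T x + T y.
Proof. by have := bop_linear T 1 x y; rewrite !scale1r. Qed.

Lemma bop0 T : T 0 = 0.
Proof. by apply: (addrI (T 0)); rewrite -bopD !addr0. Qed.

Lemma bopZ T c x : T (c *: x) = c *: T x.
Proof. by rewrite -[c *: x]addr0 bop_linear bop0 addr0. Qed.

Lemma bop_bound T : exists2 c : R[i], 0 <= c & forall x, `|T x| <= c * `|x|.
Proof.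
have [c cP] := bop_bounded T; exists c => //.
have [x x0] := @hilbert_nz R H.
have := le_trans (normr_ge0 _) (cP x); rewrite pmulr_lge0 //.
by rewrite normr_gt0.
Qed.

Fact bop_zero_linear : linear (fun _ : H => 0 : H).
Proof. by move=> c x y; rewrite scaler0 addr0. Qed.
Fact bop_zero_bounded :
  exists c : R[i], forall x : H, `|0 : H| <= c * `|x|.
Proof. by exists 0 => x; rewrite normr0 mul0r. Qed.
Definition bop_zero := Bop bop_zero_linear bop_zero_bounded.

Fact bop_one_linear : linear (@id H).
Proof. by []. Qed.
Fact bop_one_bounded : exists c : R[i], forall x : H, `|x| <= c * `|x|.
Proof. by exists 1 => x; rewrite mul1r. Qed.
Definition bop_one := Bop bop_one_linear bop_one_bounded.

Fact bop_add_linear S T : linear (fun x => S x + T x).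
Proof. by move=> c x y; rewrite !bop_linear scalerDr addrACA. Qed.
Fact bop_add_bounded S T :
  exists c : R[i], forall x, `|S x + T x| <= c * `|x|.
Proof.
have [[c cP] [d dP]] := (bop_bounded S, bop_bounded T).
by exists (c + d) => x; rewrite mulrDl (le_trans (ler_normD _ _)) ?lerD.
Qed.
Definition bop_add S T := Bop (bop_add_linear S T) (bop_add_bounded S T).

Fact bop_scale_linear c T : linear (fun x => c *: T x).
Proof.
by move=> d x y; rewrite bop_linear scalerDr !scalerA [c * d]mulrC.
Qed.
Fact bop_scale_bounded c T :
  exists d : R[i], forall x, `|c *: T x| <= d * `|x|.
Proof.
have [d dP] := bop_bounded T.
by exists (`|c| * d) => x; rewrite normrZ -mulrA ler_wpM2l.
Qed.
Definition bop_scale c T := Bop (bop_scale_linear c T) (bop_scale_bounded c T).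

Fact bop_comp_linear S T : linear (fun x => S (T x)).
Proof. by move=> c x y; rewrite !bop_linear. Qed.
Fact bop_comp_bounded S T :
  exists c : R[i], forall x, `|S (T x)| <= c * `|x|.
Proof.
have [[c c0 cP] [d dP]] := (bop_bound S, bop_bounded T).
by exists (c * d) => x; rewrite (le_trans (cP _)) // -mulrA ler_wpM2l.
Qed.
Definition bop_comp S T := Bop (bop_comp_linear S T) (bop_comp_bounded S T).

Fact bop_addA : associative bop_add.
Proof. by move=> ? ? ?; apply: bopP => x /=; rewrite addrA. Qed.
Fact bop_addC : commutative bop_add.
Proof. by move=> ? ?; apply: bopP => x /=; rewrite addrC. Qed.
Fact bop_add0 : left_id bop_zero bop_add.
Proof. by move=> ?; apply: bopP => x /=; rewrite add0r. Qed.
Fact bop_addN : left_inverse bop_zero (bop_scale (-1)) bop_add.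
Proof. by move=> ?; apply: bopP => x /=; rewrite scaleN1r addNr. Qed.

HB.instance Definition _ :=
  GRing.isZmodule.Build (bop H) bop_addA bop_addC bop_add0 bop_addN.

Fact bop_compA : associative bop_comp.
Proof. by move=> ? ? ?; apply: bopP. Qed.
Fact bop_comp1l : left_id bop_one bop_comp.
Proof. by move=> ?; apply: bopP. Qed.
Fact bop_comp1r : right_id bop_one bop_comp.
Proof. by move=> ?; apply: bopP. Qed.
Fact bop_compDl : left_distributive bop_comp bop_add.
Proof. by move=> ? ? ?; apply: bopP. Qed.
Fact bop_compDr : right_distributive bop_comp bop_add.
Proof. by move=> ? ? ?; apply: bopP => x /=; rewrite bopD. Qed.
Fact bop_one_neq0 : bop_one != 0.
Proof.
have [x x0] := @hilbert_nz R H.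
by apply: contraNneq x0 => /(congr1 (fun T : bop H => T x)) /= ->.
Qed.

HB.instance Definition _ := GRing.Zmodule_isNzRing.Build (bop H)
  bop_compA bop_comp1l bop_comp1r bop_compDl bop_compDr bop_one_neq0.

Fact bop_scaleA c d T : bop_scale c (bop_scale d T) = bop_scale (c * d) T.
Proof. by apply: bopP => x /=; rewrite scalerA. Qed.
Fact bop_scale1 : left_id 1 bop_scale.
Proof. by move=> ?; apply: bopP => x /=; rewrite scale1r. Qed.
Fact bop_scaleDr : right_distributive bop_scale +%R.
Proof. by move=> ? ? ?; apply: bopP => x /=; rewrite scalerDr. Qed.
Fact bop_scaleDl T : {morph bop_scale^~ T : a b / a + b}.
Proof. by move=> ? ?; apply: bopP => x /=; rewrite scalerDl. Qed.

HB.instance Definition _ := GRing.Zmodule_isLmodule.Build R[i] (bop H)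
  bop_scaleA bop_scale1 bop_scaleDr bop_scaleDl.

Fact bop_scaleAl c S T : c *: (S * T) = (c *: S) * T.
Proof. exact: bopP. Qed.
HB.instance Definition _ :=
  GRing.Lmodule_isLalgebra.Build R[i] (bop H) bop_scaleAl.

Fact bop_scaleAr c S T : c *: (S * T) = S * (c *: T).
Proof. by apply: bopP => x /=; rewrite -bopZ. Qed.
HB.instance Definition _ :=
  GRing.Lalgebra_isAlgebra.Build R[i] (bop H) bop_scaleAr.

Lemma bop_adjoint_ex T :
  exists S : bop H, forall x y, inner (T x) y = inner x (S y).
Proof.
have [c c0 cP] := bop_bound T.
have /choice[g gP] (y : H) : exists z, forall x, inner (T x) y = inner x z.
  apply: (@riesz R H (fun x => inner (T x) y)).
    by move=> a u v; rewrite bop_linear innerDl innerZl.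
  exists (c * `|y|) => x; rewrite (le_trans (inner_CS _ _)) // mulrAC.
  by rewrite ler_wpM2r.
have g_lin : linear g.
  by move=> a u v; apply: inner_inj => x; rewrite -gP !innerDr !innerZr -!gP.
have g_bd : exists a : R[i], forall x, `|g x| <= a * `|x|.
  exists c => y; have [->|g0] := eqVneq (g y) 0.
    by rewrite normr0 mulr_ge0.
  have g0' : 0 < `|g y| by rewrite normr_gt0.
  rewrite -(ler_pM2r g0') -expr2 norm_inner -gP.
  rewrite (le_trans (real_ler_norm _)) //.
    by rewrite gP ger0_real // inner_ge0.
  by rewrite (le_trans (inner_CS _ _)) // mulrAC ler_wpM2r.
by exists (Bop g_lin g_bd).
Qed.

Definition adjoint T : bop H := projT1 (cid (bop_adjoint_ex T)).

Lemma adjointP T x y : inner (T x) y = inner x (adjoint T y).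
Proof. by rewrite /adjoint; case: cid. Qed.

Fact adjointK : involutive adjoint.
Proof.
move=> T; apply: bopP => y; apply: inner_inj => x.
by rewrite -adjointP innerC -adjointP -innerC.
Qed.
Fact adjointD : {morph adjoint : S T / S + T}.
Proof.
move=> S T; apply: bopP => y; apply: inner_inj => x.
by rewrite -adjointP /= innerDl innerDr !adjointP.
Qed.
Fact adjointZ c T : adjoint (c *: T) = c^* *: adjoint T.
Proof.
apply: bopP => y; apply: inner_inj => x.
by rewrite -adjointP /= innerZl innerZr conjCK adjointP.
Qed.
Fact adjointM S T : adjoint (S * T) = adjoint T * adjoint S.
Proof.
apply: bopP => y; apply: inner_inj => x.
by rewrite -adjointP /= !adjointP.
Qed.

HB.instance Definition _ :=
  hasStar.Build R (bop H) adjointK adjointD adjointZ adjointM.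

Lemma bop_starE T x y : inner (T x) y = inner x (star T y).
Proof. exact: adjointP. Qed.

End BopAlgebra.

Section StarAlgebras.
Context (R : realType).

Definition linear_on (U V : lmodType R[i]) (D : set U) (f : U -> V) :=
  forall (c : R[i]) x y, D x -> D y -> f (c *: x + y) = c *: f x + f y.

Definition star_hom_on (X Y : starAlgType R) (D : set X) (f : X -> Y) :=
  [/\ linear_on D f,
      forall x y, D x -> D y -> f (x * y) = f x * f y &
      forall x, D x -> f (star x) = star (f x)].

Definition unital_star_hom (X Y : starAlgType R) (f : X -> Y) :=
  star_hom_on setT f /\ f 1 = 1.

Definition star_subalg (X : starAlgType R) (B : set X) :=
  [/\ B 0,
      forall (c : R[i]) x y, B x -> B y -> B (c *: x + y),
      forall x y, B x -> B y -> B (x * y) &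
      forall x, B x -> B (star x)].

Definition is_state (X : starAlgType R) (phi : X -> R[i]) :=
  [/\ scalar phi, forall x, 0 <= phi (star x * x) & phi 1 = 1].

Definition is_unitary (X : starAlgType R) (u : X) :=
  star u * u = 1 /\ u * star u = 1.

(* The GNS construction of the restriction of phi to D is characterised up to
   unitary equivalence: K is the completion L^2(D, phi), hat the canonical map
   and rep the left multiplication.  Values of hat and rep off D are irrelevant. *)
Record is_gns (X : starAlgType R) (D : set X) (phi : X -> R[i])
    (K : hilbertType R) (hat : X -> K) (rep : X -> bop K) : Prop := {
  gns_linear : linear_on D hat;
  gns_dense : closure (hat @` D) = setT;
  gns_inner : forall x y, D x -> D y -> inner (hat x) (hat y) = phi (star y * x);
  gns_rep : forall x y, D x -> D y -> rep x (hat y) = hat (x * y)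
}.

Definition has_faithful_gns (X : starAlgType R) (D : set X) (phi : X -> R[i]) :=
  exists (K : hilbertType R) (hat : X -> K) (rep : X -> bop K),
    is_gns D phi hat rep /\ set_inj D rep.

Definition faithful_on (X : starAlgType R) (D : set X) (phi : X -> R[i]) :=
  forall x, D x -> phi (star x * x) = 0 -> x = 0.

Definition is_free_product (A FA : cstarAlgType R) (lam : nat -> A -> FA) :=
  (forall i, unital_star_hom (lam i)) /\
  forall (B : cstarAlgType R) (f : nat -> A -> B),
    (forall i, unital_star_hom (f i)) ->
    exists! F : FA -> B,
      unital_star_hom F /\ forall i a, F (lam i a) = f i a.

Definition is_symmetric (A FA : cstarAlgType R) (lam : nat -> A -> FA)
    (psi : FA -> R[i]) :=
  forall (s : nat -> nat) (w : seq (nat * A)), bijective s ->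
    psi (\prod_(p <- w) lam p.1 p.2) = psi (\prod_(p <- w) lam (s p.1) p.2).

End StarAlgebras.

Section OperatorAlgebras.
Context (R : realType).

Definition opnorm (H : hilbertType R) (T : bop H) : R :=
  sup [set complex.Re `|T x| | x in [set x | `|x| <= 1]].

Definition op_pos (H : hilbertType R) (T : bop H) :=
  forall x, 0 <= inner (T x) x.

Definition commutant (H : hilbertType R) (S : set (bop H)) : set (bop H) :=
  [set T | forall s, S s -> T * s = s * T].

Definition bicommutant (H : hilbertType R) (S : set (bop H)) :=
  commutant (commutant S).

(* By the bicommutant theorem this is the von Neumann algebra W^*(S) generated
   by S, with the unit of the ambient space. *)
Definition vn_gen (H : hilbertType R) (S : set (bop H)) :=
  bicommutant (S `|` star @` S).

Definition norm_closed (H : hilbertType R) (B : set (bop H)) :=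
  forall T, (forall e : R, 0 < e -> exists2 S, B S & opnorm (T - S) < e) -> B T.

Definition cstar_gen (H : hilbertType R) (S : set (bop H)) : set (bop H) :=
  \bigcap_(B in [set B | [/\ star_subalg B, norm_closed B & S `<=` B]]) B.

Definition wot_cvg (H : hilbertType R) (u : nat -> bop H) (T : bop H) :=
  forall x y, inner (u n x) y @[n --> \oo] --> (inner (T x) y : R[i]^o).

(* The functionals T \mapsto \sum_n <T xi_n, eta_n> with square-summable xi, eta
   are the ultraweakly continuous ones; the ultraweak topology is the weak
   topology they induce.  Normality is ultraweak continuity. *)
Definition uw_functional (H : hilbertType R) (w : bop H -> R[i]) :=
  exists xi eta : nat -> H,
    [/\ cvgn (series (fun n => `|xi n| ^+ 2 : R[i]^o)),
        cvgn (series (fun n => `|eta n| ^+ 2 : R[i]^o)) &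
        forall T : bop H, \sum_(k < n) inner (T (xi k)) (eta k) @[n --> \oo]
                    --> (w T : R[i]^o)].

Definition uw_cvg (H : hilbertType R) (F : set_system (bop H)) (T : bop H) :=
  forall w, uw_functional w -> w S @[S --> F] --> (w T : R[i]^o).

Definition normal_on (H K : hilbertType R) (D : set (bop H))
    (f : bop H -> bop K) :=
  forall (F : set_system (bop H)) T, ProperFilter F -> F D -> D T ->
    uw_cvg F T -> uw_cvg (f @ F) (f T).

Definition normal_faithful_rep (H V : hilbertType R) (D : set (bop H))
    (kappa : bop H -> bop V) :=
  [/\ star_hom_on D kappa, normal_on D kappa & set_inj D kappa].

Record cond_exp (H : hilbertType R) (B D : set (bop H)) (E : bop H -> bop H)
    : Prop := {
  cond_exp_linear : linear_on B E;
  cond_exp_range : forall x, B x -> D (E x);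
  cond_exp_id : forall x, D x -> E x = x;
  cond_exp_pos : forall x, B x -> op_pos x -> op_pos (E x);
  cond_exp_bimod : forall s x t, D s -> B x -> D t ->
    E (s * x * t) = s * E x * t
}.

(* Right Hilbert module over the operator algebra D; the inner product is
   linear in the second variable and the action is only used on D. *)
Record hilbertModule (H : hilbertType R) (D : set (bop H)) := HilbertModule {
  hm_sort :> lmodType R[i];
  hm_act : hm_sort -> bop H -> hm_sort;
  hm_ip : hm_sort -> hm_sort -> bop H;
  hm_actDl : forall (c : R[i]) e f t, D t ->
    hm_act (c *: e + f) t = c *: hm_act e t + hm_act f t;
  hm_actDr : forall e, linear_on D (hm_act e);
  hm_actM : forall e s t, D s -> D t -> hm_act e (s * t) = hm_act (hm_act e s) t;
  hm_ip_in : forall e f, D (hm_ip e f);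
  hm_ip_linear : forall e, linear (hm_ip e);
  hm_ip_act : forall e f t, D t -> hm_ip e (hm_act f t) = hm_ip e f * t;
  hm_ip_star : forall e f, hm_ip f e = star (hm_ip e f);
  hm_ip_pos : forall e, op_pos (hm_ip e e);
  hm_ip_eq0 : forall e, hm_ip e e = 0 -> e = 0;
  hm_norm := fun e => Num.sqrt (opnorm (hm_ip e e));
  hm_complete : forall u : nat -> hm_sort,
    (forall r : R, 0 < r -> exists N, forall m n,
       (N <= m)%N -> (N <= n)%N -> hm_norm (u m - u n) < r) ->
    exists l, forall r : R, 0 < r -> exists N, forall n,
       (N <= n)%N -> hm_norm (u n - l) < r
}.

Definition hm_adjointable (H : hilbertType R) (D : set (bop H))
    (E : hilbertModule D) (f : E -> E) :=
  exists g : E -> E, forall e1 e2, hm_ip (f e1) e2 = hm_ip e1 (g e2).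

(* These axioms determine E = L^2(B, F), the completion of B for the D-valued
   inner product F(x^* y), up to a unique unitary, and the left action lft. *)
Record is_L2_module (H : hilbertType R) (B D : set (bop H))
    (F : bop H -> bop H) (E : hilbertModule D)
    (hat : bop H -> E) (lft : bop H -> E -> E) : Prop := {
  L2_linear : linear_on B hat;
  L2_dense : forall e (r : R), 0 < r ->
    exists2 x, B x & hm_norm (e - hat x) < r;
  L2_ip : forall x y, B x -> B y -> hm_ip (hat x) (hat y) = F (star x * y);
  L2_act : forall x t, B x -> D t -> hm_act (hat x) t = hat (x * t);
  L2_lft_adj : forall x, B x -> hm_adjointable (lft x);
  L2_lft : forall x y, B x -> B y -> lft x (hat y) = hat (x * y)
}.

(* These axioms determine W, the interior tensor product of E and V along
   kappa, up to a unique unitary.  kappa need not be unital. *)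
Record is_interior_tensor (H V W : hilbertType R) (D : set (bop H))
    (E : hilbertModule D) (kappa : bop H -> bop V) (tens : E -> V -> W)
    : Prop := {
  tens_linearl : forall v, linear (tens^~ v);
  tens_linearr : forall e, linear (tens e);
  tens_balanced : forall e t v, D t -> tens (hm_act e t) v = tens e (kappa t v);
  tens_inner : forall e f v w,
    inner (tens e v) (tens f w) = inner (kappa (hm_ip f e) v) w;
  tens_dense :
    closure [set x | exists s : seq (E * V),
                       x = \sum_(p <- s) tens p.1 p.2] = setT
}.

(* sigma x = lft x (x) id_V on L^2(B, F) (x)_kappa V, for x in B. *)
Definition is_induced_rep (H V W : hilbertType R) (B D : set (bop H))
    (F : bop H -> bop H) (kappa : bop H -> bop V) (sigma : bop H -> bop W) :=
  exists (E : hilbertModule D) (hat : bop H -> E) (lft : bop H -> E -> E)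
         (tens : E -> V -> W),
    [/\ is_L2_module B F hat lft, is_interior_tensor kappa tens &
        forall x e v, B x -> sigma x (tens e v) = tens (lft x e) v].

Definition extends_to_normal_iso (H W : hilbertType R) (M B : set (bop H))
    (sigma : bop H -> bop W) :=
  exists f : bop H -> bop W,
    [/\ star_hom_on M f, normal_on M f,
        set_bij M (bicommutant (sigma @` B)) f &
        forall x, B x -> f x = sigma x].

Definition extends_to_normal_cond_exp (H : hilbertType R)
    (M B D : set (bop H)) (F : bop H -> bop H) :=
  exists E : bop H -> bop H,
    [/\ cond_exp M D E, normal_on M E & forall x, B x -> E x = F x].

End OperatorAlgebras.

(* The copies of A are indexed by nat, starting from 0. *)
Section TailAndFixedAlgebras.
Context (R : realType) (A FA : cstarAlgType R) (lam : nat -> A -> FA).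
Context (H : hilbertType R) (hat : FA -> H) (pi : FA -> bop H).

Definition vec_state (x : bop H) : R[i] := inner (x (hat 1)) (hat 1).

Definition gns_vn : set (bop H) := bicommutant (range pi).

Definition tail_algebra : set (bop H) :=
  \bigcap_N vn_gen (\bigcup_(i in [set i | (N <= i)%N]) range (pi \o lam i)).

Definition finite_perm (s : nat -> nat) :=
  bijective s /\ exists N, forall i, (N <= i)%N -> s i = i.

(* U is the unitary U_s attached to the automorphism beta_s. *)
Definition implements (s : nat -> nat) (U : bop H) :=
  is_unitary U /\
  exists beta : FA -> FA,
    [/\ unital_star_hom beta, bijective beta,
        forall i a, beta (lam i a) = lam (s i) a &
        forall x, U (hat x) = hat (beta x)].

Definition fixed_algebra : set (bop H) :=
  [set x | gns_vn x /\
           forall s U, finite_perm s -> implements s U -> U * x * star U = x].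

Definition fixed_cstar : set (bop H) := cstar_gen (range pi `|` fixed_algebra).
Definition tail_cstar : set (bop H) := cstar_gen (range pi `|` tail_algebra).

Definition is_shift (alpha : bop H -> bop H) :=
  [/\ star_hom_on fixed_cstar alpha,
      forall x, fixed_cstar x -> fixed_cstar (alpha x),
      forall i a, alpha (pi (lam i a)) = pi (lam i.+1 a) &
      forall x, fixed_algebra x -> alpha x = x].

Definition is_shift_limit (alpha G : bop H -> bop H) :=
  forall x, fixed_cstar x -> wot_cvg (fun n => iter n alpha x) (G x).

End TailAndFixedAlgebras.

(* Main.v *)
Require Import Defs.
From HB Require Import structures.
From mathcomp Require Import all_boot all_order all_algebra.
From mathcomp Require Import complex.
From mathcomp Require Import all_classical all_reals all_analysis.
From mathcomp Require Import ring lra.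
Set Implicit Arguments.
Unset Strict Implicit.
Unset Printing Implicit Defensive.
Import Order.TTheory GRing.Theory Num.Theory.
Import numFieldNormedType.Exports.
Local Open Scope classical_set_scope.
Local Open Scope ring_scope.

(** Write [xi] for the cyclic vector [hat 1], and [(B, D)] for one of the pairs
    [(Q, T)] and [(S, F)].  The theorem rests on the identity
    [<G(x) a xi, b xi> = <x a xi, b xi>], for [x] in [S] and [a], [b] in [F]
    ([limit_compress]): the shift is implemented by an isometry which fixes the
    vectors [a xi] ([shift_isometry]), because on finitely many copies it agrees
    with a permutation and the state is symmetric.  So, if [e] is the projection onto the
    closure of [D xi], the expectation is a compression, [e x e = G(x) e].

    That [D] has a faithful GNS representation means that it acts faithfully on the
    closure of [D xi]; then the commutant of [D] moves this space over all of [H]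
    ([commutant_cyclic_total]).  For [m] in [M] the map [y e h |-> y e m e h], [y] in
    the commutant of [D], is well defined and bounded ([induce]): the relations to be
    checked are weakly closed in [m], and for [m] in [B] the compression [e m e] is
    [G(m) e], where [G(m)] commutes with [y].  The resulting operator lies in the
    bicommutant of [D], which is [D], and this is the normal conditional expectation
    ([normal_expectation_ex]).

    For the induced representation, the normality of [kappa] yields enough bounded
    maps [f : H -> V] which intertwine [D] and [kappa] ([kappa_intertwiners]).  Each
    gives a bounded map [s xi |-> hat s (x) f xi] from [H] to [W] which intertwines [B]
    and [sigma].  Together they have dense ranges and no common kernel, and a family of
    intertwiners with these properties identifies the generated von Neumann algebras
    ([intertwiner_iso], [induced_rep_iso]).

    Normality is treated through the space [ell2 H]: ultraweakly continuous
    functionals are the vector functionals of the amplification ([uw_functionalP]), and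
    a family of intertwiners with dense ranges carries them back and forth
    ([vector_lift]).

    When both GNS representations are faithful, the two normal expectations agree with
    [G] on [Q], hence on [M] by density; so [x = E_F(x) = E_T(x)] is in [T] for [x] in
    [F].  A faithful state has a faithful GNS representation, and its restriction to
    [T], which is contained in [F], is faithful too. *)

(** * Norms and closures in a Hilbert space *)

Section Modulus.
Context (R : realType).
Implicit Types (z w : R[i]).

(** The modulus, and below the norm, with values in [R]: inequalities between
    them are then about an ordered field. *)
Definition cmod z : R := complex.Re `|z|.

Lemma cmodE z : `|z| = (cmod z)%:C%C.
Proof. by rewrite /cmod RRe_real ?ger0_real. Qed.

Lemma cmod_ge0 z : 0 <= cmod z.
Proof. by rewrite -lecR -cmodE normr_ge0. Qed.

Lemma cmodD z w : cmod (z + w) <= cmod z + cmod w.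
Proof. by rewrite -lecR rmorphD /= -!cmodE ler_normD. Qed.

Lemma cmodM z w : cmod (z * w) = cmod z * cmod w.
Proof. by apply: complexI; rewrite rmorphM /= -!cmodE normrM. Qed.

Lemma cmodN z : cmod (- z) = cmod z.
Proof. by rewrite /cmod normrN. Qed.

Lemma cmod0 : cmod 0 = 0.
Proof. by rewrite /cmod normr0. Qed.

Lemma cmod1 : cmod 1 = 1.
Proof. by rewrite /cmod normr1. Qed.

Lemma cmod0_eq0 z : cmod z = 0 -> z = 0.
Proof. by move=> h; apply/eqP; rewrite -normr_eq0 cmodE h. Qed.

Lemma cmod_conj z : cmod z^* = cmod z.
Proof. by rewrite /cmod norm_conjC. Qed.

Lemma cmod_real (r : R) : cmod r%:C%C = `|r|.
Proof. by rewrite /cmod normc_def /= expr0n addr0 sqrtr_sqr. Qed.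

Lemma Re_le_cmod z : complex.Re z <= cmod z.
Proof.
rewrite /cmod normc_def /= -[leLHS]addr0 (le_trans (ler_norm _)) // addr0.
by rewrite -sqrtr_sqr ler_wsqrtr // lerDl sqr_ge0.
Qed.

Lemma eq_of_small (z w : R[i]) (c : R) :
  (forall e : R, 0 < e -> cmod (z - w) <= e * c) -> z = w.
Proof.
move=> h; apply/eqP; rewrite -subr_eq0; apply/eqP; apply: cmod0_eq0.
apply/eqP; rewrite eq_le cmod_ge0 andbT leNgt; apply/negP => p.
have c0 : 0 < c.
  by have := lt_le_trans p (h 1 ltr01); rewrite mul1r.
have := h (cmod (z - w) / c / 2) ltac:(by rewrite !divr_gt0).
have -> : cmod (z - w) / c / 2 * c = cmod (z - w) / 2 by field; rewrite gt_eqF.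
lra.
Qed.

End Modulus.

(** Identities between linear combinations of vectors become [ring] on scalars. *)
Ltac hring := apply: inner_inj => ?;
  rewrite ?(innerDr, innerBr, innerNr, innerZr, inner0r); ring.

Definition is_subspace (R : realType) (V : lmodType R[i]) (X : set V) :=
  X 0 /\ forall (c : R[i]) x y, X x -> X y -> X (c *: x + y).

Section RealNorm.
Context (R : realType) (H : hilbertType R).
Implicit Types (x y h k : H) (c : R[i]) (X : set H).

Definition nr x : R := complex.Re `|x|.

Lemma nrE x : `|x| = (nr x)%:C%C.
Proof. by rewrite /nr RRe_real ?ger0_real. Qed.

Lemma nr_ge0 x : 0 <= nr x.
Proof. by rewrite -lecR -nrE normr_ge0. Qed.

Lemma nrD x y : nr (x + y) <= nr x + nr y.
Proof. by rewrite -lecR rmorphD /= -!nrE ler_normD. Qed.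

Lemma nrZ c x : nr (c *: x) = cmod c * nr x.
Proof. by apply: complexI; rewrite rmorphM /= -nrE -cmodE normrZ -nrE. Qed.

Lemma nrN x : nr (- x) = nr x.
Proof. by rewrite /nr normrN. Qed.

Lemma nrB x y : nr (x - y) = nr (y - x).
Proof. by rewrite -nrN opprB. Qed.

Lemma nr0 : nr 0 = 0.
Proof. by rewrite /nr normr0. Qed.

Lemma nr0_eq0 x : nr x = 0 -> x = 0.
Proof. by move=> h; apply/eqP; rewrite -normr_eq0 nrE h. Qed.

Lemma nr_gt0 x : x != 0 -> 0 < nr x.
Proof. by move=> x0; rewrite -ltcR -nrE normr_gt0. Qed.

Lemma nr_tri x y z : nr (x - z) <= nr (x - y) + nr (y - z).
Proof. by rewrite -[x - z](subrKA y) nrD. Qed.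

Lemma inner_nr x : inner x x = (nr x ^+ 2)%:C%C.
Proof. by rewrite -norm_inner nrE rmorphXn. Qed.

Lemma nr_sqE x : nr x ^+ 2 = complex.Re (inner x x).
Proof. by rewrite inner_nr. Qed.

Lemma cmod_inner x y : cmod (inner x y) <= nr x * nr y.
Proof. by rewrite -lecR rmorphM /= -!nrE -cmodE inner_CS. Qed.

Lemma inner_zero x : inner x x = 0 -> x = 0.
Proof. by move=> /eqP; rewrite inner_eq0 => /eqP. Qed.

Lemma nr_pyth x y : inner x y = 0 -> nr (x + y) ^+ 2 = nr x ^+ 2 + nr y ^+ 2.
Proof.
move=> h; rewrite !nr_sqE innerDl !innerDr h [inner y x]innerC h conjC0.
by rewrite addr0 add0r raddfD.
Qed.

Lemma inner_suml (I : Type) (s : seq I) (f : I -> H) y :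
  inner (\sum_(i <- s) f i) y = \sum_(i <- s) inner (f i) y.
Proof. by apply: (big_morph (inner^~ y)) => [? ?|]; rewrite ?innerDl ?inner0l. Qed.

Lemma inner_sumr (I : Type) (s : seq I) (f : I -> H) y :
  inner y (\sum_(i <- s) f i) = \sum_(i <- s) inner y (f i).
Proof. by apply: (big_morph (inner y)) => [? ?|]; rewrite ?innerDr ?inner0r. Qed.

Definition nlim (u : nat -> H) l := forall e : R, 0 < e ->
  exists N, forall n, (N <= n)%N -> nr (u n - l) < e.

Lemma ncauchy (u : nat -> H) :
  (forall e : R, 0 < e -> exists N, forall m n,
     (N <= m)%N -> (N <= n)%N -> nr (u m - u n) < e) ->
  exists l, nlim u l.
Proof.
have posP (e : R[i]) : 0 < e -> exists2 r : R, 0 < r & e = r%:C%C.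
  by move=> e0; exists (complex.Re e); rewrite -?ltcR ?RRe_real ?gtr0_real.
move=> uC; have u_cvg : cvgn (u : nat -> H).
  apply/cauchy_cvgP/cauchy_ballP => _ /posP[r r0 ->].
  have [N NP] := uC _ r0.
  exists (u @` [set n | (N <= n)%N], u @` [set n | (N <= n)%N]) => /=.
    by split; exists N => // n Nn; exists n.
  move=> [_ _] /= [[m Nm <-] [n Nn <-]]; rewrite -ball_normE /= nrE ltcR.
  exact: NP.
exists (limn u) => e e0.
have e0C : 0 < e%:C%C :> R[i] by rewrite ltcR.
have /cvgrPdist_lt/(_ _ e0C)[N _ NP] : u @ \oo --> limn u by exact: u_cvg.
by exists N => n /NP; rewrite nrE ltcR nrB.
Qed.

Definition adh X : set H :=
  [set x | forall e : R, 0 < e -> exists2 y, X y & nr (x - y) < e].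

Lemma adhE X : closure X = adh X.
Proof.
apply/seteqP; split=> x /=.
  move=> cx e e0; have e0C : 0 < e%:C%C :> R[i] by rewrite ltcR.
  have [y [Xy]] := cx _ (nbhsx_ballx x _ e0C).
  by rewrite -ball_normE /= nrE ltcR => ?; exists y.
move=> ax B /nbhs_ballP[e e0 eB].
have [y Xy xy] : exists2 y, X y & nr (x - y) < complex.Re e.
  by apply: ax; rewrite -ltcR RRe_real // gtr0_real.
exists y; split => //; apply: eB; rewrite -ball_normE /= nrE.
by rewrite -[e]RRe_real ?gtr0_real // ltcR.
Qed.

Definition orth X h := forall x, X x -> inner x h = 0.

Definition is_total X := forall h, orth X h -> h = 0.

Lemma sub_adh X x : X x -> adh X x.
Proof. by move=> Xx e e0; exists x => //; rewrite subrr nr0. Qed.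

Lemma orth_adh X h : orth X h -> orth (adh X) h.
Proof.
move=> o x ax; apply: (@eq_of_small _ _ _ (nr h)) => e e0.
have [y Xy xy] := ax _ e0.
rewrite subr0 -[x](subrK y) innerDl (o _ Xy) addr0.
by rewrite (le_trans (cmod_inner _ _)) // ler_wpM2r ?nr_ge0 ?ltW.
Qed.

Lemma total_adh X : adh X = setT -> is_total X.
Proof.
move=> aX h /orth_adh; rewrite aX => /(_ h I); exact: inner_zero.
Qed.

Lemma subspace_adh X : is_subspace X -> is_subspace (adh X).
Proof.
move=> [X0 XL]; split; first exact: sub_adh.
move=> c x y ax ay e e0.
have c1 : 0 < cmod c + 1 by rewrite ltr_wpDl ?cmod_ge0.
have [x' Xx' hx] := ax (e / 2 / (cmod c + 1)) ltac:(by rewrite !divr_gt0).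
have [y' Xy' hy] := ay (e / 2) ltac:(by rewrite !divr_gt0).
exists (c *: x' + y'); first exact: XL.
rewrite opprD addrACA -scalerBr (le_lt_trans (nrD _ _)) // nrZ.
move: hx; rewrite ltr_pdivlMr // mulrDr mulr1 mulrC => hx.
by move: (nr_ge0 (x - x')) => ?; lra.
Qed.

Lemma inv_natS_lt (r : R) : 0 < r ->
  exists N, forall n, (N <= n)%N -> n.+1%:R^-1 < r.
Proof.
move=> r0; have [N _ NP] := near_infty_natSinv_lt (PosNum r0).
by exists N => n /NP.
Qed.

End RealNorm.

(** * Hilbert spaces from inner products, closed subspaces *)

(** A Hilbert space from its inner product; completeness is asked for sequences,
    and phrased with the square of the norm. *)
HB.factory Record isHilbertSpace (R : realType) V of GRing.Lmodule R[i] V := {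
  ip : V -> V -> R[i];
  ipDl : forall x y z, ip (x + y) z = ip x z + ip y z;
  ipZl : forall (c : R[i]) x z, ip (c *: x) z = c * ip x z;
  ipC : forall x y, ip y x = (ip x y)^*;
  ip_ge0 : forall x, 0 <= ip x x;
  ip_eq0 : forall x, ip x x = 0 -> x = 0;
  ip_complete : forall u : nat -> V,
    (forall e : R, 0 < e -> exists N, forall m n, (N <= m)%N -> (N <= n)%N ->
       complex.Re (ip (u m - u n) (u m - u n)) < e ^+ 2) ->
    exists l, forall e : R, 0 < e -> exists N, forall n, (N <= n)%N ->
       complex.Re (ip (u n - l) (u n - l)) < e ^+ 2;
  ip_nz : exists x : V, x != 0
}.

HB.builders Context (R : realType) V of isHilbertSpace R V.

Let q (x : V) : R := complex.Re (ip x x).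

Let qE x : ip x x = (q x)%:C%C.
Proof. by rewrite /q RRe_real // ger0_real // ip_ge0. Qed.

Let q0 x : 0 <= q x.
Proof. by rewrite -lecR -qE ip_ge0. Qed.

Let ipDr x y z : ip x (y + z) = ip x y + ip x z.
Proof. by rewrite ipC ipDl rmorphD /= -!ipC. Qed.

Let ipZr c x y : ip x (c *: y) = c^* * ip x y.
Proof. by rewrite ipC ipZl rmorphM /= -ipC. Qed.

Let nm (x : V) : R[i] := (Num.sqrt (q x))%:C%C.

Let nm_sq x : nm x ^+ 2 = ip x x.
Proof. by rewrite /nm -rmorphXn /= sqr_sqrtr ?q0 // qE. Qed.

Let nm0 x : 0 <= nm x.
Proof. by rewrite /nm lecR sqrtr_ge0. Qed.

Let ip0l y : ip 0 y = 0.
Proof. by have := ipZl 0 0 y; rewrite scale0r mul0r. Qed.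

Let ip0r y : ip y 0 = 0.
Proof. by rewrite ipC ip0l conjC0. Qed.

Let CS x y : `|ip x y| <= nm x * nm y.
Proof.
have [->|y0] := eqVneq y 0; first by rewrite ip0r normr0 mulr_ge0.
have qy : 0 < ip y y.
  by rewrite lt_def ip_ge0 andbT; apply: contraNneq y0 => /ip_eq0 ->.
pose t := ip x y / ip y y.
have e : ip (x + (- t) *: y) y = 0.
  by rewrite ipDl ipZl mulNr /t divfK ?gt_eqF // subrr.
have := ip_ge0 (x + (- t) *: y).
rewrite ipDr ipZr e mulr0 addr0 ipDl ipZl mulNr subr_ge0 /t mulrAC.
rewrite (ipC x y) -normCK ler_pdivrMr // -!nm_sq -exprMn.
by rewrite ler_pXn2r // ?nnegrE ?mulr_ge0.
Qed.

Let nmD x y : nm (x + y) <= nm x + nm y.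
Proof.
rewrite -(@ler_pXn2r _ 2) // ?nnegrE ?addr_ge0 // nm_sq sqrrD !nm_sq.
have -> : ip (x + y) (x + y) = ip x x + (ip x y + (ip x y)^*) + ip y y.
  by rewrite ipDl !ipDr -ipC !addrA.
have r : ip x y + (ip x y)^* \is Num.real.
  by rewrite CrealE rmorphD /= conjCK addrC.
rewrite lerD2r lerD2l (le_trans (real_ler_norm r)) //.
by rewrite (le_trans (ler_normD _ _)) // norm_conjC -mulr2n lerMn2r CS orbT.
Qed.

Let nmZ (c : R[i]) x : nm (c *: x) = `|c| * nm x.
Proof.
apply: (@pexpIrn _ 2) => //; rewrite ?nnegrE ?mulr_ge0 //.
by rewrite exprMn !nm_sq ipZl ipZr mulrA normCK.
Qed.

Let nm_eq0 x : nm x = 0 -> x = 0.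
Proof. by move=> h; apply: ip_eq0; rewrite -nm_sq h expr0n. Qed.

HB.instance Definition _ := Lmodule_isNormed.Build R[i] V nmD nmZ nm_eq0.

Let normE (x : V) : `|x| = nm x.
Proof. by []. Qed.

Let Vcomplete (F : set_system V) : ProperFilter F -> cauchy F -> cvg F.
Proof.
move=> FF /cauchyP FC.
have small (r : R) x : 0 < r -> (`|x| < r%:C%C) = (q x < r ^+ 2).
  move=> r0; have r0' : 0 < r%:C%C :> R[i] by rewrite ltcR.
  rewrite normE -(@ltr_pXn2r _ 2) // ?nnegrE ?nm0 ?(ltW r0') //.
  by rewrite nm_sq qE -rmorphXn ltcR.
have /choice[u uP] (n : nat) : exists x, F (ball x (n.+1%:R^-1 : R)%:C%C).
  by apply: FC; rewrite ltcR invr_gt0.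
have inv_lt (r : R) : 0 < r -> exists N, forall n, (N <= n)%N -> n.+1%:R^-1 < r.
  move=> r0; have [N _ NP] := near_infty_natSinv_lt (PosNum r0).
  by exists N => n /NP.
have near m n : `|u m - u n| < (m.+1%:R^-1 + n.+1%:R^-1 : R)%:C%C.
  have [y []] := filter_ex (filterI (uP m) (uP n)).
  rewrite -!ball_normE /= => h1 h2.
  rewrite -[u m - _](subrKA y) rmorphD (le_lt_trans (ler_normD _ _)) //.
  by rewrite ltrD // distrC.
have [l lP] : exists l, forall e : R, 0 < e ->
    exists N, forall n, (N <= n)%N -> q (u n - l) < e ^+ 2.
  apply: ip_complete => e e0; have e2 : 0 < e / 2 by rewrite divr_gt0.
  have [N NP] := inv_lt _ e2; exists N => m n Nm Nn; rewrite -/(q _) -small //.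
  rewrite (lt_trans (near m n)) // ltcR.
  by move: (NP _ Nm) (NP _ Nn); move: (m.+1%:R^-1) (n.+1%:R^-1) => a b ? ?; lra.
apply/cvg_ex; exists l => /=; apply/cvgrPdist_lt => e e0.
have eE : e = (complex.Re e)%:C%C by rewrite RRe_real // gtr0_real.
have e1 : 0 < complex.Re e / 2 by rewrite divr_gt0 // -ltcR -eE.
have [N1 NP1] := inv_lt _ e1; have [N2 NP2] := lP _ e1.
pose n := maxn N1 N2; apply: filterS (uP n) => x; rewrite -ball_normE /= => h.
rewrite -[l - x](subrKA (u n)) (le_lt_trans (ler_normD _ _)) //.
rewrite eE [X in X%:C%C]splitr rmorphD ltrD //.
  by rewrite distrC small // NP2 // leq_maxr.
by rewrite (lt_trans h) // ltcR NP1 // leq_maxl.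
Qed.

HB.instance Definition _ := Uniform_isComplete.Build V Vcomplete.

Let norm_ip (x : V) : `|x| ^+ 2 = ip x x.
Proof. exact: nm_sq. Qed.

HB.instance Definition _ := hasInner.Build R V ipDl ipZl ipC norm_ip ip_nz.

HB.end.

Section Subspace.
Context (R : realType) (V : lmodType R[i]).

Record subm (P : set V) (hP : is_subspace P) := Subm { subm_val :> V; subm_in : P subm_val }.

Context (P : set V) (hP : is_subspace P).
Local Notation W := (subm hP).

Lemma submP (x y : W) : x = y :> V -> x = y.
Proof.
case: x y => x hx [y hy] /= e; rewrite e in hx *; congr Subm; exact: Prop_irrelevance.
Qed.

HB.instance Definition _ := gen_eqMixin W.
HB.instance Definition _ := gen_choiceMixin W.

Lemma subspaceD x y : P x -> P y -> P (x + y).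
Proof. by move=> Px Py; rewrite -[x]scale1r; apply: (proj2 hP). Qed.

Lemma subspaceZ c x : P x -> P (c *: x).
Proof. by move=> Px; rewrite -[_ *: _]addr0; apply: (proj2 hP) => //; case: hP. Qed.

Let zero : W := Subm hP (proj1 hP).
Let add (x y : W) : W := Subm hP (subspaceD (subm_in x) (subm_in y)).
Let scale c (x : W) : W := Subm hP (subspaceZ c (subm_in x)).
Let opp (x : W) : W := scale (-1) x.

Fact subm_addA : associative add.
Proof. by move=> x y z; apply: submP; rewrite /= addrA. Qed.
Fact subm_addC : commutative add.
Proof. by move=> x y; apply: submP; rewrite /= addrC. Qed.
Fact subm_add0 : left_id zero add.
Proof. by move=> x; apply: submP; rewrite /= add0r. Qed.
Fact subm_addN : left_inverse zero opp add.
Proof. by move=> x; apply: submP; rewrite /= scaleN1r addNr. Qed.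

HB.instance Definition _ :=
  GRing.isZmodule.Build W subm_addA subm_addC subm_add0 subm_addN.

Fact subm_scaleA c d (x : W) : scale c (scale d x) = scale (c * d) x.
Proof. by apply: submP; rewrite /= scalerA. Qed.
Fact subm_scale1 : left_id 1 scale.
Proof. by move=> x; apply: submP; rewrite /= scale1r. Qed.
Fact subm_scaleDr : right_distributive scale +%R.
Proof. by move=> c x y; apply: submP; rewrite /= scalerDr. Qed.
Fact subm_scaleDl (x : W) : {morph scale^~ x : a b / a + b}.
Proof. by move=> a b; apply: submP; rewrite /= scalerDl. Qed.

HB.instance Definition _ := GRing.Zmodule_isLmodule.Build R[i] W
  subm_scaleA subm_scale1 subm_scaleDr subm_scaleDl.

Lemma submB (x y : W) : subm_val (x - y) = subm_val x - subm_val y.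
Proof.
have -> : subm_val (x - y) = subm_val x + (-1) *: subm_val y by [].
by rewrite scaleN1r.
Qed.

End Subspace.

Section ClosedSubspace.
Context (R : realType) (H : hilbertType R) (X : set H).
Hypotheses (lX : is_subspace X) (nzX : exists2 x, X x & x != 0).

(** The proof that [X] is not the zero subspace is an index, as Hilbert spaces are
    nonzero. *)
Definition clsub (_ : exists2 x, X x & x != 0) := subm (subspace_adh lX).
Local Notation W := (clsub nzX).
HB.instance Definition _ := GRing.Lmodule.on W.

Definition clsub_val (x : W) : H := @subm_val _ _ _ (subspace_adh lX) x.

Let ip (x y : W) : R[i] := inner (clsub_val x) (clsub_val y).

Let valB (x y : W) : clsub_val (x - y) = clsub_val x - clsub_val y.
Proof. exact: submB. Qed.

Fact clsub_complete (u : nat -> W) :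
    (forall e : R, 0 < e -> exists N, forall m n, (N <= m)%N -> (N <= n)%N ->
       complex.Re (ip (u m - u n) (u m - u n)) < e ^+ 2) ->
    exists l : W, forall e : R, 0 < e -> exists N, forall n, (N <= n)%N ->
       complex.Re (ip (u n - l) (u n - l)) < e ^+ 2.
Proof.
have small (x : H) (e : R) : 0 < e -> (complex.Re (inner x x) < e ^+ 2) = (nr x < e).
  by move=> e0; rewrite -nr_sqE ltr_sqr ?nnegrE ?nr_ge0 // ltW.
move=> uC; have [l lP] : exists l : H, nlim (fun n => clsub_val (u n)) l.
  apply: ncauchy => e e0; have [N NP] := uC _ e0; exists N => m n Nm Nn.
  by have := NP _ _ Nm Nn; rewrite /ip valB small.
have al : adh X l.
  move=> e e0; have e2 : 0 < e / 2 by rewrite divr_gt0.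
  have [N NP] := lP _ e2; have [x Xx hx] := subm_in (u N) _ e2.
  exists x => //; rewrite (le_lt_trans (nr_tri _ (clsub_val (u N)) _)) // nrB.
  by move: (NP N (leqnn N)) => ?; lra.
exists (Subm (subspace_adh lX) al : W) => e e0; have [N NP] := lP _ e0.
by exists N => n Nn; rewrite /ip valB small // NP.
Qed.

Fact clsub_eq0 (x : W) : ip x x = 0 -> x = 0.
Proof. by move=> /inner_zero h; apply: submP. Qed.

Fact clsub_nz : exists x : W, x != 0.
Proof.
have [x Xx x0] := nzX; exists (Subm (subspace_adh lX) (sub_adh Xx) : W).
by apply: contraNneq x0 => /(congr1 clsub_val) /= ->.
Qed.

HB.instance Definition _ := @isHilbertSpace.Build R W ip
  (fun x y z : W => innerDl (clsub_val x) (clsub_val y) (clsub_val z))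
  (fun (c : R[i]) (x z : W) => innerZl c (clsub_val x) (clsub_val z))
  (fun x y : W => innerC (clsub_val x) (clsub_val y)) (fun x : W => inner_ge0 (clsub_val x))
  clsub_eq0 clsub_complete clsub_nz.

End ClosedSubspace.

(** * Orthogonal projections *)

Section OrthogonalProjection.
Context (R : realType) (H : hilbertType R).
Implicit Types (x y h k : H) (c : R[i]) (X : set H).

Record is_proj (X : set H) (P : bop H) : Prop := {
  proj_adh : forall x, adh X (P x);
  proj_orth : forall x y, X y -> inner (x - P x) y = 0
}.

(** The functional [y |-> <y, x>] on the closure of [X], a Hilbert space, is
    represented by some [z]. *)
Lemma proj_point X : is_subspace X -> forall x,
  exists z, adh X z /\ forall y, X y -> inner (x - z) y = 0.
Proof.
move=> lX x; have [nz|z0] := pselect (exists2 y, X y & y != 0); last first.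
  exists 0; split; first by apply: sub_adh; case: lX.
  move=> y Xy; have [->|y0] := eqVneq y 0; first by rewrite inner0r.
  by case: z0; exists y.
have [||z zP] := @riesz R (clsub lX nz) (fun y : clsub lX nz => inner (clsub_val y) x).
- by move=> c y y'; rewrite -innerZl -innerDl.
- exists `|x| => y; rewrite (le_trans (inner_CS _ _)) // mulrC.
  suff -> : `|clsub_val y| = `|y| by [].
  by apply/eqP; rewrite -(@eqrXn2 _ 2) ?normr_ge0 // !norm_inner.
exists (clsub_val z); split; first exact: (subm_in (z : subm (subspace_adh lX))).
move=> y Xy; have := zP (Subm (subspace_adh lX) (sub_adh Xy)) => h.
have {}h : inner y x = inner y (clsub_val z) by exact: h.
by rewrite innerC innerBr h subrr conjC0.
Qed.

Lemma adh_orth0 X x y : is_subspace X -> adh X x -> adh X y ->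
  (forall z, X z -> inner z (x - y) = 0) -> x = y.
Proof.
move=> lX ax ay /orth_adh h; apply/eqP; rewrite -subr_eq0; apply/eqP.
apply: inner_zero; apply: h.
by rewrite addrC -scaleN1r; have [_] := subspace_adh lX; apply.
Qed.

Lemma proj_exists X : is_subspace X -> exists P, is_proj X P.
Proof.
move=> lX; have /choice[p pP] := proj_point lX.
have orth_p x y : X y -> inner y (x - p x) = 0.
  by move=> Xy; rewrite innerC (proj2 (pP x)) // conjC0.
have lin : linear p.
  move=> c x y; apply: (adh_orth0 lX).
  - exact: (proj1 (pP _)).
  - by have [_] := subspace_adh lX; apply; exact: (proj1 (pP _)).
  move=> z Xz.
  have -> : p (c *: x + y) - (c *: p x + p y) =
      c *: (x - p x) + (y - p y) - (c *: x + y - p (c *: x + y)).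
    by hring.
  by rewrite innerBr innerDr innerZr !orth_p // mulr0 addr0 subr0.
have bd : exists c : R[i], forall x, `|p x| <= c * `|x|.
  exists 1 => x; rewrite mul1r !nrE lecR.
  have h : inner (p x) (x - p x) = 0.
    apply: orth_adh (proj1 (pP x)) => y Xy; exact: orth_p.
  have := nr_pyth h; rewrite addrC subrK => e.
  rewrite -ler_sqr ?nnegrE ?nr_ge0 // e lerDl sqr_ge0 //.
exists (Bop lin bd); split=> x /=; first exact: (proj1 (pP x)).
exact: (proj2 (pP x)).
Qed.

End OrthogonalProjection.

(** * Bounded maps and the operator norm *)

Section BoundedMaps.
Context (R : realType).

Definition blin (H K : hilbertType R) (f : H -> K) :=
  linear f /\ exists2 c : R, 0 <= c & forall x, nr (f x) <= c * nr x.

Definition adj_pair (H K : hilbertType R) (f : H -> K) (g : K -> H) :=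
  forall x y, inner (f x) y = inner x (g y).

Lemma linD (U V : lmodType R[i]) (f : U -> V) x y :
  linear f -> f (x + y) = f x + f y.
Proof. by move=> /(_ 1 x y); rewrite !scale1r. Qed.

Lemma lin0 (U V : lmodType R[i]) (f : U -> V) : linear f -> f 0 = 0.
Proof. by move=> l; apply: (addrI (f 0)); rewrite -linD // !addr0. Qed.

Lemma linZ (U V : lmodType R[i]) (f : U -> V) c x :
  linear f -> f (c *: x) = c *: f x.
Proof. by move=> l; rewrite -[c *: x]addr0 l lin0 // addr0. Qed.

Lemma linB (U V : lmodType R[i]) (f : U -> V) x y :
  linear f -> f (x - y) = f x - f y.
Proof. by move=> l; rewrite addrC -scaleN1r l scaleN1r addrC. Qed.

Lemma le_of_small (a b c : R) :
  (forall e : R, 0 < e -> a <= b + e * c) -> a <= b.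
Proof.
move=> h; rewrite leNgt; apply/negP => ba.
have c0 : 0 < c by have := h 1 ltr01; rewrite mul1r => ?; lra.
have := h ((a - b) / 2 / c) ltac:(by rewrite !divr_gt0 // subr_gt0).
by rewrite divfK ?gt_eqF // => ?; lra.
Qed.

Lemma blin_adj (H K : hilbertType R) (f : H -> K) :
  blin f -> exists2 g, blin g & adj_pair f g.
Proof.
move=> [fl [c c0 cP]].
have /choice[g gP] (y : K) : exists z, forall x, inner (f x) y = inner x z.
  apply: (@riesz R H (fun x => inner (f x) y)).
    by move=> a u v; rewrite fl innerDl innerZl.
  exists (c * nr y)%:C%C => x; rewrite cmodE nrE -rmorphM lecR.
  by rewrite (le_trans (cmod_inner _ _)) // mulrAC ler_wpM2r // nr_ge0.
exists g; last by move=> x y; rewrite gP.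
split; first by move=> a u v; apply: inner_inj => x; rewrite -gP !innerDr !innerZr -!gP.
exists c => // y; have := nr_ge0 (g y); rewrite le_eqVlt => /predU1P[<-|g0].
  by rewrite mulr_ge0 ?nr_ge0.
rewrite -(ler_pM2r g0) -expr2 nr_sqE -gP (le_trans (Re_le_cmod _)) //.
by rewrite (le_trans (cmod_inner _ _)) // mulrAC ler_wpM2r ?nr_ge0.
Qed.

Lemma adj_pairC (H K : hilbertType R) (f : H -> K) g :
  adj_pair f g -> adj_pair g f.
Proof. by move=> h x y; rewrite innerC -h -innerC. Qed.

Lemma blin_comp (H K L : hilbertType R) (f : K -> L) (g : H -> K) :
  blin f -> blin g -> blin (f \o g).
Proof.
move=> [fl [c c0 cP]] [gl [d d0 dP]]; split.
  by move=> a x y /=; rewrite gl fl.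
exists (c * d); first by rewrite mulr_ge0.
by move=> x /=; rewrite (le_trans (cP _)) // -mulrA ler_wpM2l.
Qed.

Lemma bop_blin (H : hilbertType R) (T : bop H) : blin T.
Proof.
split; first exact: bop_linear.
have [c c0 cP] := bop_bound T.
have cE : c = (complex.Re c)%:C%C by rewrite RRe_real // ger0_real.
exists (complex.Re c); first by rewrite -lecR -cE.
by move=> x; rewrite -lecR rmorphM /= -cE -!nrE.
Qed.

Lemma blin_bop (H : hilbertType R) (f : H -> H) :
  blin f -> exists T : bop H, forall x, T x = f x.
Proof.
move=> [fl [c c0 cP]].
have fb : exists c : R[i], forall x, `|f x| <= c * `|x|.
  by exists c%:C%C => x; rewrite !nrE -rmorphM lecR.
by exists (Bop fl fb).
Qed.

(** [P] is [f^* f]. *)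
Lemma gram_op (H K : hilbertType R) (f : H -> K) : blin f ->
  exists P : bop H, forall x y, inner (P x) y = inner (f x) (f y).
Proof.
move=> bf; have [g bg fg] := blin_adj bf.
have [P PE] := blin_bop (blin_comp bg bf).
by exists P => x y; rewrite PE /= (adj_pairC fg).
Qed.

Lemma total_dense (H : hilbertType R) (X : set H) :
  is_subspace X -> is_total X -> adh X = setT.
Proof.
move=> lX tX; apply/seteqP; split=> // x _.
have [P [aP oP]] := proj_exists lX.
have := tX (x - P x); move=> h; rewrite -[x](subrK (P x)) h ?add0r //.
by move=> y Xy; rewrite innerC oP // conjC0.
Qed.

(** Extension by continuity.  The map is given by its graph because the vectors of
    its domain, finite sums most of the time, have several presentations. *)
Lemma graph_ext (H K : hilbertType R) (D : H -> K -> Prop) (c : R) : 0 <= c ->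
  D 0 0 ->
  (forall a x y x' y', D x y -> D x' y' -> D (a *: x + x') (a *: y + y')) ->
  (forall x y, D x y -> nr y <= c * nr x) ->
  is_total (fun x => exists y, D x y) ->
  exists2 f : H -> K, blin f & forall x y, D x y -> f x = y.
Proof.
move=> c0 D0 DL Dc tD.
have lD : is_subspace (fun x => exists y, D x y).
  split; first by exists 0.
  by move=> a x y [x' Dx] [y' Dy]; exists (a *: x' + y'); apply: DL.
have aD := total_dense lD tD.
pose P h k := forall e : R, 0 < e ->
  exists x y, [/\ D x y, nr (h - x) < e & nr (k - y) < e].
have DP x y : D x y -> P x y.
  by move=> Dxy e e0; exists x, y; rewrite !subrr !nr0.
have P_bound h k : P h k -> nr k <= c * nr h.
  move=> Phk; apply: (@le_of_small _ _ (1 + c)) => e e0.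
  have [x [y [Dxy hx ky]]] := Phk _ e0.
  have h1 : nr k <= nr (k - y) + nr y by rewrite -{1}[k](subrK y) nrD.
  have h2 : nr x <= nr (h - x) + nr h by rewrite nrB -{1}[x](subrK h) nrD.
  have h3 : c * nr x <= c * (e + nr h).
    by rewrite ler_wpM2l // (le_trans h2) // lerD2r ltW.
  move: (Dc _ _ Dxy) => h4; rewrite mulrDr mulr1 [e * c]mulrC.
  move: h3; rewrite mulrDr => h3; lra.
have P_lin a h k h' k' : P h k -> P h' k' -> P (a *: h + h') (a *: k + k').
  move=> Phk Phk' e e0.
  have a1 : 0 < cmod a + 1 by rewrite ltr_wpDl ?cmod_ge0.
  have [x [y [Dxy hx ky]]] :=
    Phk (e / 2 / (cmod a + 1)) ltac:(by rewrite !divr_gt0).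
  have [x' [y' [Dxy' hx' ky']]] := Phk' (e / 2) ltac:(by rewrite !divr_gt0).
  exists (a *: x + x'), (a *: y + y'); split; first exact: DL.
    rewrite opprD addrACA -scalerBr (le_lt_trans (nrD _ _)) // nrZ.
    move: hx; rewrite ltr_pdivlMr // mulrDr mulr1 mulrC => hx.
    by move: (nr_ge0 (h - x)) => ?; lra.
  rewrite opprD addrACA -scalerBr (le_lt_trans (nrD _ _)) // nrZ.
  move: ky; rewrite ltr_pdivlMr // mulrDr mulr1 mulrC => ky.
  by move: (nr_ge0 (k - y)) => ?; lra.
have P_fun h k k' : P h k -> P h k' -> k = k'.
  move=> Pk Pk'; have := P_lin (-1) _ _ _ _ Pk' Pk.
  rewrite !scaleN1r addNr [- _ + _]addrC => /P_bound; rewrite nr0 mulr0 => h0.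
  by apply/eqP; rewrite -subr_eq0; apply/eqP/nr0_eq0/le_anti; rewrite h0 nr_ge0.
have /choice[f fP] h : exists k, P h k.
  have /choice[u uP] n : exists xy : H * K,
      D xy.1 xy.2 /\ nr (h - xy.1) < n.+1%:R^-1.
    have : adh (fun x => exists y, D x y) h by rewrite aD.
    by move=> /(_ n.+1%:R^-1 ltac:(by rewrite invr_gt0))[x [y Dxy] hx]; exists (x, y).
  have c1 : 0 < c + 1 by rewrite ltr_wpDl.
  have [k kP] : exists k, nlim (fun n => (u n).2) k.
    apply: ncauchy => e e0.
    have e1 : 0 < e / (c + 1) / 2 by rewrite !divr_gt0.
    have [N NP] := inv_natS_lt e1.
    exists N => m n Nm Nn.
    have [[Dm um] [Dn un]] := (uP m, uP n).
    have Dmn : D ((u m).1 - (u n).1) ((u m).2 - (u n).2).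
      by have := DL (-1) _ _ _ _ Dn Dm; rewrite !scaleN1r ![- _ + _]addrC.
    have h1 := nr_tri (u m).1 h (u n).1; rewrite nrB in um.
    have h2 : nr ((u m).1 - (u n).1) < e / (c + 1).
      move: (NP _ Nm) (NP _ Nn) um un h1.
      move: (m.+1%:R^-1) (n.+1%:R^-1) (e / (c + 1)) => a b q.
      by move: (nr _) (nr _) (nr _) => *; lra.
    rewrite (le_lt_trans (Dc _ _ Dmn)) //; move: h2; rewrite ltr_pdivlMr //.
    by rewrite mulrDr mulr1 mulrC; move: (nr_ge0 ((u m).1 - (u n).1)) => ? ?; lra.
  exists k => e e0; have [N1 NP1] := kP _ e0; have [N2 NP2] := inv_natS_lt e0.
  pose n := maxn N1 N2; exists (u n).1, (u n).2; have [Dn un] := uP n; split => //.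
    by rewrite (lt_trans un) // NP2 // leq_maxr.
  by rewrite nrB NP1 // leq_maxl.
exists f => [|x y Dxy]; last exact: P_fun (fP x) (DP _ _ Dxy).
split; last by exists c => // x; exact: P_bound.
by move=> a x y; apply: P_fun (fP _) _; exact: P_lin.
Qed.

Lemma blin_total_eq (K L : hilbertType R) (f g : K -> L) (X : set K) :
  blin f -> blin g -> is_total X -> (forall x, X x -> f x = g x) -> f =1 g.
Proof.
move=> bf bg tX fg x; have [f' _ af] := blin_adj bf; have [g' _ ag] := blin_adj bg.
apply: inner_inj => y; rewrite innerC [RHS]innerC; congr (_^*); rewrite af ag.
congr (inner _ _); apply/eqP; rewrite -subr_eq0; apply/eqP; apply: tX => z Xz.
by rewrite innerBr -af -ag fg // subrr.
Qed.

End BoundedMaps.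

Section OperatorNorm.
Context (R : realType) (H : hilbertType R).
Implicit Types (S T : bop H) (B X Y : set (bop H)) (x y : H) (c : R).

Lemma bopB S T x : (S - T) x = S x - T x.
Proof.
have -> : (S - T) x = S x + (-1) *: T x by [].
by rewrite scaleN1r.
Qed.

Lemma bopM S T x : (S * T) x = S (T x).
Proof. by []. Qed.

Lemma opnorm_has_sup T :
  has_sup [set complex.Re `|T x| | x in [set x | `|x| <= 1]].
Proof.
split; first by exists (complex.Re `|T 0|), 0 => //=; rewrite normr0 ler01.
have [_ [c c0 cP]] := bop_blin T; exists c => _ [x /= x1 <-].
rewrite (le_trans (cP x)) // -[leRHS]mulr1 ler_wpM2l // -lecR -nrE //.
Qed.

Lemma opnorm_ge0 T : 0 <= opnorm T.
Proof.
have [_ h] := opnorm_has_sup T; apply: (ub_le_sup h).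
by exists 0; rewrite /= ?normr0 ?ler01 // bop0 normr0.
Qed.

Lemma opnormP T x : nr (T x) <= opnorm T * nr x.
Proof.
have [->|x0] := eqVneq x 0; first by rewrite bop0 nr0 mulr0.
have n0 := nr_gt0 x0.
have [_ h] := opnorm_has_sup T.
have : nr (T ((nr x)^-1%:C%C *: x)) <= opnorm T.
  apply: (ub_le_sup h); eexists => //=.
  by rewrite nrE nrZ cmod_real ger0_norm ?invr_ge0 ?nr_ge0 // mulVf ?gt_eqF.
rewrite bopZ nrZ cmod_real ger0_norm ?invr_ge0 ?nr_ge0 //.
by rewrite mulrC ler_pdivrMr.
Qed.

Lemma opnorm_le T c : 0 <= c -> (forall x, nr (T x) <= c * nr x) -> opnorm T <= c.
Proof.
move=> c0 cP; apply: ge_sup; first by have [] := opnorm_has_sup T.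
move=> _ [x /= x1 <-]; rewrite (le_trans (cP x)) //.
by rewrite -[leRHS]mulr1 ler_wpM2l // -lecR -nrE.
Qed.

Lemma opnormD S T : opnorm (S + T) <= opnorm S + opnorm T.
Proof.
apply: opnorm_le; rewrite ?addr_ge0 ?opnorm_ge0 // => x.
by rewrite mulrDl (le_trans (nrD _ _)) // lerD ?opnormP.
Qed.

Lemma opnormM S T : opnorm (S * T) <= opnorm S * opnorm T.
Proof.
apply: opnorm_le; rewrite ?mulr_ge0 ?opnorm_ge0 // => x.
by rewrite bopM (le_trans (opnormP _ _)) // -mulrA ler_wpM2l ?opnorm_ge0 ?opnormP.
Qed.

Lemma opnorm0_eq0 T : opnorm T = 0 -> T = 0.
Proof.
move=> T0; apply: bopP => x; apply: nr0_eq0; apply/le_anti.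
by rewrite nr_ge0 andbT; have := opnormP T x; rewrite T0 mul0r.
Qed.

Lemma opnorm0 : opnorm (0 : bop H) = 0.
Proof.
by apply/le_anti; rewrite opnorm_ge0 opnorm_le // => x; rewrite nr0 mul0r.
Qed.

Lemma opnormZ (a : R[i]) T : opnorm (a *: T) = cmod a * opnorm T.
Proof.
have le b S : opnorm (b *: S) <= cmod b * opnorm S.
  apply: opnorm_le; rewrite ?mulr_ge0 ?cmod_ge0 ?opnorm_ge0 // => x.
  by rewrite nrZ -mulrA ler_wpM2l ?cmod_ge0 ?opnormP.
have [->|a0] := eqVneq a 0; first by rewrite scale0r cmod0 mul0r opnorm0.
apply/le_anti; rewrite le /=.
have := le a^-1 (a *: T); rewrite scalerA mulVf // scale1r.
have a1 : 0 < cmod a by rewrite -ltcR -cmodE normr_gt0.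
have -> : cmod a^-1 = (cmod a)^-1.
  by apply: (mulIf (lt0r_neq0 a1)); rewrite -cmodM mulVf // cmod1 mulVf ?gt_eqF.
by rewrite mulrC ler_pdivlMr // mulrC.
Qed.

Lemma opnormN T : opnorm (- T) = opnorm T.
Proof. by rewrite -scaleN1r opnormZ cmodN cmod1 mul1r. Qed.

Lemma opnormB S T : opnorm (S - T) = opnorm (T - S).
Proof. by rewrite -opnormN opprB. Qed.

Lemma opnorm_star_le T : opnorm (star T) <= opnorm T.
Proof.
apply: opnorm_le => [|x]; first exact: opnorm_ge0.
have := nr_ge0 (star T x); rewrite le_eqVlt => /predU1P[<-|g0].
  by rewrite mulr_ge0 ?nr_ge0 ?opnorm_ge0.
rewrite -(ler_pM2r g0) -expr2 nr_sqE -bop_starE (le_trans (Re_le_cmod _)) //.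
rewrite (le_trans (cmod_inner _ _)) // mulrAC ler_wpM2r ?nr_ge0 //.
exact: opnormP.
Qed.

Lemma opnorm_star T : opnorm (star T) = opnorm T.
Proof.
by apply/le_anti; rewrite opnorm_star_le -{1}[T]starK opnorm_star_le.
Qed.

Lemma opnorm_cstar T : opnorm (star T * T) = opnorm T ^+ 2.
Proof.
apply/le_anti; rewrite (le_trans (opnormM _ _)) ?opnorm_star ?expr2 //=.
set c := opnorm (star T * T); have c0 : 0 <= c by exact: opnorm_ge0.
rewrite -expr2 -[leRHS]sqr_sqrtr // ler_sqr ?nnegrE ?sqrtr_ge0 ?opnorm_ge0 //.
apply: opnorm_le => [|x]; first exact: sqrtr_ge0.
rewrite -ler_sqr ?nnegrE ?mulr_ge0 ?sqrtr_ge0 ?nr_ge0 //.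
rewrite exprMn sqr_sqrtr // nr_sqE bop_starE (le_trans (Re_le_cmod _)) //.
rewrite (le_trans (cmod_inner _ _)) // mulrC expr2 mulrA ler_wpM2r ?nr_ge0 //.
by rewrite -bopM opnormP.
Qed.

Lemma op_eq_small S T c :
  (forall e : R, 0 < e -> opnorm (S - T) <= e * c) -> S = T.
Proof.
move=> h; apply/eqP; rewrite -subr_eq0; apply/eqP/opnorm0_eq0/le_anti.
rewrite opnorm_ge0 andbT; apply: (@le_of_small _ _ _ c) => e e0.
by rewrite add0r h.
Qed.

Lemma opnorm_complete (u : nat -> bop H) :
  (forall e : R, 0 < e -> exists N, forall m n,
     (N <= m)%N -> (N <= n)%N -> opnorm (u m - u n) < e) ->
  exists l, forall e : R, 0 < e -> exists N, forall n,
    (N <= n)%N -> opnorm (u n - l) < e.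
Proof.
move=> uC.
have /choice[l lP] x : exists y, nlim (fun n => u n x) y.
  apply: ncauchy => e e0.
  have c1 : 0 < nr x + 1 by rewrite ltr_wpDl ?nr_ge0.
  have [N NP] := uC (e / (nr x + 1)) ltac:(by rewrite divr_gt0).
  exists N => m n Nm Nn; rewrite -bopB (le_lt_trans (opnormP _ _)) //.
  have := NP _ _ Nm Nn; rewrite ltr_pdivlMr // mulrDr mulr1.
  by move: (opnorm_ge0 (u m - u n)) => ? ?; lra.
have approx (e : R) : 0 < e -> exists N, forall n, (N <= n)%N ->
    forall x, nr (u n x - l x) <= e * nr x.
  move=> e0; have [N NP] := uC _ e0; exists N => n Nn x.
  apply: (@le_of_small _ _ _ 1) => d d0; have [N' NP'] := lP x _ d0.
  pose m := maxn N N'.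
  rewrite (le_trans (nr_tri _ (u m x) _)) // mulr1 lerD ?(ltW (NP' _ _)) ?leq_maxr //.
  rewrite -bopB (le_trans (opnormP _ _)) // ler_wpM2r ?nr_ge0 // ltW //.
  by rewrite NP // leq_maxl.
have ll : linear l.
  move=> a x y; apply/eqP; rewrite -subr_eq0; apply/eqP/nr0_eq0/le_anti.
  rewrite nr_ge0 andbT.
  apply: (@le_of_small _ _ _ (nr (a *: x + y) + cmod a * nr x + nr y)) => e e0.
  have [N NP] := approx _ e0.
  have -> : l (a *: x + y) - (a *: l x + l y) =
     - (u N (a *: x + y) - l (a *: x + y)) + (a *: (u N x - l x) + (u N y - l y)).
    by rewrite bop_linear; hring.
  rewrite add0r (le_trans (nrD _ _)) // nrN -addrA mulrDr lerD ?NP //.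
  rewrite (le_trans (nrD _ _)) // mulrDr lerD ?NP // nrZ mulrCA.
  by rewrite ler_wpM2l ?cmod_ge0 ?NP.
have lb : exists2 c : R, 0 <= c & forall x, nr (l x) <= c * nr x.
  have [N NP] := approx 1 ltr01; exists (opnorm (u N) + 1).
    by rewrite addr_ge0 ?opnorm_ge0.
  move=> x; rewrite -[l x](subrK (u N x)) addrC mulrDl (le_trans (nrD _ _)) //.
  by rewrite lerD ?opnormP // nrB NP.
have [L LE] := blin_bop (conj ll lb).
exists L => e e0; have e2 : 0 < e / 2 by rewrite divr_gt0.
have [N NP] := approx _ e2.
exists N => n Nn; apply: (@le_lt_trans _ _ (e / 2)); last by lra.
by apply: opnorm_le => [|x]; [rewrite ltW|rewrite bopB LE NP].
Qed.

HB.instance Definition _ := isCStarAlgebra.Build R (bop H) opnormD opnormZ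
  opnorm0_eq0 opnormM opnorm_cstar opnorm_complete.

End OperatorNorm.

(** * Square roots and commutants *)

Section StarAlgebraFacts.
Context (R : realType) (X : starAlgType R).
Implicit Types (x y : X) (B : set X).

Lemma star1 : star 1 = 1 :> X.
Proof. by rewrite -[LHS]mulr1 -{2}[1]starK -starM mulr1 starK. Qed.

Lemma star0 : star 0 = 0 :> X.
Proof. by apply: (addrI (star 0)); rewrite -starD !addr0. Qed.

Lemma starN x : star (- x) = - star x.
Proof. by apply: (addrI (star x)); rewrite -starD !subrr star0. Qed.

Lemma starB x y : star (x - y) = star x - star y.
Proof. by rewrite starD starN. Qed.

Lemma star_realZ (r : R) x : star (r%:C%C *: x) = r%:C%C *: star x.
Proof. by rewrite starZ conj_Creal ?complex_real. Qed.

Lemma star_subalgD B x y : star_subalg B -> B x -> B y -> B (x + y).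
Proof. by move=> [_ h _ _] Bx By; rewrite -[x]scale1r; apply: h. Qed.

Lemma star_subalgZ B c x : star_subalg B -> B x -> B (c *: x).
Proof. by move=> [h0 h _ _] Bx; rewrite -[_ *: _]addr0; apply: h. Qed.

Lemma star_subalgB B x y : star_subalg B -> B x -> B y -> B (x - y).
Proof.
by move=> hB Bx By; rewrite -scaleN1r; apply: star_subalgD => //; apply: star_subalgZ.
Qed.

Lemma star_subalgM B x y : star_subalg B -> B x -> B y -> B (x * y).
Proof. by move=> [_ _ h _]; apply: h. Qed.

Lemma star_subalgS B x : star_subalg B -> B x -> B (star x).
Proof. by move=> [_ _ _]; apply. Qed.

Lemma star_subalg0 B : star_subalg B -> B 0.
Proof. by case. Qed.

End StarAlgebraFacts.

Section SquareRoot.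
Context (R : realType) (H : hilbertType R).
Implicit Types (S T : bop H) (B X Y : set (bop H)) (x y : H) (c : R).

(** The root is [1 - L], where [L] is the limit of [b_0 = 0],
    [b_(n+1) = (T + b_n^2) / 2].  The increments of [b] are dominated by those of the
    bounded increasing sequence [t] which the same recursion gives for [T = 1]. *)
Lemma sqrt_one_sub B T : star_subalg B -> norm_closed B -> B 1 -> B T ->
  star T = T -> opnorm T <= 1 -> exists Z, [/\ B Z, star Z = Z & Z * Z = 1 - T].
Proof.
move=> hB cB B1 BT sT T1.
pose b := fix b n := if n is n'.+1 then (2^-1 : R)%:C%C *: (T + b n' * b n') else 0.
pose t := fix t n : R := if n is n'.+1 then (1 + t n' ^+ 2) / 2 else 0.
have Bb n : B (b n).
  elim: n => [|n IH] /=; first exact: star_subalg0.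
  by apply: star_subalgZ => //; apply: star_subalgD => //; apply: star_subalgM.
have sb n : star (b n) = b n.
  by elim: n => [|n IH] /=; rewrite ?star0 // star_realZ starD starM IH sT.
have t01 n : 0 <= t n <= 1.
  elim: n => [|n /andP[h0 h1]] /=; first by rewrite lexx ler01.
  have h2 : t n ^+ 2 <= 1 by rewrite expr_le1.
  by move: (sqr_ge0 (t n)) => ?; apply/andP; split; lra.
have half0 : cmod (2^-1 : R)%:C%C = 2^-1 :> R.
  by rewrite cmod_real ger0_norm // invr_ge0.
have bt n : opnorm (b n) <= t n.
  elim: n => [|n IH] /=; first by rewrite opnorm0.
  rewrite opnormZ half0 mulrC ler_wpM2r ?invr_ge0 // (le_trans (opnormD _ _)) //.
  rewrite lerD // (le_trans (opnormM _ _)) // expr2.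
  by rewrite ler_pM ?opnorm_ge0.
have step n : 0 <= t n.+1 - t n /\ opnorm (b n.+1 - b n) <= t n.+1 - t n.
  elim: n => [|n [IH0 IH]].
    split; first by rewrite subr0; case/andP: (t01 1%N).
    by rewrite !subr0 bt.
  have e1 : t n.+2 - t n.+1 = (t n.+1 - t n) * (t n.+1 + t n) / 2.
    by rewrite /=; field.
  have p0 : 0 <= t n.+1 + t n.
    by case/andP: (t01 n) => ? _; case/andP: (t01 n.+1) => ? _; rewrite addr_ge0.
  split; first by rewrite e1 divr_ge0 // mulr_ge0.
  rewrite e1.
  have -> : b n.+2 - b n.+1 = (2^-1 : R)%:C%C *:
      (b n.+1 * (b n.+1 - b n) + (b n.+1 - b n) * b n).
    rewrite -[b n.+2]/(_ *: (T + b n.+1 * b n.+1)) -[X in _ - X]/(_ *: (T + b n * b n)).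
    rewrite -scalerBr; congr (_ *: _).
    by rewrite mulrBr mulrBl addrA subrK opprD addrACA subrr add0r.
  rewrite opnormZ half0 [leRHS]mulrC ler_wpM2l ?invr_ge0 //.
  rewrite (le_trans (opnormD _ _)) // [leRHS]mulrDr lerD //.
    by rewrite (le_trans (opnormM _ _)) // mulrC ler_pM ?opnorm_ge0.
  by rewrite (le_trans (opnormM _ _)) // ler_pM ?opnorm_ge0.
have bdiff m k : opnorm (b (m + k)%N - b m) <= t (m + k)%N - t m.
  elim: k => [|k IH]; first by rewrite addn0 !subrr opnorm0.
  rewrite addnS -[_ - b m](subrKA (b (m + k)%N)) (le_trans (opnormD _ _)) //.
  by rewrite -[leRHS](subrKA (t (m + k)%N)) lerD // (proj2 (step _)).
have tmono m k : t m <= t (m + k)%N.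
  elim: k => [|k IH]; first by rewrite addn0.
  by rewrite addnS (le_trans IH) // -subr_ge0 (proj1 (step _)).
have ht : has_sup (range t).
  by split; [exists (t 0%N), 0%N|exists 1 => _ [n _ <-]; case/andP: (t01 n)].
have bC : forall e : R, 0 < e -> exists N, forall m n,
    (N <= m)%N -> (N <= n)%N -> opnorm (b m - b n) < e.
  move=> e e0; have e2 : 0 < e / 2 by rewrite divr_gt0.
  have [_ [N _ <-] tN] := sup_adherent e2 ht; exists N => m n Nm Nn.
  have tS k : t k <= sup (range t) by apply: (ub_le_sup (proj2 ht)); exists k.
  have h k : (N <= k)%N -> opnorm (b k - b N) < e / 2.
    move=> Nk; have := bdiff N (k - N)%N; rewrite subnKC // => h.
    by rewrite (le_lt_trans h) //; move: (tS k) => ?; lra.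
  rewrite -[b m - _](subrKA (b N)) (le_lt_trans (opnormD _ _)) //.
  by rewrite [opnorm (b N - _)]opnormB; move: (h _ Nm) (h _ Nn) => ? ?; lra.
have [L LP] := opnorm_complete bC.
have BL : B L.
  apply: cB => e e0; have [N NP] := LP _ e0.
  by exists (b N) => //; rewrite opnormB NP.
have sL : star L = L.
  apply: (@op_eq_small _ _ _ _ 2) => e e0; have [N NP] := LP _ e0.
  rewrite -(subrKA (b N)) (le_trans (opnormD _ _)) // -{1}(sb N) -starB opnorm_star.
  by rewrite opnormB; move: (NP N (leqnn N)) => ?; lra.
have LE : L = (2^-1 : R)%:C%C *: (T + L * L).
  apply: (@op_eq_small _ _ _ _ (1 + (2 + opnorm L) )) => e e0.
  have [N NP] := LP _ e0.
  rewrite -(subrKA (b N.+1)) (le_trans (opnormD _ _)) // mulrDr mulr1 lerD //.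
    by rewrite opnormB ltW // NP.
  rewrite -scalerBr opnormZ half0.
  have -> : T + b N * b N - (T + L * L) = b N * (b N - L) + (b N - L) * L.
    by rewrite mulrBr mulrBl addrA subrK opprD addrACA subrr add0r.
  have h := NP N (leqnn N).
  have b1 : opnorm (b N) <= 1 by rewrite (le_trans (bt _)) //; case/andP: (t01 N).
  have L0 := opnorm_ge0 L; have b0 := opnorm_ge0 (b N).
  have d0 := opnorm_ge0 (b N - L).
  have h1 : opnorm (b N * (b N - L)) <= e.
    by rewrite (le_trans (opnormM _ _)) // -[e]mul1r ler_pM // ltW.
  have h2 : opnorm ((b N - L) * L) <= e * opnorm L.
    by rewrite (le_trans (opnormM _ _)) // ler_wpM2r // ltW.
  have h3 := opnormD (b N * (b N - L)) ((b N - L) * L).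
  have h4 : 0 <= e * opnorm L by rewrite mulr_ge0 // ltW.
  rewrite [leRHS]mulrDr; move: h1 h2 h3 h4; move: (opnorm (_ + _)) (opnorm (_ * L)).
  by move=> u v; move: (e * opnorm L) => w *; lra.
exists (1 - L); split; first exact: star_subalgB.
  by rewrite starB star1 sL.
have -> : T = 2 *: L - L * L.
  rewrite {1}LE scalerA (_ : 2 * _ = 1) ?scale1r ?addrK //.
  by rewrite -(rmorph_nat (real_complex R) 2) -rmorphM /= mulfV // rmorph1.
rewrite mulrBl mul1r mulrBr mulr1 scaler_nat mulr2n !opprD !opprK addrA.
by rewrite !addrA.
Qed.

(** Bounds on transported operators come from this root: whatever transports the elements of [B]
    also transports [Z], and [|S x|^2 + |Z x|^2 = c^2 |x|^2] survives. *)
Lemma defect_root B S c : star_subalg B -> norm_closed B -> B 1 -> B S ->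
  0 < c -> (forall x, nr (S x) <= c * nr x) ->
  exists Z, [/\ B Z, star Z = Z & Z * Z = (c ^+ 2)%:C%C *: 1 - star S * S].
Proof.
move=> hB cB B1 BS c0 Sc.
pose T := (c ^- 2)%:C%C *: (star S * S).
have nS : opnorm S <= c by apply: opnorm_le; rewrite ?ltW.
have [||||||Z [BZ sZ ZZ]] := @sqrt_one_sub B T.
- exact: hB.
- exact: cB.
- exact: B1.
- by apply: star_subalgZ => //; apply: star_subalgM => //; apply: star_subalgS.
- by rewrite star_realZ starM starK.
- rewrite opnormZ cmod_real ger0_norm ?invr_ge0 ?sqr_ge0 // opnorm_cstar.
  rewrite mulrC ler_pdivrMr ?exprn_gt0 // mul1r ler_sqr ?nnegrE ?opnorm_ge0 //.
  exact: ltW.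
exists (c%:C%C *: Z); split; first exact: star_subalgZ.
  by rewrite star_realZ sZ.
rewrite -scalerAl -scalerAr scalerA ZZ scalerBr -rmorphM -expr2; congr (_ - _).
by rewrite scalerA -rmorphM divff ?scale1r // expf_neq0 // gt_eqF.
Qed.

(** Polarization at [x + y] and [x + i y]. *)
Lemma op_pos_star T : op_pos T -> star T = T.
Proof.
move=> pT; apply/esym.
have sa x : inner (T x) x = inner x (T x).
  by rewrite [RHS]innerC conj_Creal // ger0_real // pT.
apply: bopP => x; apply: inner_inj => y; rewrite -bop_starE.
have h1 := sa (x + y); have h2 := sa (x + 'i *: y).
move: h1 h2; rewrite !(bopD, bopZ, innerDl, innerDr, innerZl, innerZr) !sa.
rewrite conjCi.
set a := inner y (T x); set b := inner (T y) x.
set p := inner (T x) y; set q := inner x (T y).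
set u := inner x _; set v := inner y _ => h1 h2.
have e1 : b = a + q - p.
  have -> : b = (u + b + (p + v)) - u - p - v by ring.
  by rewrite h1; ring.
have e2 : 'i * b = 'i * (a - q + p).
  have -> : 'i * b = (u + 'i * b + (- 'i * p + 'i * (- 'i * v)))
    - u + 'i * p + 'i * 'i * v by ring.
  by rewrite h2; ring.
have {}e2 : b = a - q + p by apply: mulfI e2; exact: neq0Ci.
apply: (@mulfI _ 2); first by rewrite pnatr_eq0.
have -> : 2 * b = b + b by ring.
by rewrite {1}e1 e2; ring.
Qed.

(** For a positive operator [T] bounded by [c] one has [|T x|^2 <= c <T x, x>], so
    that [1 - c^-1 T] is a contraction, to which the series above applies. *)
Lemma pos_root B T : star_subalg B -> norm_closed B -> B 1 -> B T ->
  op_pos T -> exists Z, [/\ B Z, star Z = Z & Z * Z = T].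
Proof.
move=> hB cB B1 BT pT.
pose c := opnorm T + 1.
have c0 : 0 < c by rewrite ltr_wpDl ?opnorm_ge0.
have Tc x : nr (T x) <= c * nr x.
  by rewrite (le_trans (opnormP _ _)) // ler_wpM2r ?nr_ge0 // /c lerDl.
have sT := op_pos_star pT.
have rT x : inner (T x) x = (complex.Re (inner (T x) x))%:C%C.
  by rewrite RRe_real // ger0_real // pT.
have key x : nr (T x) ^+ 2 <= c * complex.Re (inner (T x) x).
  have := pT (x - (c^-1)%:C%C *: T x).
  set r := c^-1; set n2 := nr (T x) ^+ 2; set rho := complex.Re (inner (T x) x).
  have TT y : inner (T y) (T x) = inner (T (T y)) x by rewrite [RHS]bop_starE sT.
  have hw : complex.Re (inner (T (T x)) (T x)) <= c * n2.
    rewrite (le_trans (Re_le_cmod _)) // (le_trans (cmod_inner _ _)) //.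
    by rewrite /n2 expr2 mulrA ler_wpM2r ?nr_ge0.
  rewrite (linB _ _ (bop_linear T)) bopZ.
  rewrite !(innerBl, innerBr, innerZl, innerZr) conj_Creal ?complex_real //.
  rewrite -TT (rT x) (rT (T x)) inner_nr -/n2 -/rho.
  set w := complex.Re _ in hw *.
  rewrite -!(rmorphM, rmorphB) /= lecR => h.
  have rc : r * c = 1 by rewrite mulVf // gt_eqF.
  have -> : n2 = 2 * n2 - (r * c) * n2 by rewrite rc; ring.
  have {}h : c * (r * n2 - r * (r * w)) <= c * (rho - r * n2).
    by rewrite ler_pM2l // -mulrBr -subr_ge0.
  have h2 : r * w <= r * (c * n2) by rewrite ler_wpM2l // invr_ge0 ltW.
  have e1 : c * (r * n2 - r * (r * w)) = (r * c) * n2 - (r * c) * (r * w) by ring.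
  have e2 : c * (rho - r * n2) = c * rho - (r * c) * n2 by ring.
  have e3 : r * (c * n2) = n2 by rewrite mulrA rc mul1r.
  by move: h h2; rewrite e1 e2 e3 rc !mul1r => ? ?; lra.
have [||||||Z [BZ sZ ZZ]] := @sqrt_one_sub B (1 - (c^-1)%:C%C *: T).
- exact: hB.
- exact: cB.
- exact: B1.
- by apply: star_subalgB => //; apply: star_subalgZ.
- by rewrite starB star1 star_realZ sT.
- apply: opnorm_le => // x; rewrite mul1r.
  rewrite -ler_sqr ?nnegrE ?nr_ge0 // bopB.
  have -> : ((c^-1)%:C%C *: T) x = (c^-1)%:C%C *: T x by [].
  rewrite nr_sqE -[(1 : bop H) x]/x.
  rewrite !(innerBl, innerBr, innerZl, innerZr) conj_Creal ?complex_real //.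
  have -> : inner x (T x) = inner (T x) x by rewrite bop_starE sT.
  rewrite rT !inner_nr -!(rmorphM, rmorphB) /=.
  have := key x; set n2 := nr (T x) ^+ 2; set rho := complex.Re _ => h.
  have : c^-1 * (c^-1 * n2) <= c^-1 * rho.
    by rewrite ler_pM2l ?invr_gt0 // ler_pdivrMl.
  have rho0 : 0 <= rho by rewrite -lecR -rT; exact: pT.
  have : 0 <= c^-1 * rho by rewrite mulr_ge0 // invr_ge0 ltW.
  by move=> ? ?; lra.
exists ((Num.sqrt c)%:C%C *: Z); split; first exact: star_subalgZ.
  by rewrite star_realZ sZ.
rewrite -scalerAl -scalerAr scalerA ZZ -rmorphM -expr2 sqr_sqrtr ?(ltW c0) //.
by rewrite subKr scalerA -rmorphM divff ?scale1r // gt_eqF.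
Qed.

End SquareRoot.

Section Commutants.
Context (R : realType) (H : hilbertType R).
Implicit Types (S T : bop H) (B X Y : set (bop H)).

Definition star_closed X := forall S, X S -> X (star S).

Lemma commutant_star_closed X : star_closed X -> star_closed (commutant X).
Proof.
move=> hX T hT S XS; apply: (can_inj (@starK _ _)).
by rewrite !starM !starK (hT _ (hX _ XS)).
Qed.

Lemma commutant_subalg X : star_closed X -> star_subalg (commutant X).
Proof.
move=> hX; split.
- by move=> S _; rewrite mul0r mulr0.
- move=> c S T hS hT U XU.
  by rewrite mulrDl mulrDr -scalerAl -scalerAr hS ?hT.
- by move=> S T hS hT U XU; rewrite -mulrA hT // mulrA hS // mulrA.
- exact: commutant_star_closed.
Qed.

Lemma commutant_one X : commutant X 1.
Proof. by move=> S _; rewrite mul1r mulr1. Qed.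

Lemma commutant_norm_closed X : norm_closed (commutant X).
Proof.
move=> T h S XS; apply: (@op_eq_small _ _ _ _ (2 * opnorm S)) => e e0.
have [T' XT' TT'] := h _ e0.
have -> : T * S - S * T = (T - T') * S + S * (T' - T).
  by rewrite mulrBl mulrBr XT' // addrA subrK.
rewrite (le_trans (opnormD _ _)) // (le_trans (lerD (opnormM _ _) (opnormM _ _))) //.
rewrite [opnorm (T' - T)]opnormB.
have : opnorm (T - T') * opnorm S <= e * opnorm S.
  by rewrite ler_wpM2r ?opnorm_ge0 // ltW.
by move: (opnorm _) (opnorm _) => a b ?; rewrite [b * a]mulrC; lra.
Qed.

Lemma commutantS X Y : X `<=` Y -> commutant Y `<=` commutant X.
Proof. by move=> XY T hT S /XY; apply: hT. Qed.

Lemma sub_bicommutant X : X `<=` bicommutant X.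
Proof. by move=> S XS T hT; rewrite hT. Qed.

Lemma tricommutant X : commutant (bicommutant X) = commutant X.
Proof.
apply/seteqP; split; first exact/commutantS/sub_bicommutant.
exact: sub_bicommutant.
Qed.

Lemma total_eq S T (Y : set H) : is_total Y -> (forall x, Y x -> S x = T x) -> S = T.
Proof.
move=> tY e; apply/eqP; rewrite -subr_eq0; apply/eqP.
apply: (can_inj (@starK _ _)); rewrite star0; apply: bopP => k; apply: tY => x Yx.
by rewrite -bop_starE bopB e // subrr inner0l.
Qed.

End Commutants.

Section LinearOn.
Context (R : realType) (X Y : starAlgType R) (B : set X) (f : X -> Y).
Hypotheses (hB : star_subalg B) (fL : linear_on B f).

Lemma linear_on0 : f 0 = 0.
Proof.
have z := star_subalg0 hB.
by have := fL (-1) z z; rewrite scaleN1r oppr0 addr0 scaleN1r addNr.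
Qed.

Lemma linear_onZ c x : B x -> f (c *: x) = c *: f x.
Proof.
move=> Bx; have z := star_subalg0 hB.
by rewrite -[c *: x]addr0 fL // linear_on0 addr0.
Qed.

Lemma linear_onB x y : B x -> B y -> f (x - y) = f x - f y.
Proof. by move=> Bx By; rewrite addrC -scaleN1r fL // scaleN1r addrC. Qed.

Lemma linear_onD x y : B x -> B y -> f (x + y) = f x + f y.
Proof. by move=> Bx By; rewrite -[x]scale1r fL // !scale1r. Qed.

End LinearOn.

Section HomContractive.
Context (R : realType) (H K : hilbertType R) (B : set (bop H)) (f : bop H -> bop K).
Hypotheses (hB : star_subalg B) (cB : norm_closed B) (B1 : B 1).
Hypothesis hf : star_hom_on B f.

(** A root [z] of [c^2 - x^* x] lies in [B], and its image is a root of
    [c^2 p - f(x)^* f(x)], where [p = f 1] is a projection. *)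
Lemma star_hom_contractive x : B x -> opnorm (f x) <= opnorm x.
Proof.
move=> Bx; have [fL fM fS] := hf; apply: (@le_of_small _ _ _ 1) => e e0.
rewrite mulr1; set c := opnorm x + e.
have c0 : 0 < c by rewrite ltr_wpDl ?opnorm_ge0.
have xc k : nr (x k) <= c * nr k.
  by rewrite (le_trans (opnormP _ _)) // ler_wpM2r ?nr_ge0 // lerDl ltW.
have [z [Bz sz zz]] := defect_root hB cB B1 Bx c0 xc.
have Bs := star_subalgS hB Bx.
have key : star (f x) * f x + star (f z) * f z = (c ^+ 2)%:C%C *: f 1.
  rewrite -!fS // -!fM // ?sz //.
  have Bxx := star_subalgM hB Bs Bx; have Bzz := star_subalgM hB Bz Bz.
  by rewrite -(linear_onD fL Bxx Bzz) zz addrC subrK (linear_onZ hB fL _ B1).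
have sq (u : bop K) k : inner ((star u * u) k) k = (nr (u k) ^+ 2)%:C%C.
  by rewrite bopM bop_starE starK inner_nr.
have p1 k : inner (f 1 k) k = (nr (f 1 k) ^+ 2)%:C%C.
  by rewrite -sq -fS // star1 -fM // mulr1.
have pk k : nr (f 1 k) <= nr k.
  have := nr_ge0 (f 1 k); rewrite le_eqVlt => /predU1P[<-|p0]; first exact: nr_ge0.
  rewrite -(ler_pM2l p0) -expr2 -[leLHS]ger0_norm ?sqr_ge0 // -cmod_real -p1.
  exact: cmod_inner.
apply: opnorm_le => [|k]; first exact: ltW.
rewrite -ler_sqr ?nnegrE ?mulr_ge0 ?nr_ge0 ?(ltW c0) // exprMn.
have : (nr (f x k) ^+ 2)%:C%C + (nr (f z k) ^+ 2)%:C%C =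
    (c ^+ 2)%:C%C * (nr (f 1 k) ^+ 2)%:C%C.
  rewrite -p1 -!sq -innerDl -innerZl.
  by rewrite -[X in inner X _ = _]/((star (f x) * f x + star (f z) * f z) k) key.
rewrite -rmorphM -rmorphD => /complexI h.
apply: (@le_trans _ _ (c ^+ 2 * nr (f 1 k) ^+ 2)).
  by rewrite -h lerDl sqr_ge0.
by rewrite ler_wpM2l ?sqr_ge0 // ler_sqr ?nnegrE ?nr_ge0.
Qed.

End HomContractive.

(** * Square-summable sequences and ultraweak continuity *)

Section SquareSummable.
Context (R : realType) (H : hilbertType R).
Implicit Types (u v : nat -> H).

Definition sqsum : set (nat -> H) :=
  [set u : nat -> H | exists C : R, forall N, \sum_(k < N) nr (u k) ^+ 2 <= C].

Lemma nr_sqD (x y : H) : nr (x + y) ^+ 2 <= 2 * nr x ^+ 2 + 2 * nr y ^+ 2.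
Proof.
rewrite (@le_trans _ _ ((nr x + nr y) ^+ 2)) //.
  by rewrite ler_sqr ?nnegrE ?addr_ge0 ?nr_ge0 // nrD.
have := sqr_ge0 (nr x - nr y); rewrite sqrrB sqrrD; move: (nr x) (nr y) => a b.
by move=> ?; lra.
Qed.

Lemma sqsum_subspace : is_subspace sqsum.
Proof.
split; first by exists 0 => N; rewrite big1 // => k _; rewrite nr0 expr0n.
move=> c u v [C hC] [D hD]; exists (2 * (cmod c ^+ 2 * C) + 2 * D) => N.
rewrite (@le_trans _ _ (\sum_(k < N) (2 * (cmod c ^+ 2 * nr (u k) ^+ 2)
    + 2 * nr (v k) ^+ 2))) //.
  by apply: ler_sum => k _; rewrite (le_trans (nr_sqD _ _)) // nrZ exprMn.
rewrite big_split /= -!big_distrr /=.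
have := hD N; have : cmod c ^+ 2 * \sum_(i < N) nr (u i) ^+ 2 <= cmod c ^+ 2 * C.
  by rewrite ler_wpM2l ?sqr_ge0.
by move=> ? ?; lra.
Qed.

Definition clim (z : nat -> R[i]) l := forall e : R, 0 < e ->
  exists N, forall n, (N <= n)%N -> cmod (z n - l) < e.

Lemma clim_uniq z a b : clim z a -> clim z b -> a = b.
Proof.
move=> za zb; apply: (@eq_of_small _ _ _ 2) => e e0.
have [N NP] := za _ e0; have [M MP] := zb _ e0.
pose n := maxn N M.
have -> : a - b = - (z n - a) + (z n - b) by ring.
rewrite (le_trans (cmodD _ _)) // cmodN.
have := NP n (leq_maxl _ _); have := MP n (leq_maxr _ _) => ? ?; lra.
Qed.

Lemma climE (z : nat -> R[i]) l : z n @[n --> \oo] --> (l : R[i]^o) <-> clim z l.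
Proof.
split.
  move=> /((@cvgrPdist_lt _ R[i]^o nat \oo _ (z : nat -> R[i]^o) l).1) h e e0.
  have e0' : 0 < e%:C%C :> R[i] by rewrite ltcR.
  have [N _ NP] := h _ e0'; exists N => n /NP.
  by rewrite distrC cmodE ltcR.
move=> h; apply: ((@cvgrPdist_lt _ R[i]^o nat \oo _ (z : nat -> R[i]^o) l).2) => e e0.
have eE : e = (complex.Re e)%:C%C by rewrite RRe_real // gtr0_real.
have [|N NP] := h (complex.Re e); first by rewrite -ltcR -eE.
by exists N => // n /NP; rewrite distrC eE [in X in _ -> X]cmodE ltcR.
Qed.

Lemma climD z w a b : clim z a -> clim w b -> clim (fun n => z n + w n) (a + b).
Proof.
move=> za wb e e0; have e2 : 0 < e / 2 by rewrite divr_gt0.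
have [N NP] := za _ e2; have [M MP] := wb _ e2; exists (maxn N M) => n.
rewrite geq_max => /andP[/NP h1 /MP h2].
rewrite opprD addrACA (le_lt_trans (cmodD _ _)) //; lra.
Qed.

Lemma climZ c z a : clim z a -> clim (fun n => c * z n) (c * a).
Proof.
move=> za e e0; have c1 : 0 < cmod c + 1 by rewrite ltr_wpDl ?cmod_ge0.
have [N NP] := za (e / (cmod c + 1)) ltac:(by rewrite divr_gt0).
exists N => n /NP; rewrite -mulrBr cmodM ltr_pdivlMr // mulrDr mulr1 mulrC.
by move: (cmod_ge0 (z n - a)) => ? ?; lra.
Qed.

Lemma clim_conj z a : clim z a -> clim (fun n => (z n)^*) a^*.
Proof.
move=> za e e0; have [N NP] := za _ e0; exists N => n /NP.
by rewrite -rmorphB cmod_conj.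
Qed.

Lemma eq_clim z w a : z =1 w -> clim z a -> clim w a.
Proof.
by move=> e za d d0; have [N NP] := za _ d0; exists N => n /NP; rewrite e.
Qed.

Lemma bounded_mono_lim (a : nat -> R) C : (forall n, a n <= a n.+1) ->
  (forall n, a n <= C) ->
  exists l, forall e, 0 < e -> exists N, forall n, (N <= n)%N -> `|a n - l| < e.
Proof.
move=> am aC; have ha : has_sup (range a).
  by split; [exists (a 0%N), 0%N|exists C => _ [n _ <-]].
exists (sup (range a)) => e e0; have [_ [N _ <-] aN] := sup_adherent e0 ha.
exists N => n Nn.
have mono : a N <= a n.
  elim: n Nn => [|n IH]; first by rewrite leqn0 => /eqP ->.
  by rewrite leq_eqVlt => /predU1P[->//|/IH h]; rewrite (le_trans h).
have : a n <= sup (range a) by apply: (ub_le_sup (proj2 ha)); exists n.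
by move=> ?; rewrite ler0_norm; lra.
Qed.

Let sums u v N := \sum_(k < N) inner (u k) (v k).

Lemma sqsum_lim u : sqsum u -> exists l : R, forall e, 0 < e ->
  exists N, forall n, (N <= n)%N -> `|\sum_(k < n) nr (u k) ^+ 2 - l| < e.
Proof.
move=> [C hC]; apply: bounded_mono_lim hC => n.
by rewrite big_ord_recr /= lerDl sqr_ge0.
Qed.

Lemma sum_sq_mono u m n : (m <= n)%N ->
  \sum_(k < m) nr (u k) ^+ 2 <= \sum_(k < n) nr (u k) ^+ 2.
Proof.
move=> mn; rewrite -(subnKC mn); elim: (n - m)%N => [|d IH]; first by rewrite addn0.
by rewrite addnS big_ord_recr /= (le_trans IH) // lerDl sqr_ge0.
Qed.

Lemma polar_Re (x y : H) : complex.Re (inner x y) =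
  4^-1 * nr (x + y) ^+ 2 - 4^-1 * nr (x - y) ^+ 2.
Proof.
rewrite !nr_sqE !(innerBl, innerBr, innerDl, innerDr) -mulrBr -raddfB /=.
have -> : inner x x + inner y x + (inner x y + inner y y) -
  (inner x x - inner x y - (inner y x - inner y y)) = 2 * (inner x y + inner y x).
  by ring.
rewrite (innerC x y); case: (inner x y) => a b /=.
by field.
Qed.

Lemma inner_sums_lim u v : sqsum u -> sqsum v -> exists l, clim (sums u v) l.
Proof.
move=> su sv.
have re w : sqsum w -> exists l : R, forall e, 0 < e -> exists N, forall n,
    (N <= n)%N -> `|complex.Re (sums u w n) - l| < e.
  move=> sw; have s1 : sqsum (u + w) by rewrite -[u]scale1r; apply: (proj2 sqsum_subspace).
  have s2 : sqsum (u - w).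
    by rewrite addrC -scaleN1r; apply: (proj2 sqsum_subspace).
  have [a ha] := sqsum_lim s1; have [b hb] := sqsum_lim s2.
  exists (4^-1 * a - 4^-1 * b) => e e0.
  have [N NP] := ha _ e0; have [M MP] := hb _ e0.
  exists (maxn N M) => n; rewrite geq_max => /andP[/NP h1 /MP h2].
  rewrite /sums raddf_sum /=.
  under eq_bigr do rewrite polar_Re.
  rewrite sumrB -!big_distrr /= opprB.
  move: h1 h2; rewrite !ltr_norml => /andP[? ?] /andP[? ?].
  by apply/andP; split; lra.
have [a ha] := re _ sv.
have [b hb] : exists l : R, forall e, 0 < e -> exists N, forall n,
    (N <= n)%N -> `|complex.Im (sums u v n) - l| < e.
  have siv : sqsum ('i *: v).
    by rewrite -[_ *: _]addr0; apply: (proj2 sqsum_subspace) => //; case: sqsum_subspace.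
  have [b hb] := re _ siv; exists b => e /hb[N NP]; exists N => n /NP.
  suff -> : complex.Re (sums u ('i *: v) n) = complex.Im (sums u v n) by [].
  rewrite /sums !raddf_sum /=; apply: eq_bigr => k _.
  rewrite innerZr conjCi -complexiE; case: (inner _ _) => p q.
  by simpc.
exists (a +i* b)%C => e e0; have e2 : 0 < e / 2 by rewrite divr_gt0.
have [N NP] := ha _ e2; have [M MP] := hb _ e2; exists (maxn N M) => n.
rewrite geq_max => /andP[/NP h1 /MP h2].
case: (sums u v n) h1 h2 => p q /= h1 h2.
have -> : (p +i* q)%C - (a +i* b)%C = (p - a)%:C%C + 'i * (q - b)%:C%C.
  by rewrite -complexiE; simpc.
rewrite (le_lt_trans (cmodD _ _)) // cmodM !cmod_real.
by rewrite (_ : cmod 'i = 1) ?mul1r; [lra|rewrite /cmod normCi].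
Qed.

End SquareSummable.

Definition ell2 (R : realType) (H : hilbertType R) := subm (sqsum_subspace H).

Section Ell2.
Context (R : realType) (H : hilbertType R).
Local Notation W := (ell2 H).
HB.instance Definition _ := GRing.Lmodule.on W.
Implicit Types (u v w : W).

Definition coord u : nat -> H := @subm_val _ _ _ (sqsum_subspace H) u.

Lemma coordP u v : coord u =1 coord v -> u = v.
Proof. by move=> e; apply: submP; apply/funext. Qed.

Lemma coordD u v k : coord (u + v) k = coord u k + coord v k.
Proof. by []. Qed.

Lemma coordZ c u k : coord (c *: u) k = c *: coord u k.
Proof. by []. Qed.

Lemma coordB u v k : coord (u - v) k = coord u k - coord v k.
Proof. by rewrite /coord submB. Qed.

Lemma sqsum_coord u : sqsum (coord u).
Proof. exact: subm_in. Qed.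

Lemma sqsum_ell2 (s : nat -> H) : sqsum s -> exists u : W, coord u = s.
Proof. by move=> hs; exists (Subm (sqsum_subspace H) hs). Qed.

Let sums u v N := \sum_(k < N) inner (coord u k) (coord v k).

Let ip u v : R[i] := projT1 (cid (inner_sums_lim (sqsum_coord u) (sqsum_coord v))).

Let ip_lim u v : clim (sums u v) (ip u v).
Proof. by rewrite /ip; case: cid. Qed.

Let ipDl u v w : ip (u + v) w = ip u w + ip v w.
Proof.
apply: clim_uniq (ip_lim _ _) _.
apply: eq_clim (climD (ip_lim u w) (ip_lim v w)) => n.
by rewrite /sums -big_split; apply: eq_bigr => k _; exact/esym/innerDl.
Qed.

Let ipZl (c : R[i]) u w : ip (c *: u) w = c * ip u w.
Proof.
apply: clim_uniq (ip_lim _ _) _.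
apply: eq_clim (climZ c (ip_lim u w)) => n.
by rewrite /sums big_distrr; apply: eq_bigr => k _; exact/esym/innerZl.
Qed.

Let ipC u v : ip v u = (ip u v)^*.
Proof.
apply: clim_uniq (ip_lim _ _) _.
apply: eq_clim (clim_conj (ip_lim u v)) => n.
by rewrite /sums rmorph_sum; apply: eq_bigr => k _ /=; rewrite -innerC.
Qed.

Let q u : R := complex.Re (ip u u).

Let sumsE u N : sums u u N = (\sum_(k < N) nr (coord u k) ^+ 2)%:C%C.
Proof. by rewrite rmorph_sum; apply: eq_bigr => k _; rewrite inner_nr. Qed.

Let ip_real u : ip u u = (q u)%:C%C.
Proof.
have : (ip u u)^* = ip u u by rewrite -ipC.
rewrite /q; case: (ip u u) => a b [] /= h; congr (_ +i* _)%C.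
by move: h => /= h; lra.
Qed.

Let q_ge u N : \sum_(k < N) nr (coord u k) ^+ 2 <= q u.
Proof.
apply: (@le_of_small _ _ _ 1) => e e0; have [M MP] := ip_lim u u e0.
have := MP (maxn N M) (leq_maxr _ _); rewrite sumsE ip_real -rmorphB cmod_real.
rewrite ltr_norml mulr1 => /andP[_ h].
by have := sum_sq_mono (coord u) (leq_maxl N M) => h'; lra.
Qed.

Let q_le u C : (forall N, \sum_(k < N) nr (coord u k) ^+ 2 <= C) -> q u <= C.
Proof.
move=> hC; apply: (@le_of_small _ _ _ 1) => e e0; have [M MP] := ip_lim u u e0.
have := MP M (leqnn _); rewrite sumsE ip_real -rmorphB cmod_real.
rewrite ltr_norml mulr1 => /andP[h _].
by have := hC M => h'; lra.
Qed.

Let q0 u : 0 <= q u.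
Proof. by have := q_ge u 0; rewrite big_ord0. Qed.

Let ip_ge0 u : 0 <= ip u u.
Proof. by rewrite ip_real lecR q0. Qed.

Let q_coord u k : nr (coord u k) ^+ 2 <= q u.
Proof.
rewrite (le_trans _ (q_ge u k.+1)) // big_ord_recr /= lerDr.
by apply: sumr_ge0 => i _; rewrite sqr_ge0.
Qed.

Let ip_eq0 u : ip u u = 0 -> u = 0.
Proof.
move=> h; apply: coordP => k; apply: nr0_eq0.
have := q_coord u k; rewrite /q h /= => hk.
by apply/eqP; rewrite -sqrf_eq0 eq_le hk sqr_ge0.
Qed.

Let ip_complete (u : nat -> W) :
    (forall e : R, 0 < e -> exists N, forall m n, (N <= m)%N -> (N <= n)%N ->
       complex.Re (ip (u m - u n) (u m - u n)) < e ^+ 2) ->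
    exists l : W, forall e : R, 0 < e -> exists N, forall n, (N <= n)%N ->
       complex.Re (ip (u n - l) (u n - l)) < e ^+ 2.
Proof.
move=> uC.
have /choice[l lP] k : exists y, nlim (fun n => coord (u n) k) y.
  apply: ncauchy => e e0; have [N NP] := uC _ e0; exists N => m n Nm Nn.
  have := NP _ _ Nm Nn; rewrite -/(q _) -coordB => h.
  rewrite -ltr_sqr ?nnegrE ?nr_ge0 ?(ltW e0) //.
  exact: le_lt_trans (q_coord _ _) h.
have lim_sum N (e : R) : 0 < e -> exists M, forall n, (M <= n)%N ->
    \sum_(k < N) nr (coord (u n) k - l k) ^+ 2 <= e.
  elim: N e => [|N IH] e e0; first by exists 0%N => n _; rewrite big_ord0 ltW.
  have e2 : 0 < e / 2 by rewrite divr_gt0.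
  have se : 0 < Num.sqrt (e / 2) by rewrite sqrtr_gt0.
  have [M MP] := IH _ e2; have [M' MP'] := lP N _ se.
  exists (maxn M M') => n; rewrite geq_max => /andP[/MP h1 /MP' h2].
  rewrite big_ord_recr /= [e]splitr lerD //.
  rewrite -[e / 2]sqr_sqrtr ?(ltW e2) // ler_sqr ?nnegrE ?nr_ge0 ?sqrtr_ge0 //.
  exact: ltW.
have bound e : 0 < e -> exists M, forall m, (M <= m)%N -> forall N,
    \sum_(k < N) nr (coord (u m) k - l k) ^+ 2 <= 4 * e ^+ 2.
  move=> e0; have [M MP] := uC _ e0; exists M => m Mm N.
  have e2 : 0 < e ^+ 2 by rewrite exprn_gt0.
  have [M' MP'] := lim_sum N _ e2; pose n := maxn M M'.
  apply: (@le_trans _ _ (\sum_(k < N) (2 * nr (coord (u m - u n) k) ^+ 2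
      + 2 * nr (coord (u n) k - l k) ^+ 2))).
    apply: ler_sum => k _; rewrite coordB -[X in nr X](subrKA (coord (u n) k)).
    exact: nr_sqD.
  rewrite big_split /= -!big_distrr /=.
  have h1 := q_ge (u m - u n) N.
  have h2 : q (u m - u n) < e ^+ 2 by apply: MP => //; rewrite leq_maxl.
  have h3 := MP' n (leq_maxr _ _).
  lra.
have [L LE] : exists L : W, coord L = l.
  apply: sqsum_ell2; have [M /(_ M (leqnn M)) MP] := bound 1 ltr01.
  have s1 : sqsum (fun k => coord (u M) k - l k) by exists (4 * 1 ^+ 2).
  have -> : l = (-1) *: (fun k => coord (u M) k - l k) + coord (u M).
    by apply/funext => k /=; rewrite /GRing.scale /= /GRing.add /= scaleN1r opprB subrK.
  by apply: (proj2 (sqsum_subspace H)) => //; exact: sqsum_coord.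
exists L => e e0; have e4 : 0 < e / 4 by rewrite divr_gt0.
have [M MP] := bound _ e4; exists M => n Mn.
apply: (@le_lt_trans _ _ (4 * (e / 4) ^+ 2)).
  apply: q_le => N; rewrite (le_trans _ (MP n Mn N)) //.
  by apply: ler_sum => k _; rewrite coordB LE.
have := exprn_gt0 2 e0; rewrite exprMn !expr2 => h; lra.
Qed.

Let single_in (x : H) : sqsum (fun k : nat => if k == 0%N then x else 0).
Proof.
exists (nr x ^+ 2) => N; case: N => [|N]; first by rewrite big_ord0 sqr_ge0.
by rewrite big_ord_recl /= big1 ?addr0 // => k _; rewrite nr0 expr0n.
Qed.

Let nz : exists u : W, u != 0.
Proof.
have [x x0] := @hilbert_nz R H; have [u uE] := sqsum_ell2 (single_in x).
by exists u; apply: contraNneq x0 => u0; have /= <- := congr1 (@^~ 0%N) uE; rewrite u0.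
Qed.

HB.instance Definition _ := @isHilbertSpace.Build R W ip ipDl ipZl ipC ip_ge0
  ip_eq0 ip_complete nz.

Lemma inner_lim u v : clim (fun N => \sum_(k < N) inner (coord u k) (coord v k))
  (inner u v).
Proof. exact: ip_lim. Qed.

Lemma nr_ell2_le u C : 0 <= C ->
  (forall N, \sum_(k < N) nr (coord u k) ^+ 2 <= C ^+ 2) -> nr u <= C.
Proof.
move=> C0 h; rewrite -ler_sqr ?nnegrE ?nr_ge0 // nr_sqE; exact: q_le.
Qed.

Lemma nr_ell2_ge u N : \sum_(k < N) nr (coord u k) ^+ 2 <= nr u ^+ 2.
Proof. by rewrite nr_sqE; exact: q_ge. Qed.

Lemma ell2_map (K : hilbertType R) (f : nat -> K -> H) c : 0 <= c ->
  (forall n, linear (f n)) ->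
  (forall x N, \sum_(n < N) nr (f n x) ^+ 2 <= (c * nr x) ^+ 2) ->
  exists2 A : K -> W, blin A & forall x n, coord (A x) n = f n x.
Proof.
move=> c0 fl fs; have /choice[A AE] x : exists u : W, coord u = f^~ x.
  by apply: sqsum_ell2; exists ((c * nr x) ^+ 2).
exists A; last by move=> x n; rewrite AE.
split; first by move=> a x y; apply: coordP => n; rewrite AE coordD coordZ !AE fl.
exists c => // x; apply: nr_ell2_le => [|N]; first by rewrite mulr_ge0 ?nr_ge0.
by rewrite AE.
Qed.

Lemma inner_single u v k : (forall n, n != k -> coord v n = 0) ->
  inner u v = inner (coord u k) (coord v k).
Proof.
move=> v0; apply: clim_uniq (inner_lim u v) _ => e e0; exists k.+1 => n kn.
rewrite (bigD1 (Ordinal kn)) //= big1 ?addr0 ?subrr ?cmod0 // => i ik.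
by rewrite v0 ?inner0r.
Qed.

Lemma single_ex k : exists2 i : H -> W, blin i &
  forall x n, coord (i x) n = if n == k then x else 0.
Proof.
apply: (@ell2_map _ (fun n x => if n == k then x else 0) 1) => // [n c x y|x N].
  by case: eqP => // _; rewrite scaler0 addr0.
rewrite mul1r; have [kN|kN] := ltnP k N.
  rewrite (bigD1 (Ordinal kN)) //= eqxx big1 ?addr0 // => n.
  by rewrite -val_eqE /= => /negPf ->; rewrite nr0 expr0n.
rewrite big1 ?sqr_ge0 // => n _; rewrite ltn_eqF ?nr0 ?expr0n //.
exact: leq_trans (ltn_ord n) kN.
Qed.

Definition single k : H -> W := projT1 (cid2 (single_ex k)).

Lemma single_blin k : blin (single k).
Proof. by rewrite /single; case: cid2. Qed.

Lemma coord_single k x n : coord (single k x) n = if n == k then x else 0.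
Proof. by rewrite /single; case: cid2. Qed.

Lemma inner_singler u k x : inner u (single k x) = inner (coord u k) x.
Proof.
rewrite (@inner_single u _ k) ?coord_single ?eqxx // => n nk.
by rewrite coord_single (negPf nk).
Qed.

Lemma inner_singlel u k x : inner (single k x) u = inner x (coord u k).
Proof. by rewrite innerC inner_singler -innerC. Qed.

Lemma coord_blin k : blin (fun u => coord u k).
Proof.
have [g bg hg] := blin_adj (single_blin k).
suff -> : (fun u => coord u k) = g by [].
apply/funext => u; apply: inner_inj => x.
by rewrite -hg inner_singlel.
Qed.

Lemma diag_ex (T : bop H) : exists D : bop W, forall u n, coord (D u) n = T (coord u n).
Proof.
have [c c0 cP] := (bop_blin T).2.
have [||D bD DE] := @ell2_map W (fun n u => T (coord u n)) c c0.
- by move=> n a u v; rewrite coordD coordZ bop_linear.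
- move=> u N; rewrite (@le_trans _ _ (\sum_(k < N) c ^+ 2 * nr (coord u k) ^+ 2)) //.
    apply: ler_sum => k _; rewrite -exprMn ler_sqr ?nnegrE ?mulr_ge0 ?nr_ge0 //.
  by rewrite -big_distrr /= exprMn ler_wpM2l ?sqr_ge0 ?nr_ell2_ge.
by have [D' D'E] := blin_bop bD; exists D' => u n; rewrite D'E DE.
Qed.

(** The amplification of [T], that is, [T (x) 1] on [H (x) ell2]. *)
Definition diag T : bop W := projT1 (cid (diag_ex T)).

Lemma coord_diag T u n : coord (diag T u) n = T (coord u n).
Proof. by rewrite /diag; case: cid. Qed.

Lemma diag_single T k x : diag T (single k x) = single k (T x).
Proof.
apply: coordP => n; rewrite coord_diag !coord_single.
by case: eqP; rewrite ?bop0.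
Qed.

Lemma diagM S T : diag (S * T) = diag S * diag T.
Proof. by apply: bopP => u; apply: coordP => n; rewrite bopM !coord_diag. Qed.

Lemma diag1 : diag 1 = 1.
Proof. by apply: bopP => u; apply: coordP => n; rewrite coord_diag. Qed.

Lemma diag_linear : linear diag.
Proof.
move=> c S T; apply: bopP => u; apply: coordP => n.
have -> : (c *: diag S + diag T) u = c *: diag S u + diag T u by [].
by rewrite coordD coordZ !coord_diag.
Qed.

Lemma total_single : is_total [set u : W | exists (k : nat) (x : H), u = single k x].
Proof.
move=> u ou; apply: coordP => n; apply: inner_inj => x.
by rewrite -inner_singlel ou ?inner0r //; exists n, x.
Qed.

Lemma diag_star T : diag (star T) = star (diag T).
Proof.
apply: (total_eq total_single) => _ [k [x ->]].
apply: inner_inj => u; rewrite -bop_starE diag_single !inner_singler coord_diag.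
by rewrite bop_starE.
Qed.

(** The two sequences in the definition of an ultraweakly continuous functional are
    two vectors of [ell2 H]: it is a vector functional of the amplification. *)
Lemma uw_functionalP (w : bop H -> R[i]) : uw_functional w <->
  exists u v : W, forall T, w T = inner (diag T u) v.
Proof.
have sumE (s : nat -> H) n :
    series (fun k => `|s k| ^+ 2 : R[i]^o) n = (\sum_(k < n) nr (s k) ^+ 2)%:C%C.
  rewrite /series /= big_mkord rmorph_sum; apply: eq_bigr => k _.
  by rewrite nrE -rmorphXn.
have cvgE (s : nat -> H) : cvgn (series (fun k => `|s k| ^+ 2 : R[i]^o)) <-> sqsum s.
  split.
    move=> /cvg_ex[l /climE h]; have [N NP] := h 1 ltr01.
    exists (1 + cmod l) => M; pose n := maxn N M.
    rewrite (le_trans (sum_sq_mono s (leq_maxr N M))) // -/n.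
    have : cmod ((\sum_(k < n) nr (s k) ^+ 2)%:C%C - l) < 1.
      by rewrite -sumE; exact: NP (leq_maxl _ _).
    set a := \sum_(_ < _) _ => h'.
    have a0 : 0 <= a by apply: sumr_ge0 => k _; rewrite sqr_ge0.
    rewrite -[a]ger0_norm // -cmod_real -[a%:C%C](subrK l) (le_trans (cmodD _ _)) //.
    by rewrite lerD2r ltW.
  move=> hs; have [l lP] := sqsum_lim hs; apply/cvg_ex; exists l%:C%C.
  apply/climE => e e0; have [N NP] := lP _ e0; exists N => n /NP h.
  rewrite -[X in cmod (X - _)]/(series (fun k => `|s k| ^+ 2 : R[i]^o) n) sumE.
  by rewrite -rmorphB cmod_real.
split.
  move=> [xi [eta [/cvgE /sqsum_ell2[u uE] /cvgE /sqsum_ell2[v vE] h]]].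
  exists u, v => T; have /climE := h T => hT; apply: clim_uniq hT _.
  apply: eq_clim (inner_lim (diag T u) v) => n.
  by apply: eq_bigr => k _; rewrite coord_diag uE vE.
move=> [u [v h]]; exists (coord u), (coord v); split.
- by apply/cvgE; exact: sqsum_coord.
- by apply/cvgE; exact: sqsum_coord.
move=> T; apply/climE; rewrite h; apply: eq_clim (inner_lim (diag T u) v) => n.
by apply: eq_bigr => k _; rewrite coord_diag.
Qed.

End Ell2.

(** * Transport along families of intertwiners *)

Section Limits.
Context (R : realType).

Lemma nlim_blin (H K : hilbertType R) (f : H -> K) u l :
  blin f -> nlim u l -> nlim (fun n => f (u n)) (f l).
Proof.
move=> [fl [c c0 cP]] ul e e0; have c1 : 0 < c + 1 by rewrite ltr_wpDl.
have [N NP] := ul (e / (c + 1)) ltac:(by rewrite divr_gt0).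
exists N => n /NP; rewrite ltr_pdivlMr // mulrDr mulr1 mulrC => h.
rewrite -linB // (le_lt_trans (cP _)) //.
by move: (nr_ge0 (u n - l)) => ?; lra.
Qed.

Lemma nlim_cst (H : hilbertType R) (l : H) : nlim (fun _ => l) l.
Proof. by move=> e e0; exists 0%N => n _; rewrite subrr nr0. Qed.

Lemma nlim_bounded (H : hilbertType R) (u : nat -> H) l : nlim u l ->
  exists N, forall n, (N <= n)%N -> nr (u n) <= nr l + 1.
Proof.
move=> ul; have [N NP] := ul 1 ltr01; exists N => n /NP h.
rewrite -[u n](subrK l) (le_trans (nrD _ _)) //; lra.
Qed.

Lemma clim_inner (H : hilbertType R) (u v : nat -> H) l m :
  nlim u l -> nlim v m -> clim (fun n => inner (u n) (v n)) (inner l m).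
Proof.
move=> ul vm e e0.
pose c := nr l + nr m + 1; have c0 : 0 < c by rewrite ltr_wpDl ?addr_ge0 ?nr_ge0.
have [N1 NP1] := ul (e / c / 2) ltac:(by rewrite !divr_gt0).
have [N2 NP2] := vm (e / c / 2) ltac:(by rewrite !divr_gt0).
have [N3 NP3] := nlim_bounded vm.
exists (maxn N1 (maxn N2 N3)) => n; rewrite !geq_max.
move=> /and3P[/NP1 h1 /NP2 h2 /NP3 h3].
have -> : inner (u n) (v n) - inner l m = inner (u n - l) (v n) + inner l (v n - m).
  by rewrite innerBl innerBr; ring.
rewrite (le_lt_trans (cmodD _ _)) //.
have k1 : cmod (inner (u n - l) (v n)) <= e / c / 2 * (nr m + 1).
  by rewrite (le_trans (cmod_inner _ _)) // ler_pM ?nr_ge0 // ltW.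
have k2 : cmod (inner l (v n - m)) <= e / c / 2 * nr l.
  by rewrite (le_trans (cmod_inner _ _)) // mulrC ler_wpM2r ?nr_ge0 // ltW.
have : e / c / 2 * (nr m + 1) + e / c / 2 * nr l = e / 2.
  by rewrite -mulrDr /c; field; rewrite gt_eqF.
by move=> k3; lra.
Qed.

Lemma adh_seq (H : hilbertType R) (X : set H) x : adh X x ->
  exists u, (forall n, X (u n)) /\ nlim u x.
Proof.
move=> ax; have /choice[u uP] n : exists y, X y /\ nr (x - y) < n.+1%:R^-1.
  by have [y Xy hy] := ax n.+1%:R^-1 ltac:(by rewrite invr_gt0); exists y.
exists u; split=> [n|e e0]; first by case: (uP n).
have [N NP] := inv_natS_lt e0; exists N => n Nn.
by rewrite nrB (lt_trans _ (NP _ Nn)) //; case: (uP n).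
Qed.

Lemma adh_of_orth (H : hilbertType R) (X : set H) x : is_subspace X ->
  (forall k, orth X k -> inner x k = 0) -> adh X x.
Proof.
move=> lX h; have [P [aP oP]] := proj_exists lX.
have o : orth X (x - P x) by move=> y Xy; rewrite innerC oP // conjC0.
have : inner (x - P x) (x - P x) = 0.
  by rewrite {1}innerBl h // (orth_adh o (aP x)) subrr.
by move=> /inner_zero/eqP; rewrite subr_eq0 => /eqP ->.
Qed.

End Limits.

Section Induction.
Context (R : realType) (H W : hilbertType R) (I : Type).
Context (Z : I -> H -> W) (Zs : I -> W -> H).
Hypotheses (bZ : forall i, blin (Z i)) (aZ : forall i, adj_pair (Z i) (Zs i)).
Hypothesis tZ : is_total [set w | exists i h, w = Z i h].
Implicit Types (X : bop H) (Y : bop W).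

Definition gram_commutes X :=
  forall i j h, X (Zs j (Z i h)) = Zs j (Z i (X h)).

Lemma adj_blin i : blin (Zs i).
Proof.
have [g bg hg] := blin_adj (bZ i).
suff -> : Zs i = g by [].
by apply/funext => y; apply: inner_inj => x; rewrite -hg aZ.
Qed.

Lemma gram_commutes_star X : gram_commutes X -> gram_commutes (star X).
Proof.
move=> hX i j h; apply: inner_inj => k.
by rewrite -bop_starE -!aZ -!(adj_pairC (aZ i)) -hX bop_starE.
Qed.

Let gset : set (bop H) := [set T | exists i j, forall h, T h = Zs j (Z i h)].

Let gsetP X : commutant gset X <-> gram_commutes X.
Proof.
split=> [hX i j h|hX T [i [j TE]]]; last first.
  by apply: bopP => h; rewrite !bopM !TE hX.
have [T TE] := blin_bop (blin_comp (adj_blin j) (bZ i)).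
have := congr1 (fun U : bop H => U h) (hX T _); rewrite !bopM !TE /=; apply.
by exists i, j.
Qed.

Let gset_star : star_closed gset.
Proof.
move=> T [i [j TE]]; exists j, i => h; apply: inner_inj => k.
by rewrite -bop_starE TE (adj_pairC (aZ j)) aZ.
Qed.

Lemma pos_root_gram X : op_pos X -> gram_commutes X ->
  exists C, [/\ gram_commutes C, star C = C & C * C = X].
Proof.
move=> pX /gsetP hX.
have [C [/gsetP]] := pos_root (commutant_subalg gset_star)
  (@commutant_norm_closed _ _ _) (@commutant_one _ _ _) hX pX.
by exists C.
Qed.

Let ev (s : seq (I * H)) X := \sum_(p <- s) Z p.1 (X p.2).

Let evD s X X' : ev s (X + X') = ev s X + ev s X'.
Proof. rewrite -big_split; apply: eq_bigr => p _; exact: linD (bZ p.1).1. Qed.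

Let evZ s c X : ev s (c *: X) = c *: ev s X.
Proof. rewrite scaler_sumr; apply: eq_bigr => p _; exact: linZ (bZ p.1).1. Qed.

Let ev_inner s t X X' : gram_commutes X' ->
  inner (ev s X) (ev t X') = inner (ev s (star X' * X)) (ev t 1).
Proof.
move=> hX; rewrite !inner_suml; apply: eq_bigr => p _.
rewrite !inner_sumr; apply: eq_bigr => q _.
rewrite -!(adj_pairC (aZ q.1)) bopM -(gram_commutes_star hX) [RHS]bop_starE.
by rewrite starK.
Qed.

(** Operators commuting with all [Z_j^* Z_i] can be transported along the [Z_i].
    If [c] bounds [X] and [C^2 = c^2 - X^* X], then [C] commutes with the
    [Z_j^* Z_i] too, and
    [|sum Z_i X h_i|^2 + |sum Z_i C h_i|^2 = c^2 |sum Z_i h_i|^2]. *)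
Lemma induce X : gram_commutes X -> exists Y, forall i h, Y (Z i h) = Z i (X h).
Proof.
move=> hX; have := hX => /gsetP hX'.
pose c := opnorm X + 1; have c0 : 0 < c by rewrite ltr_wpDl ?opnorm_ge0.
have Xc x : nr (X x) <= c * nr x.
  by rewrite (le_trans (opnormP _ _)) // ler_wpM2r ?nr_ge0 // lerDl.
have [C [/gsetP hC sC CC]] := defect_root (commutant_subalg gset_star)
  (@commutant_norm_closed _ _ _) (@commutant_one _ _ _) hX' c0 Xc.
have bound s : nr (ev s X) <= c * nr (ev s 1).
  have e1 : (nr (ev s X) ^+ 2)%:C%C + (nr (ev s C) ^+ 2)%:C%C =
      (c ^+ 2 * nr (ev s 1) ^+ 2)%:C%C.
    rewrite -!inner_nr ev_inner // [inner (ev s C) _]ev_inner // -innerDl -evD sC CC.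
    by rewrite addrC subrK evZ innerZl inner_nr -rmorphM.
  have {e1} : nr (ev s X) ^+ 2 + nr (ev s C) ^+ 2 = c ^+ 2 * nr (ev s 1) ^+ 2.
    by apply: complexI; rewrite rmorphD.
  rewrite -ler_sqr ?nnegrE ?mulr_ge0 ?nr_ge0 ?(ltW c0) // exprMn => <-.
  by rewrite lerDl sqr_ge0.
have ev_lin a s t X' : ev ([seq (p.1, a *: p.2) | p <- s] ++ t) X' =
    a *: ev s X' + ev t X'.
  rewrite /ev big_cat big_map /= scaler_sumr; congr (_ + _).
  by apply: eq_bigr => p _; rewrite bopZ linZ //; case: (bZ p.1).
have [||| |f bf fE] := @graph_ext _ W W
  (fun x y => exists s, x = ev s 1 /\ y = ev s X) c (ltW c0).
- by exists [::]; rewrite /ev !big_nil.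
- move=> a x y x' y' [s [-> ->]] [t [-> ->]].
  by exists ([seq (p.1, a *: p.2) | p <- s] ++ t); rewrite !ev_lin.
- by move=> x y [s [-> ->]].
- move=> k ok; apply: tZ => _ [i [h ->]]; apply: ok.
  by exists (ev [:: (i, h)] X), [:: (i, h)]; rewrite /ev !big_seq1.
have [Y YE] := blin_bop bf; exists Y => i h; rewrite YE; apply: fE.
by exists [:: (i, h)]; rewrite /ev !big_seq1.
Qed.

Lemma induce_uniq Y Y' : (forall i h, Y (Z i h) = Y' (Z i h)) -> Y = Y'.
Proof. by move=> e; apply: (total_eq tZ) => _ [i [h ->]]. Qed.

Lemma induce_star X Y Y' : gram_commutes X ->
  (forall i h, Y (Z i h) = Z i (X h)) -> (forall i h, Y' (Z i h) = Z i (star X h)) ->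
  Y' = star Y.
Proof.
move=> hX hY hY'; apply: induce_uniq => i h; apply/eqP; rewrite -subr_eq0.
apply/eqP; apply: tZ => _ [j [k ->]].
rewrite innerBr -bop_starE hY hY' -!(adj_pairC (aZ i)) -hX.
by rewrite [X in _ - X]bop_starE subrr.
Qed.

End Induction.

Section VectorLift.
Context (R : realType) (H K : hilbertType R) (I : Type).
Context (Z : I -> H -> K) (D : set (bop H)) (g : bop H -> bop K).
Hypotheses (bZ : forall i, blin (Z i)).
Hypothesis tZ : is_total [set w | exists i h, w = Z i h].
Hypothesis sD : star_closed D.
Hypothesis g_star : forall d, D d -> g (star d) = star (g d).
Hypothesis gZ : forall d i h, D d -> g d (Z i h) = Z i (d h).

(** Any two vectors of [K] lie in the closed span of the ranges of countably many
    [Z_n], which may be scaled so that [A k = (Z_n^* k)_n] is bounded from [K] to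
    [ell2 H].  It intertwines [g] with the amplification, and the isometric part
    of its polar decomposition carries the two vectors to [ell2 H]. *)
Lemma vector_lift w w' : exists u u' : ell2 H,
  forall d, D d -> inner (g d w) w' = inner (diag d u) u'.
Proof.
have [i0 _] : exists i : I, True.
  apply: contrapT => noI; have [k k0] := @hilbert_nz R K.
  move/eqP: k0; apply; apply: tZ => x [i _]; case: noI; by exists i.
have /choice[Zs aZ'] i : exists f, blin f /\ adj_pair (Z i) f.
  by have [f bf af] := blin_adj (bZ i); exists f.
have aZ i : adj_pair (Z i) (Zs i) by case: (aZ' i).
have bZs i : blin (Zs i) by case: (aZ' i).
pose ev (s : seq (I * H)) := \sum_(p <- s) Z p.1 p.2.
pose S := [set x | exists s, x = ev s].
have lS : is_subspace S.
  split; first by exists [::]; rewrite /ev big_nil.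
  move=> a _ _ [s ->] [t ->]; exists ([seq (p.1, a *: p.2) | p <- s] ++ t).
  rewrite /ev big_cat big_map /= scaler_sumr; congr (_ + _).
  by apply: eq_bigr => p _; rewrite linZ //; case: (bZ p.1).
have dS : adh S = setT.
  apply: total_dense => // k ok; apply: tZ => _ [i [h ->]]; apply: ok.
  by exists [:: (i, h)]; rewrite /ev big_seq1.
have seqs x : exists s : nat -> seq (I * H), nlim (ev \o s) x.
  have /adh_seq[u [uS ux]] : adh S x by rewrite dS.
  have /choice[s sP] n := uS n; exists s => e /ux[N NP]; exists N => n /NP.
  by rewrite /= -sP.
have [s sw] := seqs w; have [t tw] := seqs w'.
(* An enumeration of all the indices occurring in the s_n and the t_n. *)
pose J k := if unpickle k is Some (b, n, j) then
  (nth (i0, 0) (if b then s n else t n) j).1 else i0.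
have JP (b : bool) n p : List.In p (if b then s n else t n) -> exists m, J m = p.1.
  move=> /(List.In_nth _ _ (i0, 0))[j [_ jp]]; exists (pickle (b, n, j)).
  by rewrite /J pickleK -jp; congr (_.1); elim: (if b then _ else _) j {jp} => [|a l IH] [|j] //=.
have J_orth k : (forall m, Zs (J m) k = 0) -> inner w k = 0 /\ inner w' k = 0.
  move=> hk.
  have ev0 (b : bool) n : inner (ev (if b then s n else t n)) k = 0.
    have := JP b n; elim: (if b then _ else _) => [|p l IH] h.
      by rewrite /ev big_nil inner0l.
    rewrite /ev big_cons innerDl aZ; have [m <-] := h p (or_introl erefl).
    by rewrite hk inner0r add0r IH // => q ql; apply: h; right.
  have lim0 x (r : nat -> seq (I * H)) : nlim (ev \o r) x ->
      (forall n, inner (ev (r n)) k = 0) -> inner x k = 0.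
    move=> rx r0; apply: clim_uniq (clim_inner rx (nlim_cst k)) _.
    by move=> e e0; exists 0%N => n _ /=; rewrite r0 subrr cmod0.
  by split; [exact: lim0 sw (ev0 true)|exact: lim0 tw (ev0 false)].
have /choice[c cP] n : exists c : R, 0 <= c /\ forall x, nr (Zs (J n) x) <= c * nr x.
  by have [_ [c c0 cP]] := bZs (J n); exists c.
pose a n : R := 2^-1 ^+ n / (c n + 1).
have c1 n : 0 < c n + 1 by rewrite ltr_wpDl //; case: (cP n).
have a0 n : 0 < a n by rewrite divr_gt0 // exprn_gt0 // invr_gt0.
have [A bA AE] : exists2 A : K -> ell2 H, blin A &
    forall x n, coord (A x) n = (a n)%:C%C *: Zs (J n) x.
  apply: (@ell2_map R H K _ (Num.sqrt 2)) => [|n b x y|x N]; first exact: sqrtr_ge0.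
    by rewrite (bZs _).1 scalerDr !scalerA mulrC.
  have geo M : \sum_(n < M) (2^-1 : R) ^+ n = 2 - 2 * (2^-1) ^+ M.
    elim: M => [|M IH]; first by rewrite big_ord0 expr0; ring.
    by rewrite big_ord_recr /= IH exprS; field.
  rewrite exprMn sqr_sqrtr // (@le_trans _ _ (\sum_(n < N) 2^-1 ^+ n * nr x ^+ 2)) //.
    apply: ler_sum => n _; rewrite nrZ cmod_real ger0_norm ?(ltW (a0 n)) //.
    rewrite (@le_trans _ _ ((2^-1 ^+ n * nr x) ^+ 2)) //.
      rewrite ler_sqr ?nnegrE ?mulr_ge0 ?nr_ge0 ?exprn_ge0 ?invr_ge0 ?(ltW (a0 n)) ?(ltW (c1 n)) //.
      have -> : 2^-1 ^+ n = a n * (c n + 1) by rewrite divfK // gt_eqF.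
      rewrite -[leRHS]mulrA ler_wpM2l ?(ltW (a0 n)) // (le_trans ((cP n).2 x)) //.
      by rewrite ler_wpM2r ?nr_ge0 // lerDl.
    rewrite exprMn ler_wpM2r ?sqr_ge0 // expr2 ler_piMl ?exprn_ge0 ?invr_ge0 //.
    by rewrite exprn_ile1 ?invr_ge0 // invf_le1 // ler1n.
  by rewrite -big_distrl /= geo ler_wpM2r ?sqr_ge0 // gerBl mulr_ge0 // exprn_ge0 // invr_ge0.
have Zs_g d i x : D d -> Zs i (g d x) = d (Zs i x).
  move=> Dd; apply: inner_inj => h; rewrite -aZ -[g d]starK -g_star //.
  rewrite -bop_starE gZ; last exact: sD.
  by rewrite aZ bop_starE starK.
have Ag d x : D d -> A (g d x) = diag d (A x).
  by move=> Dd; apply: coordP => n; rewrite coord_diag !AE Zs_g // bopZ.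
have [P PE] := gram_op bA.
pose gD := g @` D.
have sgD : star_closed gD.
  by move=> _ [d Dd <-]; exists (star d); [exact: sD|rewrite g_star].
have gP : commutant gD P.
  move=> _ [d Dd <-]; apply: bopP => x; apply: inner_inj => y.
  rewrite innerC [RHS]innerC; congr (_^*); rewrite !bopM PE Ag //.
  rewrite [RHS]bop_starE PE -g_star // Ag; last exact: sD.
  by rewrite diag_star bop_starE.
have pP : op_pos P by move=> x; rewrite PE inner_ge0.
have [Q [gQ sQ QQ]] := pos_root (commutant_subalg sgD)
  (@commutant_norm_closed _ _ _) (@commutant_one _ _ _) gP pP.
have QE x y : inner (Q x) (Q y) = inner (A x) (A y).
  by rewrite bop_starE sQ innerC -bopM QQ PE -innerC.
have nQA x : nr (Q x) = nr (A x).
  apply/eqP; rewrite -(@eqrXn2 _ 2) ?nr_ge0 //; apply/eqP/complexI.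
  by rewrite -!inner_nr QE.
pose rQ := [set y | exists x, y = Q x].
have lQ : is_subspace rQ.
  split; first by exists 0; rewrite bop0.
  by move=> b _ _ [x ->] [y ->]; exists (b *: x + y); rewrite bop_linear.
have orthQ k : orth rQ k -> inner w k = 0 /\ inner w' k = 0.
  move=> ok; apply: J_orth => m.
  have Qk : Q k = 0.
    by apply: inner_inj => x; rewrite inner0r -[Q]sQ -bop_starE ok //; exists x.
  have Ak : A k = 0 by apply: nr0_eq0; rewrite -nQA Qk nr0.
  have := AE k m; rewrite Ak => /esym/eqP; rewrite scaler_eq0 => /orP[|/eqP //].
  by move=> /eqP/complexI/eqP; rewrite gt_eqF.
have lift x : (forall k, orth rQ k -> inner x k = 0) ->
    exists (y : nat -> K) u, nlim (fun n => Q (y n)) x /\ nlim (fun n => A (y n)) u.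
  move=> /(adh_of_orth lQ)/adh_seq[v [vQ vx]]; have /choice[y yE] n := vQ n.
  have {}vx : nlim (fun n => Q (y n)) x.
    by move=> e /vx[N NP]; exists N => n /NP; rewrite yE.
  have [u uP] : exists u, nlim (fun n => A (y n)) u.
    apply: ncauchy => e e0; have [N NP] := vx (e / 2) ltac:(by rewrite divr_gt0).
    exists N => m n /NP h1 /NP h2; rewrite -(linB _ _ bA.1) -nQA.
    rewrite (linB _ _ (bop_linear Q)) (le_lt_trans (nr_tri _ x _)) //.
    by rewrite [nr (x - _)]nrB; lra.
  by exists y, u.
have [y [u [yw yu]]] := lift w (fun k ok => (orthQ k ok).1).
have [y' [u' [yw' yu']]] := lift w' (fun k ok => (orthQ k ok).2).
exists u, u' => d Dd.
apply: clim_uniq (clim_inner (nlim_blin (bop_blin (g d)) yw) yw') _.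
apply: eq_clim (clim_inner (nlim_blin (bop_blin (diag d)) yu) yu') => n.
by rewrite -Ag // -QE -!bopM gQ //; exists d.
Qed.

End VectorLift.

(** * Normal maps and bicommutants *)

Section Normality.
Context (R : realType).

(** Normality becomes a statement on functionals, with no filter left. *)
Lemma normal_of_functionals (H W : hilbertType R) (D : set (bop H))
    (f : bop H -> bop W) :
  (forall u v : ell2 W, exists u' v' : ell2 H, forall T, D T ->
     inner (diag (f T) u) v = inner (diag T u') v') ->
  normal_on D f.
Proof.
move=> h F T FF FD DT FT w /uw_functionalP[u [v wE]].
have [u' [v' e]] := h u v.
have uw' : uw_functional (fun S : bop H => inner (diag S u') v').
  by apply/uw_functionalP; exists u', v'.
have lim : inner (diag S u') v' @[S --> F] --> (inner (diag T u') v' : R[i]^o).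
  exact: FT _ uw'.
have eT : w (f T) = inner (diag T u') v' by rewrite (wE (f T)) (e T DT).
rewrite eT => A /lim hA.
have : F (D `&` [set S | A (inner (diag S u') v')]) by apply: filterI.
move=> hF; suff : F [set S | A (w (f S))] by [].
by apply: filterS hF => S [DS AS] /=; rewrite (wE (f S)) e.
Qed.

(** A map spatially implemented by a family with dense ranges is normal: so is its
    amplification, to which [vector_lift] applies. *)
Lemma intertwiner_functionals (H W : hilbertType R) (I : Type) (Z : I -> H -> W)
    (D : set (bop H)) (f : bop H -> bop W) :
  (forall i, blin (Z i)) -> is_total [set w | exists i h, w = Z i h] ->
  star_closed D -> (forall d, D d -> f (star d) = star (f d)) ->
  (forall d i h, D d -> f d (Z i h) = Z i (d h)) ->
  forall u v : ell2 W, exists u' v' : ell2 H, forall d, D d ->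
    inner (diag (f d) u) v = inner (diag d u') v'.
Proof.
move=> bZ tZ sD fs fZ u v.
pose Z' (p : nat * I) h : ell2 W := single p.1 (Z p.2 h).
have := @vector_lift R H (ell2 W) (nat * I)%type Z' D (fun d => diag (f d)).
apply => //.
- move=> p; exact (blin_comp (@single_blin R W p.1) (bZ p.2)).
- move=> k ok; apply: coordP => n; apply: tZ => _ [i [h ->]].
  by rewrite -inner_singlel; apply: ok; exists (n, i), h.
- by move=> d Dd; rewrite fs // diag_star.
by move=> d [n i] h Dd; rewrite /Z' /= diag_single fZ.
Qed.

End Normality.

Section Projections.
Context (R : realType) (H : hilbertType R).

Context (X : set H) (P : bop H).
Hypotheses (lX : is_subspace X) (PX : is_proj X P).

Lemma proj_fix x : adh X x -> P x = x.
Proof.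
move=> ax; apply: (adh_orth0 lX) => //; first exact: proj_adh.
by move=> z Xz; rewrite -opprB innerNr innerC (proj_orth PX) // conjC0 oppr0.
Qed.

Lemma proj_idem x : P (P x) = P x.
Proof. exact/proj_fix/(proj_adh PX). Qed.

Lemma proj_star : star P = P.
Proof.
have h x y : inner (P x) y = inner (P x) (P y).
  apply/eqP; rewrite -subr_eq0 -innerBr; apply/eqP.
  apply: (orth_adh (X := X)); last exact: proj_adh.
  by move=> z Xz; rewrite innerC (proj_orth PX) // conjC0.
apply: bopP => y; apply: inner_inj => x.
by rewrite -bop_starE [RHS]innerC [in RHS]h -innerC h.
Qed.

Lemma proj_eq0 x : orth X x -> P x = 0.
Proof.
move=> ox; apply: inner_zero; rewrite bop_starE proj_star proj_idem.
by rewrite innerC (orth_adh ox) ?conjC0 //; exact: proj_adh.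
Qed.

Lemma proj_comm (S : bop H) : (forall x, X x -> X (S x)) -> (forall x, X x -> X (star S x)) ->
  P * S = S * P.
Proof.
move=> SX SsX; apply: bopP => x; apply: (adh_orth0 lX) => [||z Xz].
- exact: (proj_adh PX).
- move=> e; have /adh_seq[w [wX wx]] := proj_adh PX x.
  by move=> /(nlim_blin (bop_blin S) wx)[N NP]; exists (S (w N)); [exact: SX|rewrite nrB NP].
have -> : (P * S) x - (S * P) x = S (x - P x) - (S x - P (S x)).
  by rewrite !bopM (linB _ _ (bop_linear S)); hring.
rewrite innerBr [X in _ - X]innerC (proj_orth PX) // conjC0 subr0.
by rewrite innerC bop_starE (proj_orth PX) ?conjC0 //; apply: SsX.
Qed.

End Projections.

Section BicommutantTheory.
Context (R : realType) (H : hilbertType R) (B : set (bop H)).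
Implicit Types (T S b : bop H).

(** In use, [q] is a composite of maps between different spaces. *)
Lemma bicommutant_commute T (q : H -> H) : bicommutant B T -> blin q ->
  (forall b h, B b -> q (b h) = b (q h)) -> forall h, T (q h) = q (T h).
Proof.
move=> MT bq qB h; have [Q QE] := blin_bop bq.
have hQ : commutant B Q by move=> b Bb; apply: bopP => x; rewrite !bopM !QE qB.
by rewrite -!QE -!bopM MT.
Qed.

Lemma bicommutant_star_closed : star_closed B -> star_closed (bicommutant B).
Proof. by move=> sB; apply/commutant_star_closed/commutant_star_closed. Qed.

Lemma bicommutant_subalg : star_closed B -> star_subalg (bicommutant B).
Proof. by move=> sB; apply/commutant_subalg/commutant_star_closed. Qed.

(** Von Neumann's density theorem, stated for functionals: the projection onto the
    closure of [B u] in [ell2 H] has its matrix entries in the commutant of [B],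
    and thus commutes with the amplification of the bicommutant. *)
Lemma bicommutant_dense : star_subalg B -> B 1 -> forall u v : ell2 H,
  (forall b, B b -> inner (diag b u) v = 0) ->
  forall T, bicommutant B T -> inner (diag T u) v = 0.
Proof.
move=> hB B1 u v uv T MT.
pose X := [set x | exists2 b, B b & x = diag b u].
have lX : is_subspace X.
  split; first by exists 0; [exact: star_subalg0|rewrite (lin0 (@diag_linear _ _))].
  move=> c _ _ [b Bb ->] [b' Bb' ->]; exists (c *: b + b').
    by apply: star_subalgD => //; apply: star_subalgZ.
  by rewrite diag_linear.
have [P PX] := proj_exists lX.
have XB b x : B b -> X x -> X (diag b x).
  move=> Bb [b' Bb' ->]; exists (b * b'); first exact: star_subalgM.
  by rewrite diagM.
have PB b x : B b -> P (diag b x) = diag b (P x).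
  move=> Bb; rewrite -!bopM (proj_comm lX PX) // => y Xy; first exact: XB.
  by rewrite -diag_star; apply: XB => //; apply: star_subalgS.
have PT x : P (diag T x) = diag T (P x).
  have tS := @total_single R H.
  suff e : P * diag T = diag T * P by have := congr1 (fun U : bop (ell2 H) => U x) e.
  apply: (total_eq tS) => _ [k [y ->]]; rewrite !bopM diag_single.
  apply: coordP => n; rewrite coord_diag; apply/esym.
  apply: (bicommutant_commute (q := fun h => coord (P (single k h)) n) MT).
    have bP : blin (P \o single k) by apply: blin_comp (bop_blin P) (@single_blin R H k).
    exact: (@blin_comp R H (ell2 H) H (fun w => coord w n) _ (@coord_blin R H n) bP).
  by move=> b h Bb; rewrite -diag_single PB // coord_diag.
have Pu : P u = u by apply: (proj_fix lX PX); apply: sub_adh; exists 1; rewrite ?diag1.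
have vX : orth (adh X) v by apply: orth_adh => _ [b Bb ->]; exact: uv.
by rewrite -Pu -PT vX //; exact: (proj_adh PX).
Qed.

End BicommutantTheory.

Section IntertwinerIso.
Context (R : realType) (H W : hilbertType R) (I : Type) (B : set (bop H)).
Context (Z : I -> H -> W) (Zs : I -> W -> H) (eta : bop H -> bop W).
Hypotheses (bZ : forall i, blin (Z i)) (aZ : forall i, adj_pair (Z i) (Zs i)).
Hypothesis tZ : is_total [set w | exists i h, w = Z i h].
Hypothesis Z0 : forall h, (forall i, Z i h = 0) -> h = 0.
Hypothesis sB : star_closed B.
Hypothesis BZ : forall b, B b -> gram_commutes Z Zs b.
Hypothesis etaZ : forall b i h, B b -> eta b (Z i h) = Z i (b h).

Let M := bicommutant B.
Let N := bicommutant (eta @` B).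

Let bZs i : blin (Zs i).
Proof. exact: adj_blin bZ aZ i. Qed.

Let tZs : is_total [set h | exists i w, h = Zs i w].
Proof.
move=> h oh; apply: Z0 => i; apply: inner_inj => w.
by rewrite -(adj_pairC (aZ i)) inner0r oh //; exists i, w.
Qed.

Let eta_star b : B b -> eta (star b) = star (eta b).
Proof.
move=> Bb; apply: (induce_star aZ tZ (BZ Bb)) => i h; first exact: etaZ.
exact/etaZ/sB.
Qed.

Let Zs_eta b i w : B b -> Zs i (eta b w) = b (Zs i w).
Proof.
move=> Bb; apply: inner_inj => h; rewrite -aZ -[eta b]starK -bop_starE -eta_star //.
by rewrite etaZ ?aZ ?bop_starE ?starK //; exact: sB.
Qed.

Let MZ T : M T -> gram_commutes Z Zs T.
Proof.
move=> MT i j h; apply: (bicommutant_commute (q := fun h => Zs j (Z i h)) MT).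
  exact: blin_comp (bZs j) (bZ i).
by move=> b x Bb; rewrite BZ.
Qed.

Let NZ Y : N Y -> forall i j w, Y (Z j (Zs i w)) = Z j (Zs i (Y w)).
Proof.
move=> NY i j w; apply: (bicommutant_commute (q := fun w => Z j (Zs i w)) NY).
  exact: blin_comp (bZ j) (bZs i).
by move=> _ x [b Bb <-]; rewrite Zs_eta // etaZ.
Qed.

Let sM : star_closed M.
Proof. exact: bicommutant_star_closed. Qed.

(** The family [Z] identifies the von Neumann algebra generated by [B] with the one
    generated by the image of [B]: both are reconstructed from the commutant, and
    a family of intertwiners [Z_i] with dense ranges and no common kernel is enough
    to compare the two commutants. *)
Lemma intertwiner_iso : extends_to_normal_iso M B eta.
Proof.
have /choice[f fP] T : exists Y : bop W, M T -> forall i h, Y (Z i h) = Z i (T h).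
  have [MT|nMT] := pselect (M T); last by exists 0.
  by have [Y YP] := induce bZ aZ tZ (MZ MT); exists Y.
have uniq := induce_uniq tZ.
have hM := bicommutant_subalg sB.
have f_star T : M T -> f (star T) = star (f T).
  move=> MT; apply: (induce_star aZ tZ (MZ MT)) => i h; first exact: fP.
  exact/fP/sM.
exists f; split.
- split.
  + move=> c S T MS MT; apply: uniq => i h.
    have MST : M (c *: S + T) by apply: (star_subalgD hM) => //; apply: (star_subalgZ _ hM).
    have -> : (c *: f S + f T) (Z i h) = c *: f S (Z i h) + f T (Z i h) by [].
    have -> : f (c *: S + T) (Z i h) = Z i (c *: S h + T h) by rewrite fP.
    by rewrite (bZ i).1 !fP.
  + move=> S T MS MT; apply: uniq => i h.
    by rewrite bopM !fP //; exact: (star_subalgM hM).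
  + exact: f_star.
- apply: normal_of_functionals; apply: (intertwiner_functionals bZ tZ) => //.
  by move=> d i h Md; exact: fP.
- split.
  + move=> T MT Y hY; apply: uniq => i h; rewrite !bopM (fP _ MT).
    have q : blin (fun h => Zs i (Y (Z i h))).
      exact: blin_comp (bZs i) (blin_comp (bop_blin Y) (bZ i)).
    apply/eqP; rewrite -subr_eq0; apply/eqP; apply: tZ => _ [j [k ->]].
    have bq : blin (fun h => Zs j (Y (Z i h))).
      exact: blin_comp (bZs j) (blin_comp (bop_blin Y) (bZ i)).
    have BQ b x : B b -> Zs j (Y (Z i (b x))) = b (Zs j (Y (Z i x))).
      move=> Bb; rewrite -etaZ //; have hYb : Y * eta b = eta b * Y.
        by apply: hY; exists b.
      by rewrite -[Y (eta b _)]/((Y * eta b) _) hYb bopM Zs_eta.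
    have e := bicommutant_commute MT bq BQ h.
    rewrite innerBr -[f T]starK -f_star // -bop_starE fP; last exact: sM.
    by rewrite !aZ -e bop_starE starK subrr.
  + move=> S T /set_mem MS /set_mem MT e; apply: bopP => h.
    apply/eqP; rewrite -subr_eq0; apply/eqP; apply: Z0 => i.
    by rewrite (linB _ _ (bZ i).1) -(fP _ MS) -(fP _ MT) e subrr.
  + move=> Y NY.
    have aZs i : adj_pair (Zs i) (Z i) by apply: adj_pairC.
    have cY : gram_commutes Zs Z Y by move=> i j w; exact: NZ.
    have cYs := gram_commutes_star aZs cY.
    have [T TE] := induce bZs aZs tZs cY.
    have [Ts TsE] := induce bZs aZs tZs cYs.
    have TsT := induce_star aZs tZs cY TE TsE.
    have MT : M T.
      move=> Q hQ; apply: (total_eq tZs) => _ [i [w ->]].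
      apply/eqP; rewrite -subr_eq0; apply/eqP; apply: tZs => _ [j [w' ->]].
      have bq : blin (fun w => Z j (Q (Zs i w))).
        exact: blin_comp (bZ j) (blin_comp (bop_blin Q) (bZs i)).
      have BQ b x : (eta @` B) b -> Z j (Q (Zs i (b x))) = b (Z j (Q (Zs i x))).
        move=> [b' Bb' <-]; rewrite Zs_eta // etaZ //; congr (Z j _).
        by rewrite -!bopM hQ.
      have e := bicommutant_commute NY bq BQ w.
      rewrite innerBr !bopM TE -[T]starK -TsT -bop_starE TsE !(aZs j).
      by rewrite bop_starE starK e subrr.
    exists T => //; apply: uniq => i h; rewrite fP //.
    apply: inner_inj => w; rewrite -(adj_pairC (aZ i)) -[T]starK -TsT -bop_starE.
    by rewrite TsE (aZs i) bop_starE starK.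
- move=> b Bb; apply: uniq => i h; rewrite etaZ // fP //.
  exact: sub_bicommutant.
Qed.

End IntertwinerIso.

(** * Normal extension of a conditional expectation *)

Section DensityCorollaries.
Context (R : realType) (H : hilbertType R).

(** The amplification of the amplification is carried back to [ell2 H] by the
    embeddings [single k \o single n]: sums of ultraweakly continuous functionals
    are of the same form. *)
Lemma functional_add (u v u' v' : ell2 H) : exists w w' : ell2 H, forall T : bop H,
  inner (diag T w) w' = inner (diag T u) v + inner (diag T u') v'.
Proof.
have [|||||w [w' ww']] := @vector_lift R H (ell2 (ell2 H)) (nat * nat)%type
  (fun p h => single p.1 (single p.2 h)) setT (fun d => diag (diag d)) _ _ _ _ _
  (single 0%N u + single 1%N u') (single 0%N v + single 1%N v').
- move=> p; exact: (@blin_comp R H (ell2 H) _ _ _ (@single_blin R (ell2 H) p.1)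
    (@single_blin R H p.2)).
- move=> k ok; apply: coordP => n; apply: coordP => m; apply: inner_inj => x.
  rewrite -[LHS]inner_singlel -[LHS]inner_singlel ok; last by exists (n, m), x.
  by rewrite inner0r.
- by [].
- by move=> d _; rewrite !diag_star.
- by move=> d p h _; rewrite !diag_single.
exists w, w' => T; rewrite -ww' //.
rewrite bopD !diag_single innerDl !innerDr !inner_singlel !coord_single /=.
by rewrite !inner0r addr0 add0r.
Qed.

Lemma functional_single (T : bop H) x y :
  inner (T x) y = inner (diag T (single 0%N x)) (single 0%N y).
Proof. by rewrite diag_single inner_singlel coord_single. Qed.

Context (B : set (bop H)).
Hypotheses (hB : star_subalg B) (B1 : B 1).

Lemma bicommutant_functional_eq (u v u' v' : ell2 H) :
  (forall b, B b -> inner (diag b u) v = inner (diag b u') v') ->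
  forall T, bicommutant B T -> inner (diag T u) v = inner (diag T u') v'.
Proof.
move=> h T MT; have [w [w' ww']] := functional_add u v u' (- v').
apply/eqP; rewrite -subr_eq0 -innerNr -ww'; apply/eqP.
apply: (bicommutant_dense hB B1) MT => b Bb.
by rewrite ww' innerNr h // subrr.
Qed.

Lemma bicommutant_inner_eq x y x' y' :
  (forall b, B b -> inner (b x) y = inner (b x') y') ->
  forall T, bicommutant B T -> inner (T x) y = inner (T x') y'.
Proof.
move=> h T MT; rewrite !functional_single.
by apply: bicommutant_functional_eq MT => b Bb; rewrite -!functional_single h.
Qed.

End DensityCorollaries.

(** For a von Neumann algebra [D] the projection is in [D], so that a faithful
    representation of [D] can decide whether [X] is zero. *)
Lemma proj_bicommutant (R : realType) (H : hilbertType R) (D : set (bop H)) (X : set H) :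
  star_closed D -> is_subspace X -> (forall y x, commutant D y -> X x -> X (y x)) ->
  exists2 P, is_proj X P & bicommutant D P.
Proof.
move=> sD lX cX; have [P PX] := proj_exists lX; exists P => // y cy.
apply: (proj_comm lX PX) => x Xx; first exact: cX.
by apply: cX => //; exact: commutant_star_closed.
Qed.

(** The closure of this subspace carries the GNS representation of the vector state
    of [xi] on [D]. *)
Lemma cyclic_subspace (R : realType) (H : hilbertType R) (D : set (bop H)) (xi : H) :
  star_subalg D -> is_subspace [set x | exists2 a, D a & x = a xi].
Proof.
move=> hD; split; first by exists 0; [exact: star_subalg0|].
move=> c _ _ [a Da ->] [b Db ->]; exists (c *: a + b) => //.
by apply: star_subalgD => //; exact: star_subalgZ.
Qed.

Section Expectation.
Context (R : realType) (H : hilbertType R) (xi : H) (B D : set (bop H)).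
Context (G : bop H -> bop H).
Hypotheses (hB : star_subalg B) (B1 : B 1) (DB : D `<=` B).
Hypotheses (hD : bicommutant D = D) (sD : star_closed D).
Hypothesis GD : forall x, B x -> D (G x).
Hypothesis Gxi : forall x a b, B x -> D a -> D b ->
  inner (G x (a xi)) (b xi) = inner (x (a xi)) (b xi).
Hypothesis faith : forall a, D a -> (forall b, D b -> a (b xi) = 0) -> a = 0.

Let M := bicommutant B.
Let D' := commutant D.
Let X0 := [set x | exists2 a, D a & x = a xi].

Let hDs : star_subalg D.
Proof. by rewrite -hD; apply: commutant_subalg; exact: commutant_star_closed. Qed.

Let D1 : D 1.
Proof. by rewrite -hD; exact: commutant_one. Qed.

Let lX0 : is_subspace X0.
Proof. exact: cyclic_subspace. Qed.

Let DX0 a x : D a -> X0 x -> X0 (a x).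
Proof. by move=> Da [b Db ->]; exists (a * b) => //; exact: star_subalgM. Qed.

Let D'S : star_closed D'.
Proof. exact: commutant_star_closed. Qed.

Context (e : bop H) (eX : is_proj X0 e).

Let eD a : D a -> e * a = a * e.
Proof. by move=> Da; apply: (proj_comm lX0 eX) => x; apply: DX0 => //; exact: sD. Qed.

Let De a x : D a -> e (a x) = a (e x).
Proof. by move=> /eD h; rewrite -!bopM h. Qed.

Let e_xi a : D a -> e (a xi) = a xi.
Proof. by move=> Da; apply: (proj_fix lX0 eX); apply: sub_adh; exists a. Qed.

Let ee := proj_idem lX0 eX.
Let es := proj_star eX.

(** The projection onto the complement of [D' D xi] lies in [D] and kills [D xi], so
    that faithfulness makes it zero. *)
Lemma commutant_cyclic_total :
  is_total [set w | exists (y : {y | D' y}) h, w = sval y (e h)].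
Proof.
move=> k0 ok0.
pose N := [set k | forall y h, D' y -> inner (y (e h)) k = 0].
have lN : is_subspace N.
  split; first by move=> y h _; rewrite inner0r.
  by move=> c k k' Nk Nk' y h Dy; rewrite innerDr innerZr Nk // Nk' // mulr0 addr0.
have [p pN pD] : exists2 P, is_proj N P & bicommutant D P.
  apply: proj_bicommutant => // y' k Dy' Nk y h Dy.
  rewrite innerC bop_starE -innerC -bopM; apply: Nk.
  by apply: (star_subalgM (commutant_subalg sD)) => //; exact: D'S.
rewrite hD in pD.
have p0 : p = 0.
  apply: faith => // b Db; apply: (proj_eq0 lN pN) => k Nk.
  by rewrite innerC -(e_xi Db) -[e _]/((1 : bop H) (e _)) Nk ?conjC0 //; exact: commutant_one.
have Nk0 : N k0 by move=> y h Dy; apply: ok0; exists (exist _ y Dy), h.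
by rewrite -(proj_fix lN pN (sub_adh Nk0)) p0.
Qed.

Let I := {y | D' y}.
Let Z (y : I) h := sval y (e h).
Let Zs (y : I) h := e (star (sval y) h).

Let bZ y : blin (Z y).
Proof. exact: blin_comp (bop_blin _) (bop_blin _). Qed.

Let aZ y : adj_pair (Z y) (Zs y).
Proof. by move=> h k; rewrite /Z /Zs bop_starE bop_starE es. Qed.

Let tZ := commutant_cyclic_total.

(** By hypothesis the two sides have the same matrix entries between vectors of
    [D xi], and [G x] preserves the closure of [D xi]. *)
Lemma compress_G x : B x -> forall h, e (x (e h)) = G x (e h).
Proof.
move=> Bx h; apply: inner_inj => k; have hG := GD Bx.
have -> : G x (e h) = e (G x (e h)) by rewrite (De _ hG) ee.
have -> : inner k (e (x (e h))) = inner (e k) (x (e h)) by rewrite [RHS]bop_starE es.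
have -> : inner k (e (G x (e h))) = inner (e k) (G x (e h)).
  by rewrite [RHS]bop_starE es.
have key u v : adh X0 u -> adh X0 v -> inner v ((x - G x) u) = 0.
  move=> au av; apply: (orth_adh (X := X0)) av => _ [b Db ->].
  rewrite -[x - _]starK -bop_starE innerC.
  suff -> : inner u (star (x - G x) (b xi)) = 0 by rewrite conjC0.
  apply: (orth_adh (X := X0)) au => _ [a Da ->].
  by rewrite -bop_starE bopB innerBl Gxi // subrr.
by apply/eqP; rewrite -subr_eq0 -innerBr -bopB key //; exact: (proj_adh eX).
Qed.

Let comD y a z : D' y -> D a -> a (y z) = y (a z).
Proof. by move=> Dy Da; rewrite -!bopM Dy. Qed.

(** Both sides are weakly continuous in [T], and for [T] in [B] the compression
    [e T e] is [G T e], where [G T] commutes with the commutant of [D]. *)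
Let X_M T : M T -> gram_commutes Z Zs (e * T * e).
Proof.
move=> MT p q h; rewrite /Zs /Z !bopM !ee.
apply: inner_inj => k; rewrite innerC [RHS]innerC; congr (_^*).
set r := star (sval q) * sval p.
have Dr : D' r.
  apply: (star_subalgM (commutant_subalg sD)); last exact: svalP.
  by apply: D'S; exact: svalP.
have rE x : star (sval q) (sval p x) = r x by [].
rewrite !rE.
have -> : inner (e (T (e (r (e h))))) k = inner (T (e (r (e h)))) (e k).
  by rewrite [LHS]bop_starE es.
have -> : inner (e (r (e (T (e h))))) k = inner (T (e h)) (e (star r (e k))).
  by rewrite bop_starE es bop_starE bop_starE es.
apply: (bicommutant_inner_eq hB B1) MT => b Bb.
have hG := GD Bb.
have -> : inner (b (e (r (e h)))) (e k) = inner (e (b (e (r (e h))))) k.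
  by rewrite [RHS]bop_starE es.
have -> : inner (b (e h)) (e (star r (e k))) = inner (e (r (e (b (e h))))) k.
  by rewrite [RHS]bop_starE es [RHS]bop_starE [RHS]bop_starE es.
by rewrite !(compress_G Bb) -(comD _ Dr hG) (De _ hG).
Qed.

Section Properties.
Context (f : bop H -> bop H).
Hypothesis fP : forall X, gram_commutes Z Zs X -> forall y h, f X (Z y h) = Z y (X h).

(** The operator [y e h |-> y e T e h], for [y] in the commutant of [D]. *)
Definition expectation T := f (e * T * e).

Let E := expectation.
Let uniq := induce_uniq tZ.

Lemma expectationE T y h : M T -> D' y -> E T (y (e h)) = y (e (T (e h))).
Proof.
move=> MT Dy; have := fP (X_M MT) (exist _ y Dy) h.
by rewrite /Z /E /expectation /= => ->; rewrite ee.
Qed.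

Lemma expectation_uniq (S T : bop H) : (forall y h, D' y -> S (y (e h)) = T (y (e h))) -> S = T.
Proof. by move=> h; apply: uniq => -[y Dy] x; exact: h. Qed.

Lemma expectation_in T : M T -> D (E T).
Proof.
move=> MT; rewrite -hD => q Dq; apply: expectation_uniq => y h Dy.
rewrite !bopM expectationE // -[q (y _)]/((q * y) _) expectationE //.
exact: (star_subalgM (commutant_subalg sD)).
Qed.

Lemma expectation_ext x : B x -> E x = G x.
Proof.
move=> Bx; apply: expectation_uniq => y h Dy.
rewrite expectationE //; last exact: sub_bicommutant.
by rewrite compress_G // -!bopM Dy //; exact: GD.
Qed.

Lemma expectation_functionals (u v : ell2 H) : exists u' v' : ell2 H,
  forall T, M T -> inner (diag (E T) u) v = inner (diag T u') v'.
Proof.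
have [|||||u' [v' h]] := @intertwiner_functionals R H H I Z
  (gram_commutes Z Zs) f _ _ _ _ _ u v.
- exact: bZ.
- exact: tZ.
- by move=> X; exact: gram_commutes_star.
- move=> X hX; apply: (induce_star aZ tZ hX) => y x; first exact: fP.
  by apply: fP; exact: gram_commutes_star.
- by move=> X y x hX; exact: fP.
exists (diag e u'), (diag e v') => T MT.
rewrite /E /expectation h; last exact: X_M.
by rewrite !diagM !bopM bop_starE -diag_star es.
Qed.

Lemma expectation_normal : normal_on M E.
Proof. by apply: normal_of_functionals; exact: expectation_functionals. Qed.

Lemma expectation_cond_exp : cond_exp M D E.
Proof.
have hM : star_subalg M by apply: bicommutant_subalg => x; exact: star_subalgS.
have BM := @sub_bicommutant _ _ B.
have DM : D `<=` M by move=> x /DB /BM.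
split.
- move=> c S T MS MT; apply: expectation_uniq => y h Dy.
  have MST : M (c *: S + T) by apply: (star_subalgD hM) => //; exact: (star_subalgZ _ hM).
  have -> : (c *: E S + E T) (y (e h)) = c *: E S (y (e h)) + E T (y (e h)) by [].
  rewrite !expectationE //.
  by rewrite -[(c *: S + T) _]/(c *: S _ + T _) !bop_linear.
- exact: expectation_in.
- move=> d Dd; apply: expectation_uniq => y h Dy; rewrite expectationE //; last exact: DM.
  by rewrite De // ee -!bopM Dy.
- move=> T MT pT.
  have pX : op_pos (e * T * e).
    by move=> h; rewrite !bopM bop_starE es; exact: pT.
  have [C [hC sC CC]] := pos_root_gram bZ aZ pX (X_M MT).
  have fC : f C = star (f C).
    by rewrite -{1}sC; apply: (induce_star aZ tZ hC) => y h; rewrite fP // sC.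
  have ECC : E T = f C * f C.
    apply: uniq => y h; rewrite bopM !(fP hC) /E /expectation fP; last exact: X_M.
    by rewrite -CC bopM.
  by move=> w; rewrite ECC bopM bop_starE -fC inner_ge0.
- move=> s x t Ds Mx Dt; apply: expectation_uniq => y h Dy.
  have Mxt : M (s * x * t).
    by apply: (star_subalgM hM); [apply: (star_subalgM hM) => //|]; exact: DM.
  rewrite expectationE // !bopM (De _ Ds) (comD _ Dy Dt) -(De h Dt) expectationE //.
  by rewrite (comD _ Dy Ds).
Qed.

End Properties.

(** The last clause is normality in the form which allows to compare two
    expectations on a weakly dense algebra. *)
Theorem normal_expectation_ex : exists E, [/\ cond_exp M D E, normal_on M E,
  (forall x, B x -> E x = G x) &
  forall u v : ell2 H, exists u' v' : ell2 H, forall T, M T ->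
    inner (diag (E T) u) v = inner (diag T u') v'].
Proof.
have /choice[f fP] X : exists Y : bop H, gram_commutes Z Zs X ->
    forall y h, Y (Z y h) = Z y (X h).
  have [hX|nX] := pselect (gram_commutes Z Zs X); last by exists 0.
  by have [Y YP] := induce bZ aZ tZ hX; exists Y.
exists (expectation f); split.
- exact: expectation_cond_exp.
- exact: expectation_normal.
- exact: expectation_ext.
- exact: expectation_functionals.
Qed.

(** * The induced representation *)

Hypothesis cyc : is_total [set x | exists2 b, B b & x = b xi].

Section Induced.
Context (V W : hilbertType R) (kappa : bop H -> bop V) (sigma : bop H -> bop W).
Hypothesis hk : normal_faithful_rep D kappa.

Let klin c a b : D a -> D b -> kappa (c *: a + b) = c *: kappa a + kappa b.
Proof. by move=> Da Db; case: hk => -[h _ _] _ _; exact: h. Qed.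

Let kM a b : D a -> D b -> kappa (a * b) = kappa a * kappa b.
Proof. by move=> Da Db; case: hk => -[_ h _] _ _; exact: h. Qed.

Let kS a : D a -> kappa (star a) = star (kappa a).
Proof. by move=> Da; case: hk => -[_ _ h] _ _; exact: h. Qed.

Let D0 : D 0. Proof. exact: star_subalg0. Qed.

Let k0 : kappa 0 = 0.
Proof. exact: (linear_on0 hDs klin). Qed.

Let kZ c a : D a -> kappa (c *: a) = c *: kappa a.
Proof. exact: (linear_onZ hDs klin). Qed.

Definition intertwines (f : H -> V) :=
  blin f /\ forall a h, D a -> f (a h) = kappa a (f h).

(** Along the filter of the basic ultraweak neighbourhoods of [0] in [D], the vector
    functional of [v] tends to [0]; homogeneity turns this into a bound. *)
Lemma kappa_functional v : exists (L : seq (ell2 H * ell2 H)) (r : R),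
  0 < r /\ forall a, D a -> cmod (inner (kappa a v) v) <=
    r * \sum_(p <- L) cmod (inner (diag a p.1) p.2).
Proof.
pose near0 (L : seq (ell2 H * ell2 H)) (r : R) : set (bop H) :=
  [set a | D a /\ forall p, p \in L -> cmod (inner (diag a p.1) p.2) < r].
pose F : set_system (bop H) := [set A | exists L r, 0 < r /\ near0 L r `<=` A].
have FF : ProperFilter F.
  split.
    move=> [L [r [r0 h]]]; apply: (h 0); split=> // p _.
    by rewrite (lin0 (@diag_linear _ _)) inner0l cmod0.
  split.
  - by exists [::], 1; split=> // a _.
  - move=> A A' [L [r [r0 h]]] [L' [r' [r0' h']]].
    exists (L ++ L'), (Num.min r r'); split; first by rewrite lt_min r0.
    move=> a [Da ha]; split; [apply: h|apply: h']; split=> // p pL.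
      have := ha p; rewrite mem_cat pL /= => /(_ isT).
      by rewrite lt_min => /andP[].
    have := ha p; rewrite mem_cat pL orbT /= => /(_ isT).
    by rewrite lt_min => /andP[].
  - by move=> A A' AA' [L [r [r0 h]]]; exists L, r; split=> // a /h /AA'.
have FD : F D by exists [::], 1; split=> // a [].
have F0 : uw_cvg F 0.
  move=> w /uw_functionalP[u [u' wE]] A /= /nbhs_ballP[r r0 rA].
  have rE : r = (complex.Re r)%:C%C by rewrite RRe_real // gtr0_real.
  exists [:: (u, u')], (complex.Re r); split; first by rewrite -ltcR -rE.
  move=> a [Da /(_ (u, u') (mem_head _ _)) /= h]; apply: rA.
  rewrite -ball_normE /= !wE (lin0 (@diag_linear _ _)) inner0l sub0r normrN.
  by rewrite cmodE rE ltcR.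
have [_ hn _] := hk.
have uwv : uw_functional (fun T : bop V => inner (T v) v).
  apply/uw_functionalP; exists (single 0%N v), (single 0%N v) => T.
  exact: functional_single.
have := hn F 0 FF FD D0 F0 _ uwv; rewrite k0 => lim.
have b1 : nbhs (inner ((0 : bop V) v) v : R[i]^o)
    (ball (inner ((0 : bop V) v) v : R[i]^o) 1).
  by apply: nbhsx_ballx.
have [L [r [r0 Lr]]] := lim _ b1.
exists L, r^-1; split; first by rewrite invr_gt0.
move=> a Da; set m := \sum_(p <- L) _.
have m0 : 0 <= m by apply: sumr_ge0 => p _; exact: cmod_ge0.
apply: (@le_of_small _ _ _ r^-1) => d d0.
pose t := r / (m + d); have md : 0 < m + d by lra.
have t0 : 0 < t by rewrite divr_gt0.
have h : near0 L r (t%:C%C *: a).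
  split=> [|p pL]; first exact: star_subalgZ.
  have -> : diag (t%:C%C *: a) p.1 = t%:C%C *: diag a p.1.
    by rewrite (linZ _ _ (@diag_linear _ _)).
  rewrite innerZl cmodM cmod_real gtr0_norm //.
  have pm : cmod (inner (diag a p.1) p.2) <= m.
    by rewrite /m (big_rem p) //= lerDl; apply: sumr_ge0 => q _; exact: cmod_ge0.
  by rewrite /t mulrAC ltr_pdivrMr // ltr_pM2l //; lra.
have := Lr _ h; rewrite /= -ball_normE /= inner0l sub0r normrN kZ //.
have -> : (t%:C%C *: kappa a) v = t%:C%C *: kappa a v by [].
rewrite innerZl cmodE -(rmorph1 (real_complex R)) ltcR cmodM cmod_real gtr0_norm //.
rewrite /t mulrAC ltr_pdivrMr // mul1r mulrC -ltr_pdivlMr // => /ltW.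
by rewrite mulrDl mulrC [d * _]mulrC [r^-1 * d]mulrC.
Qed.

(** [|kappa a v|^2] is the value at [a^* a] of the functional bounded above, and the
    finitely many vectors of that bound fit into one vector. *)
Lemma kappa_bound v : exists (u : ell2 (ell2 H)) (c : R), 0 <= c /\
  forall a, D a -> nr (kappa a v) <= c * nr (diag (diag a) u).
Proof.
have [L [r [r0 Lr]]] := kappa_functional v.
have sq (a : bop H) (u u' : ell2 H) :
    cmod (inner (diag (star a * a) u) u') <= nr (diag a u) ^+ 2 + nr (diag a u') ^+ 2.
  rewrite diagM bopM diag_star bop_starE starK.
  rewrite (le_trans (cmod_inner _ _)) //.
  have := sqr_ge0 (nr (diag a u) - nr (diag a u')); rewrite sqrrB.
  by move: (sqr_ge0 (nr (diag a u))) (sqr_ge0 (nr (diag a u'))) => ? ? ?; lra.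
have [w [w' ww']] : exists w w' : ell2 H, forall a : bop H,
    \sum_(p <- L) cmod (inner (diag (star a * a) p.1) p.2) <=
    complex.Re (inner (diag (star a * a) w) w').
  elim: L {Lr} => [|p L [w [w' IH]]].
    by exists 0, 0 => a; rewrite big_nil inner0r.
  have [w1 [w1' h1]] := functional_add p.1 p.1 p.2 p.2.
  have [w2 [w2' h2]] := functional_add w w' w1 w1'.
  exists w2, w2' => a; rewrite big_cons h2 h1 addrC raddfD lerD //.
  have sqE u : inner (diag (star a * a) u) u = (nr (diag a u) ^+ 2)%:C%C.
    by rewrite diagM bopM diag_star bop_starE starK inner_nr.
  by rewrite !sqE raddfD /= sq.
exists (single 0%N w + single 1%N w'), (Num.sqrt r); split; first exact: sqrtr_ge0.
move=> a Da; rewrite -ler_sqr ?nnegrE ?mulr_ge0 ?nr_ge0 ?sqrtr_ge0 //.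
rewrite exprMn sqr_sqrtr ?(ltW r0) //.
have -> : nr (diag (diag a) (single 0%N w + single 1%N w')) ^+ 2 =
    nr (diag a w) ^+ 2 + nr (diag a w') ^+ 2.
  rewrite bopD !diag_single nr_pyth; last by rewrite inner_singlel coord_single inner0r.
  by congr (_ + _); apply: complexI; rewrite -!inner_nr inner_singlel coord_single.
have e1 : nr (kappa a v) ^+ 2 = cmod (inner (kappa (star a * a) v) v).
  rewrite kM ?kS //; last exact: sD.
  rewrite bopM bop_starE starK inner_nr cmod_real.
  by rewrite ger0_norm // sqr_ge0.
have Daa : D (star a * a) by apply: star_subalgM => //; exact: sD.
rewrite e1 (le_trans (Lr _ Daa)) // ler_wpM2l ?(ltW r0) //.
by rewrite (le_trans (ww' a)) // (le_trans (Re_le_cmod _)) // sq.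
Qed.

(** By the preceding bound [(a (x) 1) u |-> kappa a v] extends to an intertwiner from
    [ell2 (ell2 H)] to [V], and its coordinates are intertwiners from [H]: every
    [kappa 1 v] is in the closed span of their ranges. *)
Lemma kappa_intertwiners v' :
  (forall f, intertwines f -> forall h, inner (f h) v' = 0) -> kappa 1 v' = 0.
Proof.
move=> hv; apply: inner_inj => v.
have -> : inner v (kappa 1 v') = inner (kappa 1 v) v'.
  by rewrite [RHS]bop_starE -kS // star1.
rewrite inner0r; have [u [c [c0 uc]]] := kappa_bound v.
pose Y0 := [set x | exists2 a, D a & x = diag (diag a) u].
have ddl c' a b x : diag (diag (c' *: a + b)) x = c' *: diag (diag a) x + diag (diag b) x.
  by rewrite !diag_linear.
have [||||f bf fE] := @graph_ext R (ell2 (ell2 H)) V (fun x y => exists a h,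
   [/\ D a, orth Y0 h, x = diag (diag a) u + h & y = kappa a v]) c c0.
- exists 0, 0; split=> //; last by rewrite k0.
    by move=> x _; rewrite inner0r.
  by rewrite !(lin0 (@diag_linear _ _)) addr0.
- move=> t _ _ _ _ [a [h [Da oh -> ->]]] [b [h' [Db oh' -> ->]]].
  exists (t *: a + b), (t *: h + h'); split.
  + by apply: (star_subalgD hDs) => //; exact: (star_subalgZ _ hDs).
  + by move=> x Xx; rewrite innerDr innerZr oh // oh' // mulr0 addr0.
  + by rewrite ddl scalerDr addrACA.
  + by rewrite klin.
- move=> _ _ [a [h [Da oh -> ->]]]; rewrite (le_trans (uc _ Da)) // ler_wpM2l //.
  rewrite -ler_sqr ?nnegrE ?nr_ge0 // nr_pyth ?lerDl ?sqr_ge0 //.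
  by apply: oh; exists a.
- move=> k ok; apply: inner_zero; apply: (ok); exists 0, 0, k; split=> //.
  + move=> _ [a Da ->]; apply: ok; exists (kappa a v), a, 0; split=> //.
      by move=> x _; rewrite inner0r.
    by rewrite addr0.
  + by rewrite !(lin0 (@diag_linear _ _)) add0r.
  + by rewrite k0.
have fdd a : D a -> f (diag (diag a) u) = kappa a v.
  move=> Da; apply: fE; exists a, 0; split=> //; last by rewrite addr0.
  by move=> x _; rewrite inner0r.
have f0 h : orth Y0 h -> f h = 0.
  move=> oh; rewrite -[RHS](congr1 (fun T : bop V => T v) k0); apply: fE.
  by exists 0, h; split=> //; rewrite !(lin0 (@diag_linear _ _)) add0r.
have fint a x : D a -> f (diag (diag a) x) = kappa a (f x).
  move=> Da; apply: (@blin_total_eq _ _ _ (f \o diag (diag a)) (kappa a \o f)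
    [set x | Y0 x \/ orth Y0 x]) x.
  - exact: blin_comp bf (bop_blin _).
  - exact: blin_comp (bop_blin _) bf.
  - by move=> k ok; apply: inner_zero; apply: (ok); right=> x Yx; apply: ok; left.
  move=> x /= [[b Db ->]|ox]; last first.
    rewrite (f0 _ ox) bop0; apply: f0 => _ [b Db ->].
    rewrite innerC bop_starE -!diag_star -bopM -!diagM -innerC; apply: ox.
    by exists (star a * b) => //; apply: star_subalgM => //; exact: sD.
  rewrite -bopM -!diagM !fdd ?kM //; exact: star_subalgM.
have -> : kappa 1 v = f u by rewrite -fdd // !diag1.
have [f' _ af] := blin_adj bf.
suff fv : f' v' = 0 by rewrite af fv inner0r.
apply: coordP => n; apply: coordP => m; apply: inner_inj => h.
rewrite -[LHS]inner_singlel -[LHS]inner_singlel -af [RHS]inner0r.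
apply: (hv (fun h => f (single n (single m h)))); split.
  exact: (blin_comp bf (@blin_comp R H (ell2 H) _ _ _ (@single_blin R (ell2 H) n)
    (@single_blin R H m))).
by move=> a x Da; rewrite -!diag_single fint.
Qed.

Section Tensor.
Context (Em : hilbertModule D) (hat : bop H -> Em) (lft : bop H -> Em -> Em).
Context (tens : Em -> V -> W).
Hypotheses (hL : is_L2_module B G hat lft) (hT : is_interior_tensor kappa tens).
Hypothesis sigmaE : forall x d v, B x -> sigma x (tens d v) = tens (lft x d) v.

Let J := {f : H -> V | intertwines f}.

Let jb (j : J) : blin (sval j) := (svalP j).1.
Let jD (j : J) a h : D a -> sval j (a h) = kappa a (sval j h).
Proof. exact: (svalP j).2. Qed.

Let tens_hat s t v w : B s -> B t ->
  inner (tens (hat s) v) (tens (hat t) w) = inner (kappa (G (star t * s)) v) w.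
Proof. by move=> Bs Bt; rewrite (tens_inner hT) (L2_ip hL). Qed.

Let G_xi x : B x -> G x xi = e (x xi).
Proof.
move=> Bx; have ex : e xi = xi by have := e_xi D1.
by rewrite -{2}ex compress_G // ex.
Qed.

Let G_pos x : B x -> op_pos x -> op_pos (G x).
Proof.
move=> Bx px; have [Ex [hE _ <- // _]] := normal_expectation_ex.
by apply: (cond_exp_pos hE) px; exact: sub_bicommutant.
Qed.

Let D_closed : norm_closed D.
Proof. by rewrite -hD; exact: commutant_norm_closed. Qed.

(** Let [r] be the positive root of [G(s^* s)], which lies in [D].  Both norms can be
    read on it: [|hat s (x) f xi| = |f(r xi)|] and [|s xi| = |r xi|]. *)
Lemma tens_bound (j : J) : exists2 c : R, 0 <= c &
  forall s, B s -> nr (tens (hat s) (sval j xi)) <= c * nr (s xi).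
Proof.
have [_ [c c0 fc]] := jb j; exists c => // s Bs.
have Bss : B (star s * s) by apply: star_subalgM => //; exact: star_subalgS.
have pG : op_pos (G (star s * s)).
  by apply: G_pos => // x; rewrite bopM bop_starE starK inner_ge0.
have [r [Dr sr rr]] := pos_root hDs D_closed D1 (GD Bss) pG.
have nr_eq (K L : hilbertType R) (x : K) (y : L) : inner x x = inner y y -> nr x = nr y.
  move=> xy; apply/eqP; rewrite -(@eqrXn2 _ 2) ?nr_ge0 //; apply/eqP/complexI.
  by rewrite -!inner_nr.
have -> : nr (tens (hat s) (sval j xi)) = nr (sval j (r xi)).
  by apply: nr_eq; rewrite tens_hat // -rr kM // bopM bop_starE -kS // sr -!jD.
have -> // : nr (s xi) = nr (r xi).
apply: nr_eq; pose x1 := (1 : bop H) xi.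
have -> : inner (r xi) (r xi) = inner ((r * r) x1) x1 by rewrite bopM [RHS]bop_starE sr.
by rewrite rr Gxi // bopM [RHS]bop_starE starK.
Qed.

Lemma tens_map (j : J) : exists2 f : H -> W, blin f &
  forall s, B s -> f (s xi) = tens (hat s) (sval j xi).
Proof.
have [c c0 hc] := tens_bound j.
have t0 v : tens 0 v = 0 by apply: (lin0 (tens_linearl hT v)).
have h0 : hat 0 = 0.
  have B0 := star_subalg0 hB; have := (L2_linear hL) 1 _ _ B0 B0.
  by rewrite !scale1r addr0 => h; apply: (addrI (hat 0)); rewrite addr0 -h.
have [||||f bf fE] := @graph_ext R H W (fun x y => exists s,
   [/\ B s, x = s xi & y = tens (hat s) (sval j xi)]) c c0.
- by exists 0; split; [exact: star_subalg0| |rewrite h0 t0].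
- move=> a _ _ _ _ [s [Bs -> ->]] [t [Bt -> ->]]; exists (a *: s + t); split=> //.
    by apply: star_subalgD => //; exact: star_subalgZ.
  by rewrite (L2_linear hL) // (tens_linearl hT).
- by move=> _ _ [s [Bs -> ->]]; exact: hc.
- move=> k ok; apply: cyc => _ [s Bs ->]; apply: ok.
  by exists (tens (hat s) (sval j xi)), s.
by exists f => // s Bs; apply: fE; exists s.
Qed.

Context (Zt : J -> H -> W) (Zts : J -> W -> H).
Hypotheses (bZt : forall j, blin (Zt j)) (aZt : forall j, adj_pair (Zt j) (Zts j)).
Hypothesis ZtE : forall j s, B s -> Zt j (s xi) = tens (hat s) (sval j xi).

Let sigmaZ b j h : B b -> sigma b (Zt j h) = Zt j (b h).
Proof.
move=> Bb; apply: (@blin_total_eq _ _ _ (sigma b \o Zt j) (Zt j \o b) _ _ _ cyc).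
- exact: blin_comp (bop_blin _) (bZt j).
- exact: blin_comp (bZt j) (bop_blin _).
move=> _ [s Bs ->] /=; rewrite ZtE // sigmaE // (L2_lft hL) // -bopM ZtE //.
exact: star_subalgM.
Qed.

(** The adjoint of the map built from [f] sends [hat s (x) f' xi] to
    [s e f^* f' xi]: the inner products with [hat t (x) f xi] involve
    [kappa (G (s^* t)) f xi = f (G (s^* t) xi) = f (e s^* t xi)]. *)
Lemma tens_map_inner i j h s : B s ->
  inner (Zt i h) (Zt j (s xi)) = inner (sval i (e (star s h))) (sval j xi).
Proof.
move=> Bs; have [fs _ af] := blin_adj (jb i).
rewrite aZt af [RHS](_ : _ = inner h (s (e (fs (sval j xi))))); last first.
  by rewrite bop_starE es bop_starE starK.
apply/eqP; rewrite -subr_eq0 -innerBr; apply/eqP.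
suff -> : Zts i (Zt j (s xi)) - s (e (fs (sval j xi))) = 0 by rewrite inner0r.
apply: cyc => _ [t Bt ->].
have Bst : B (star s * t) by apply: star_subalgM => //; exact: star_subalgS.
rewrite innerBr -aZt !ZtE // tens_hat // -(jD _ _ (GD Bst)) G_xi // bopM af.
by rewrite [inner (e _) _]bop_starE es bop_starE starK subrr.
Qed.

Let BZt b : B b -> gram_commutes Zt Zts b.
Proof.
move=> Bb i j h; apply/eqP; rewrite -subr_eq0; apply/eqP; apply: cyc => _ [s Bs ->].
rewrite innerBr -[b]starK -bop_starE -bopM.
have Bbs : B (star b * s) by apply: star_subalgM => //; exact: star_subalgS.
rewrite -!aZt innerC tens_map_inner // [X in _ - X]innerC tens_map_inner //.
by rewrite starM starK bopM subrr.
Qed.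

Let star_kappa1 : star (kappa 1) = kappa 1.
Proof. by rewrite -kS // star1. Qed.

Let yaxi_total : is_total [set x | exists y a, [/\ D' y, D a & x = y (a xi)]].
Proof.
move=> k ok; apply: tZ => _ [y [h ->]]; rewrite bop_starE.
apply: (orth_adh (X := X0)); last exact: (proj_adh eX).
move=> _ [a Da ->]; rewrite -bop_starE; apply: ok.
by exists (sval y), a; split=> //; exact: svalP.
Qed.

Let precomp (j : J) y (Dy : D' y) : intertwines (sval j \o y).
Proof.
split; first exact: blin_comp (jb j) (bop_blin y).
by move=> a h Da /=; rewrite -(comD _ Dy Da) jD.
Qed.

Let tens_cont d v : nr (tens d v) <= nr v * hm_norm d.
Proof.
rewrite -ler_sqr ?nnegrE ?mulr_ge0 ?sqrtr_ge0 ?nr_ge0 //.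
rewrite exprMn sqr_sqrtr ?opnorm_ge0 // nr_sqE (tens_inner hT).
rewrite (le_trans (Re_le_cmod _)) // (le_trans (cmod_inner _ _)) // expr2 mulrC -mulrA.
rewrite ler_wpM2l ?nr_ge0 // mulrC (le_trans (opnormP _ _)) // ler_wpM2r ?nr_ge0 //.
have [hk' _ _] := hk; apply: (star_hom_contractive hDs D_closed D1 hk'); exact: hm_ip_in.
Qed.

Let tens_blin s : B s -> blin (tens (hat s)).
Proof.
move=> Bs; split; first exact: (tens_linearr hT).
have Gs : D (G (star s * s)) by apply: GD; apply: star_subalgM => //; exact: star_subalgS.
exists (Num.sqrt (opnorm (kappa (G (star s * s))))); first exact: sqrtr_ge0.
move=> v; rewrite -ler_sqr ?nnegrE ?mulr_ge0 ?sqrtr_ge0 ?nr_ge0 //.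
rewrite exprMn sqr_sqrtr ?opnorm_ge0 // nr_sqE tens_hat //.
rewrite (le_trans (Re_le_cmod _)) // (le_trans (cmod_inner _ _)) //.
by rewrite expr2 mulrA ler_wpM2r ?nr_ge0 ?opnormP.
Qed.

Let tens_hatM s a v : B s -> D a -> tens (hat (s * a)) v = tens (hat s) (kappa a v).
Proof. by move=> Bs Da; rewrite -(L2_act hL) // (tens_balanced hT). Qed.

Lemma tens_map_total : is_total [set w | exists j h, w = Zt j h].
Proof.
move=> w ow.
have hat0 s v : B s -> inner (tens (hat s) v) w = 0.
  move=> Bs; have [g _ ag] := blin_adj (tens_blin Bs).
  have kg : kappa 1 (g w) = 0.
    apply: kappa_intertwiners => f hf h.
    have [f' _ af] := blin_adj hf.1.
    suff f'0 : f' (g w) = 0 by rewrite af f'0 inner0r.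
    apply: yaxi_total => _ [y [a [Dy Da ->]]].
    have DyI := precomp (exist _ f hf : J) Dy.
    rewrite -af -(comD _ Dy Da) hf.2 // -ag -tens_hatM //.
    have Bsa : B (s * a) by apply: star_subalgM => //; exact: DB.
    have := ZtE (exist _ _ DyI : J) Bsa => /= <-.
    by apply: ow; exists (exist _ _ DyI), ((s * a) xi).
  rewrite -[s]mulr1 tens_hatM // ag bop_starE star_kappa1 kg inner0r //.
have all0 d v : inner (tens d v) w = 0.
  apply: (@eq_of_small _ _ _ (nr v * nr w)) => r r0.
  have [s Bs sd] := L2_dense hL d r0.
  have -> : inner (tens d v) w - 0 = inner (tens (d - hat s) v) w.
    by rewrite (linB _ _ (tens_linearl hT v)) innerBl hat0.
  rewrite (le_trans (cmod_inner _ _)) // mulrA ler_wpM2r ?nr_ge0 //.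
  by rewrite (le_trans (tens_cont _ _)) // mulrC ler_wpM2r ?nr_ge0 // ltW.
have := tens_dense hT; rewrite adhE => /total_adh; apply => _ [p ->].
by rewrite inner_suml big1.
Qed.

(** The common kernel is stable under the commutant of [D]; the projection onto it
    is in [D], and its image under [kappa] annihilates all the intertwiners, which
    forces it to vanish as [kappa] is faithful. *)
Let ker_J n : (forall j : J, sval j n = 0) -> n = 0.
Proof.
pose N := [set n | forall j : J, sval j n = 0].
have lN : is_subspace N.
  split; first by move=> j; rewrite (lin0 (jb j).1).
  by move=> c x y Nx Ny j; rewrite (jb j).1 Nx Ny scaler0 addr0.
have aN x : adh N x -> N x.
  move=> ax j; have [f' _ af] := blin_adj (jb j).
  apply: inner_inj => y; rewrite innerC af inner0r.
  rewrite (orth_adh (X := N) _ ax) ?conjC0 // => z Nz.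
  by rewrite -af Nz inner0l.
have [P PN PD] : exists2 P, is_proj N P & bicommutant D P.
  apply: proj_bicommutant => // y x Dy Nx j.
  exact: (Nx (exist _ _ (precomp j Dy))).
rewrite hD in PD => hn.
suff P0 : P = 0 by rewrite -(proj_fix lN PN (sub_adh hn)) P0.
have [_ _ kinj] := hk; apply: kinj; rewrite ?inE // k0.
apply: bopP => v.
have -> : kappa P v = kappa 1 (kappa P v) by rewrite -bopM -kM // mul1r.
apply: kappa_intertwiners => f hf h; rewrite innerC bop_starE -kS //.
have sP : star P = P by exact: (proj_star PN).
have /= fPh := aN _ (proj_adh PN h) (exist _ f hf).
by rewrite sP -hf.2 // fPh inner0r conjC0.
Qed.

(** If the maps all kill [h] then all intertwiners kill [e s^* h], for every [s], and
    [h] is orthogonal to [B xi]. *)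
Lemma tens_map_ker h : (forall j, Zt j h = 0) -> h = 0.
Proof.
move=> Zh.
have es0 s : B s -> e (star s h) = 0.
  move=> Bs; apply: ker_J => i.
  have [f' _ af] := blin_adj (jb i).
  set u := sval i (e (star s h)).
  suff f'0 : f' u = 0 by apply: inner_zero; rewrite {1}/u af f'0 inner0r.
  apply: yaxi_total => _ [y [a [Dy Da ->]]].
  rewrite -af -(comD _ Dy Da) jD // bop_starE -kS // /u -jD; last exact: sD.
  have Bsa : B (s * a) by apply: star_subalgM => //; exact: DB.
  have := tens_map_inner i (exist _ _ (precomp i Dy)) h Bsa.
  rewrite Zh inner0l starM bopM De //= => [h0|]; last exact: sD.
  by rewrite innerC -h0 conjC0.
apply: cyc => _ [s Bs ->].
by rewrite -[xi](e_xi D1) bop_starE -[inner _ _]/(inner (e _) _) bop_starE es es0 ?inner0r.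
Qed.

Lemma tensor_iso : extends_to_normal_iso M B sigma.
Proof.
apply: (intertwiner_iso bZt aZt tens_map_total tens_map_ker) => //.
by move=> s; exact: star_subalgS.
Qed.

End Tensor.

(** Every intertwiner [f] from [D] on [H] to [kappa] on [V] gives a bounded map
    [s xi |-> hat s (x) f xi], which intertwines [B] and [sigma]; there are enough of
    them for [intertwiner_iso]. *)
Theorem induced_rep_iso : is_induced_rep B D G kappa sigma ->
  extends_to_normal_iso M B sigma.
Proof.
move=> [Em [hat [lft [tens [hL hT hs]]]]].
have /choice[Zt hZ] (j : {f : H -> V | intertwines f}) : exists f : H -> W,
    blin f /\ forall s, B s -> f (s xi) = tens (hat s) (sval j xi).
  by have [f bf fE] := tens_map hL hT j; exists f.
have bZt j : blin (Zt j) := (hZ j).1.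
have /choice[Zts aZt] j : exists g, adj_pair (Zt j) g.
  by have [g _ ag] := blin_adj (bZt j); exists g.
exact: (tensor_iso hL hT hs bZt aZt (fun j => (hZ j).2)).
Qed.

End Induced.

End Expectation.

(** * Faithful GNS representations and generated algebras *)

Section GNSFaithful.
Context (R : realType) (H : hilbertType R) (xi : H) (D : set (bop H)).
Hypothesis hD : star_subalg D.

(** An operator of [D] which vanishes on [D xi] acts as zero in the GNS space. *)
Lemma faithful_gns_cyclic (K : hilbertType R) (hat : bop H -> K) (rep : bop H -> bop K) :
  is_gns D (fun x => inner (x xi) xi) hat rep -> set_inj D rep ->
  forall a, D a -> (forall b, D b -> a (b xi) = 0) -> a = 0.
Proof.
move=> hg rinj a Da hab; have D0 := star_subalg0 hD.
have tot := total_adh (etrans (esym (adhE _)) (gns_dense hg)).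
apply: rinj; rewrite ?inE //; apply: (total_eq tot) => _ [b Db <-].
have h0 (x : bop H) : D x -> x xi = 0 -> hat x = 0.
  move=> Dx x0; apply: inner_zero; rewrite (gns_inner hg) // bopM bop_starE starK.
  by rewrite x0 inner0l.
rewrite !(gns_rep hg) // !h0 ?mul0r //; first exact: star_subalgM.
by rewrite bopM hab.
Qed.

(** The GNS space is realized as the closure of [D xi]. *)
Lemma faithful_state_gns : D 1 -> xi != 0 ->
  faithful_on D (fun x => inner (x xi) xi) ->
  has_faithful_gns D (fun x => inner (x xi) xi).
Proof.
move=> D1 xi0 fD.
pose X := [set x | exists2 a, D a & x = a xi].
have lX : is_subspace X by exact: cyclic_subspace.
have nzX : exists2 x, X x & x != 0 by exists xi => //; exists 1.
have [P PX] := proj_exists lX.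
pose K : hilbertType R := clsub lX nzX.
pose v (k : K) : H := clsub_val k.
have vP (k : K) : adh X (v k) by exact: (subm_in (k : subm (subspace_adh lX))).
have v_inj (k k' : K) : v k = v k' -> k = k' by exact: submP.
have mkK x : adh X x -> exists k : K, v k = x.
  by move=> ax; exists (Subm (subspace_adh lX) ax).
have vL c (k k' : K) : v (c *: k + k') = c *: v k + v k' by [].
have vnr (k : K) : nr k = nr (v k).
  apply/eqP; rewrite -(@eqrXn2 _ 2) ?nr_ge0 //; apply/eqP/complexI.
  by rewrite -!inner_nr.
have /choice[hat hatE] a : exists k : K, D a -> v k = a xi.
  have [Da|nDa] := pselect (D a); last by exists 0.
  by have [|k kE] := mkK (a xi); [apply: sub_adh; exists a|exists k].
have /choice[rep repE] (a : bop H) : exists T : bop K, forall k, v (T k) = P (a (v k)).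
  have /choice[f fE] (k : K) : exists k' : K, v k' = P (a (v k)).
    by apply: mkK; exact: (proj_adh PX).
  have bf : blin f.
    split.
      by move=> c k k'; apply: v_inj; rewrite vL !fE vL !bop_linear.
    have [_ [c c0 cP]] := blin_comp (bop_blin P) (bop_blin a).
    by exists c => // k; rewrite !vnr fE; exact: cP.
  by have [T TE] := blin_bop bf; exists T => k; rewrite TE fE.
have repD a b : D a -> D b -> rep a (hat b) = hat (a * b).
  move=> Da Db; have Dab : D (a * b) by exact: star_subalgM.
  apply: v_inj; rewrite repE !hatE // (proj_fix lX PX) //.
  by apply: sub_adh; exists (a * b).
exists K, hat, rep; split; last first.
  move=> a b; rewrite !inE => Da Db e; apply/eqP; rewrite -subr_eq0; apply/eqP.
  have Dab : D (a - b) by exact: star_subalgB.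
  apply: fD => //; rewrite bopM bop_starE starK bopB.
  have := congr1 (fun T : bop K => v (T (hat 1))) e.
  by rewrite !repD // !mulr1 !hatE // => ->; rewrite subrr inner0l.
split.
- move=> c a b Da Db; apply: v_inj; rewrite vL !hatE //.
  by apply: star_subalgD => //; exact: star_subalgZ.
- rewrite adhE; apply/seteqP; split=> // k _ r r0.
  have [_ [a Da ->] ka] := vP k _ r0.
  exists (hat a); first by exists a.
  rewrite vnr; suff -> : v (k - hat a) = v k - a xi by [].
  by rewrite -(hatE a Da); exact: submB.
- move=> a b Da Db; rewrite -[LHS]/(inner (v (hat a)) (v (hat b))) !hatE //.
  by rewrite bopM [RHS]bop_starE starK.
- exact: repD.
Qed.

End GNSFaithful.

Section CStarGen.
Context (R : realType) (H : hilbertType R) (X : set (bop H)).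

Lemma cstar_gen_subalg : star_subalg (cstar_gen X).
Proof.
split.
- by move=> B [hB _ _]; exact: star_subalg0.
- move=> c x y hx hy B hBX; have [hB _ _] := hBX.
  by apply: (star_subalgD hB); [apply: (star_subalgZ _ hB); exact: hx|exact: hy].
- by move=> x y hx hy B hBX; have [hB _ _] := hBX; apply: (star_subalgM hB); [exact: hx|exact: hy].
- by move=> x hx B hBX; have [hB _ _] := hBX; apply: (star_subalgS hB); exact: hx.
Qed.

Lemma cstar_gen_closed : norm_closed (cstar_gen X).
Proof.
move=> T hT B hBX; have [_ cB _] := hBX; apply: cB => e e0.
by have [S hS TS] := hT e e0; exists S => //; exact: hS.
Qed.

Lemma sub_cstar_gen : X `<=` cstar_gen X.
Proof. by move=> x Xx B [_ _]; apply. Qed.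

Lemma cstar_gen_min B : star_subalg B -> norm_closed B -> X `<=` B ->
  cstar_gen X `<=` B.
Proof. by move=> hB cB XB x; apply. Qed.

Lemma cstar_gen_approx B : star_subalg B -> X `<=` B -> forall x, cstar_gen X x ->
  forall e : R, 0 < e -> exists2 b, B b & opnorm (x - b) < e.
Proof.
move=> hB XB.
pose C := [set x : bop H | forall e : R, 0 < e -> exists2 b, B b & opnorm (x - b) < e].
apply: (cstar_gen_min (B := C)) => [||x Xx e e0]; last first.
- by exists x; rewrite ?subrr ?opnorm0 //; exact: XB.
- move=> T hT e e0; have e2 : 0 < e / 2 by rewrite divr_gt0.
  have [S CS TS] := hT _ e2; have [b Bb Sb] := CS _ e2.
  exists b => //; rewrite -(subrKA S) (le_lt_trans (opnormD _ _)) //; lra.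
split.
- by move=> e e0; exists 0; [exact: star_subalg0|rewrite subrr opnorm0].
- move=> c x y Cx Cy e e0.
  have c1 : 0 < cmod c + 1 by rewrite ltr_wpDl ?cmod_ge0.
  have [b Bb xb] := Cx (e / 2 / (cmod c + 1)) ltac:(by rewrite !divr_gt0).
  have [b' Bb' yb] := Cy (e / 2) ltac:(by rewrite !divr_gt0).
  exists (c *: b + b').
    by apply: (star_subalgD hB) => //; exact: (star_subalgZ _ hB).
  rewrite opprD addrACA -scalerBr (le_lt_trans (opnormD _ _)) // opnormZ.
  move: xb; rewrite ltr_pdivlMr // mulrDr mulr1 mulrC => xb.
  by move: (opnorm_ge0 (x - b)) => ?; lra.
- move=> x y Cx Cy e e0.
  pose m := opnorm x + opnorm y + 1.
  have m1 : 1 <= m by rewrite lerDr addr_ge0 ?opnorm_ge0.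
  have m0 : 0 < m by rewrite (lt_le_trans _ m1).
  pose d := Num.min 1 (e / 2 / m).
  have d0 : 0 < d by rewrite lt_min ltr01 !divr_gt0.
  have [d1 dm] : d <= 1 /\ d * m <= e / 2.
    by rewrite -ler_pdivlMr // !ge_min !lexx orbT.
  have [b Bb xb] := Cx _ d0; have [b' Bb' yb] := Cy _ d0.
  exists (b * b'); first exact: (star_subalgM hB).
  have -> : x * y - b * b' = (x - b) * y + b * (y - b').
    by rewrite mulrBl mulrBr addrA subrK.
  rewrite (le_lt_trans (opnormD _ _)) // (le_lt_trans (lerD (opnormM _ _) (opnormM _ _))) //.
  have nb : opnorm b <= opnorm x + 1.
    rewrite -[b](subKr x) (le_trans (opnormD _ _)) // opnormN lerD2l.
    by rewrite (le_trans (ltW xb)).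
  have h1 : opnorm (x - b) * opnorm y <= d * opnorm y.
    by rewrite ler_wpM2r ?opnorm_ge0 // ltW.
  have h2 : opnorm b * opnorm (y - b') <= (opnorm x + 1) * d.
    by rewrite ler_pM ?opnorm_ge0 // ltW.
  have h3 : d * opnorm y + (opnorm x + 1) * d = d * m by rewrite /m; ring.
  lra.
- move=> x Cx e e0; have [b Bb xb] := Cx _ e0; exists (star b).
    exact: (star_subalgS hB).
  by rewrite -starB opnorm_star.
Qed.

End CStarGen.

Section FreeProduct.
Context (R : realType) (A FA : cstarAlgType R) (lam : nat -> A -> FA).
Hypothesis lam_free : is_free_product lam.

Lemma hom_eq (C : cstarAlgType R) (F1 F2 : FA -> C) :
  unital_star_hom F1 -> unital_star_hom F2 ->
  (forall i a, F1 (lam i a) = F2 (lam i a)) -> F1 =1 F2.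
Proof.
move=> h1 h2 e x.
have [_ /(_ C (fun i a => F1 (lam i a)))[i|F [_ uF]]] := lam_free.
  have [[lL lM lS] l1] := (lam_free.1 i); have [[fL fM fS] f1] := h1.
  split; last by rewrite l1.
  split=> [c a b _ _|a b _ _|a _]; first by rewrite lL // fL.
    by rewrite lM // fM.
  by rewrite lS // fS.
have e1 := uF F1 (conj h1 (fun _ _ => erefl)).
have e2 := uF F2 (conj h2 (fun i a => esym (e i a))).
by rewrite -e1 -e2.
Qed.

Lemma unital_star_hom_comp (X Y W : starAlgType R) (f : X -> Y) (g : Y -> W) :
  unital_star_hom f -> unital_star_hom g -> unital_star_hom (g \o f).
Proof.
move=> [[fL fM fS] f1] [[gL gM gS] g1]; split; last by rewrite /= f1.
split=> [c a b _ _|a b _ _|a _] /=; first by rewrite fL // gL.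
  by rewrite fM // gM.
by rewrite fS // gS.
Qed.

Lemma unitary_conj_hom (X Y : starAlgType R) (f : X -> Y) (u : Y) :
  unital_star_hom f -> Defs.is_unitary u -> unital_star_hom (fun x => u * f x * star u).
Proof.
move=> [[fL fM fS] f1] [u1 u2]; split; last by rewrite f1 mulr1.
split=> [c a b _ _|a b _ _|a _].
- by rewrite fL // mulrDr mulrDl -scalerAr -scalerAl.
- by rewrite fM // !mulrA; congr (_ * _); rewrite -!mulrA [star u * _]mulrA u1 mul1r.
- by rewrite fS // !starM starK mulrA.
Qed.

Context (K : hilbertType R) (rho : FA -> bop K).
Hypothesis rho_hom : unital_star_hom rho.

Let X := [set T | exists i a, T = rho (lam i a)].

Let sX : star_closed X.
Proof.
move=> _ [i [a ->]]; exists i, (star a).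
by have [[_ _ h] _] := lam_free.1 i; have [[_ _ h'] _] := rho_hom; rewrite h // h'.
Qed.

Let unitary_commute (u : bop K) : Defs.is_unitary u -> commutant X u -> commutant (range rho) u.
Proof.
move=> [u1 u2] hu _ [x _ <-].
have h := unitary_conj_hom rho_hom (conj u1 u2).
have agree i a : u * rho (lam i a) * star u = rho (lam i a).
  by rewrite hu; [rewrite -mulrA u2 mulr1|exists i, a].
by rewrite -[in RHS](hom_eq h rho_hom agree x) -!mulrA u1 mulr1.
Qed.

(** An operator commuting with the copies of [A] commutes with the whole free
    product: conjugation by a unitary of that kind gives a homomorphism which
    agrees with [rho] on each copy, and the commutant is spanned by its unitaries
    [c^-1 (y + i (c^2 - y^2)^(1/2))]. *)
Lemma free_commute (y : bop K) : (forall i a, y * rho (lam i a) = rho (lam i a) * y) ->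
  forall x, y * rho x = rho x * y.
Proof.
move=> hy; have {hy} : commutant X y by move=> _ [i [a ->]]; exact: hy.
have ii : 'i * 'i = -1 :> R[i] by rewrite -expr2 sqrCi.
have hC := commutant_subalg sX.
have srho : star_closed (range rho).
  by move=> _ [x _ <-]; exists (star x) => //; case: rho_hom => -[_ _ ->].
have hR := commutant_subalg srho.
have sa (z : bop K) : star z = z -> commutant X z -> commutant (range rho) z.
  move=> sz Xz.
  have s1 : star_closed [set z] by move=> _ ->; rewrite /= sz.
  have h1 : star_closed (commutant [set z]) by exact: commutant_star_closed.
  have zX : bicommutant [set z] `<=` commutant X.
    by rewrite -(tricommutant X); apply: commutantS => T hT _ ->; rewrite hT.
  pose c := opnorm z + 1; have c0 : 0 < c by rewrite ltr_wpDl ?opnorm_ge0.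
  have zc x : nr (z x) <= c * nr x.
    by rewrite (le_trans (opnormP _ _)) // ler_wpM2r ?nr_ge0 // lerDl.
  have zz : bicommutant [set z] z by exact: sub_bicommutant.
  have [r [hr sr rr]] := defect_root (commutant_subalg h1) (@commutant_norm_closed _ _ _)
    (@commutant_one _ _ _) zz c0 zc.
  have rz : r * z = z * r by apply: hr => _ ->.
  have Xr := zX _ hr.
  pose u := (c^-1)%:C%C *: (z + 'i *: r).
  have su : star u = (c^-1)%:C%C *: (z - 'i *: r).
    by rewrite star_realZ starD starZ sz sr conjCi scaleNr.
  have zzrr : z * z + r * r = (c ^+ 2)%:C%C *: 1 by rewrite rr sz addrC subrK.
  have e1 : (z - 'i *: r) * (z + 'i *: r) = (c ^+ 2)%:C%C *: 1.
    rewrite mulrBl !mulrDr -!scalerAl -!scalerAr scalerA ii scaleN1r rz.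
    by rewrite opprD opprK addrA addrK zzrr.
  have e2 : (z + 'i *: r) * (z - 'i *: r) = (c ^+ 2)%:C%C *: 1.
    rewrite mulrDl !mulrBr -!scalerAl -!scalerAr scalerA ii scaleN1r rz.
    by rewrite opprK addrA subrK zzrr.
  have cc (T : bop K) : (c^-1)%:C%C *: ((c^-1)%:C%C *: ((c ^+ 2)%:C%C *: T)) = T.
    rewrite !scalerA -!rmorphM (_ : c^-1 * c^-1 * c ^+ 2 = 1) ?scale1r //.
    by field; rewrite gt_eqF.
  have uu : Defs.is_unitary u.
    by split; rewrite su /u -scalerAl -scalerAr ?e1 ?e2 cc.
  have Xu : commutant X u.
    apply: (star_subalgZ _ hC); apply: (star_subalgD hC) => //.
    exact: (star_subalgZ _ hC).
  have Ru := unitary_commute uu Xu.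
  have -> : z = (c / 2)%:C%C *: (u + star u).
    rewrite su /u -scalerDr addrACA subrr addr0 scalerA -rmorphM.
    rewrite scalerDr -scalerDl -rmorphD (_ : c / 2 / c + c / 2 / c = 1) ?scale1r //.
    by field; rewrite gt_eqF.
  apply: (star_subalgZ _ hR); apply: (star_subalgD hR) => //.
  exact: (star_subalgS hR).
move=> hy x.
have hys : commutant X (star y) by exact: (star_subalgS hC).
have h1 : commutant (range rho) (y + star y).
  by apply: sa; [rewrite starD starK addrC|exact: (star_subalgD hC)].
have h2 : commutant (range rho) ('i *: (y - star y)).
  apply: sa; first by rewrite starZ starB starK conjCi scaleNr -scalerN opprB.
  by apply: (star_subalgZ _ hC); exact: (star_subalgB hC).
suff : commutant (range rho) y by apply; exists x.
have -> : y = 2^-1 *: (y + star y) + (2^-1 * - 'i) *: ('i *: (y - star y)).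
  rewrite scalerA -mulrA mulNr ii opprK mulr1 -scalerDr addrACA subrr addr0.
  by rewrite scalerDr -scalerDl (_ : 2^-1 + 2^-1 = 1) ?scale1r //; field.
by apply: (star_subalgD hR); exact: (star_subalgZ _ hR).
Qed.

End FreeProduct.

(** * Permutations of the copies *)

Section Symmetric.
Context (R : realType) (A FA : cstarAlgType R) (lam : nat -> A -> FA).
Context (psi : FA -> R[i]) (H : hilbertType R) (hat : FA -> H) (pi : FA -> bop H).
Hypotheses (lam_free : is_free_product lam) (psi_state : is_state psi).
Hypotheses (psi_symmetric : is_symmetric lam psi) (psi_gns : is_gns setT psi hat pi).

Let xi := hat 1.
Let word (w : seq (nat * A)) : FA := \prod_(p <- w) lam p.1 p.2.

Lemma gns_hat_linear : linear hat.
Proof. by move=> c x y; rewrite (gns_linear psi_gns). Qed.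

Lemma gns_total : is_total (range hat).
Proof. by apply: total_adh; rewrite -adhE; exact: (gns_dense psi_gns). Qed.

Lemma gns_hom : unital_star_hom pi.
Proof.
have piE x y : pi x (hat y) = hat (x * y) by rewrite (gns_rep psi_gns).
split; last first.
  by apply: (total_eq gns_total) => _ [x _ <-]; rewrite piE mul1r.
split=> [c x y _ _|x y _ _|x _]; apply: (total_eq gns_total) => _ [z _ <-].
- rewrite -[RHS]/(c *: pi x _ + pi y _) !piE mulrDl -scalerAl.
  exact: gns_hat_linear.
- by rewrite bopM !piE mulrA.
- apply/eqP; rewrite -subr_eq0; apply/eqP; apply: gns_total => _ [w _ <-].
  rewrite innerBr -bop_starE !piE !(gns_inner psi_gns) //.
  by rewrite starM starK mulrA subrr.
Qed.

Lemma pi_hat x : pi x xi = hat x.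
Proof. by rewrite (gns_rep psi_gns) // mulr1. Qed.

Lemma lam_star i a : star (lam i a) = lam i (star a).
Proof. by have [[_ _ h] _] := lam_free.1 i; rewrite h. Qed.

Lemma lam_one i : lam i 1 = 1.
Proof. by have [_ ->] := lam_free.1 i. Qed.

Lemma xi_neq0 : xi != 0.
Proof.
have [_ _ p1] := psi_state.
have : inner xi xi = 1 by rewrite (gns_inner psi_gns) // star1 mulr1.
by move=> h; apply/eqP => x0; have := oner_neq0 R[i]; rewrite -h x0 inner0l eqxx.
Qed.

Lemma pi_commute (y : bop H) : (forall i a, y * pi (lam i a) = pi (lam i a) * y) ->
  forall x, y * pi x = pi x * y.
Proof. exact: (free_commute lam_free gns_hom). Qed.

Lemma pi_word_hat i a w : pi (lam i a) (hat (word w)) = hat (word ((i, a) :: w)).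
Proof. by rewrite (gns_rep psi_gns) // /word big_cons. Qed.

(** The words in the copies of [A] already generate the whole GNS space: the
    projection onto the complement commutes with every [pi (lam i a)], hence with
    [pi], and it kills the cyclic vector. *)
Lemma word_total : is_total [set x | exists w, x = hat (word w)].
Proof.
pose N := [set k | forall w, inner (hat (word w)) k = 0].
have lN : is_subspace N.
  split; first by move=> w; rewrite inner0r.
  by move=> c k k' Nk Nk' w; rewrite innerDr innerZr Nk Nk' mulr0 addr0.
have [P PN] := proj_exists lN.
have NL i a k : N k -> N (pi (lam i a) k).
  move=> Nk w; rewrite -[pi _]starK -bop_starE.
  have [[_ _ piS] _] := gns_hom.
  by rewrite -piS // lam_star pi_word_hat Nk.
have PL i a : P * pi (lam i a) = pi (lam i a) * P.
  apply: (proj_comm lN PN) => k; first exact: NL.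
  have [[_ _ piS] _] := gns_hom.
  by rewrite -piS // lam_star; exact: NL.
have Pxi : P xi = 0.
  apply: (proj_eq0 lN PN) => k Nk; rewrite innerC.
  by have := Nk [::]; rewrite /word big_nil => ->; rewrite conjC0.
move=> k ok; have Nk : N k by move=> w; apply: ok; exists w.
rewrite -(proj_fix lN PN (sub_adh Nk)); apply: gns_total => _ [x _ <-].
rewrite -(proj_star PN) -bop_starE -pi_hat -bopM pi_commute //.
by rewrite bopM Pxi bop0 inner0l.
Qed.

Let act (s : nat -> nat) (w : seq (nat * A)) := [seq (s p.1, p.2) | p <- w].

Let psi_act s w : bijective s -> psi (word (act s w)) = psi (word w).
Proof. by move=> bs; rewrite /word big_map (psi_symmetric w bs). Qed.

Let wstar (w : seq (nat * A)) := rev [seq (p.1, star p.2) | p <- w].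

Let word_star w : star (word w) = word (wstar w).
Proof.
rewrite /word /wstar; elim: w => [|p w IH].
  by rewrite /= /rev /= !big_nil star1.
by rewrite big_cons /= rev_cons -cats1 big_cat big_seq1 /= starM IH lam_star.
Qed.

Let word_cat w w' : word (w ++ w') = word w * word w'.
Proof. by rewrite /word big_cat. Qed.

Let act_wstar s w : act s (wstar w) = wstar (act s w).
Proof. by rewrite /act /wstar map_rev -!map_comp. Qed.

Let inner_act s w w' : bijective s ->
  inner (hat (word (act s w))) (hat (word (act s w'))) =
  inner (hat (word w)) (hat (word w')).
Proof.
move=> bs; rewrite !(gns_inner psi_gns) // !word_star -!word_cat -act_wstar.
by rewrite /act -map_cat -/(act s _) psi_act.
Qed.

Let act_op s : bijective s -> exists U : bop H, forall w,
  U (hat (word w)) = hat (word (act s w)).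
Proof.
move=> bs.
pose ev (s : nat -> nat) (t : seq (R[i] * seq (nat * A))) :=
  \sum_(p <- t) p.1 *: hat (word (act s p.2)).
have act_id w : act id w = w by rewrite /act -[RHS]map_id; apply: eq_map => -[].
have evI t : nr (ev s t) = nr (ev id t).
  apply/eqP; rewrite -(@eqrXn2 _ 2) ?nr_ge0 //; apply/eqP/complexI.
  rewrite -!inner_nr !inner_suml; apply: eq_bigr => p _.
  rewrite !inner_sumr; apply: eq_bigr => q _.
  by rewrite !innerZl !innerZr inner_act // !act_id.
have ev_lin (r : nat -> nat) a t t' :
    ev r ([seq (a * p.1, p.2) | p <- t] ++ t') = a *: ev r t + ev r t'.
  rewrite /ev big_cat big_map /= scaler_sumr; congr (_ + _).
  by apply: eq_bigr => p _; rewrite scalerA.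
have [||||f bf fE] := @graph_ext R H H
  (fun x y => exists t, x = ev id t /\ y = ev s t) 1 ler01.
- by exists [::]; rewrite /ev !big_nil.
- move=> a _ _ _ _ [t [-> ->]] [t' [-> ->]].
  by exists ([seq (a * p.1, p.2) | p <- t] ++ t'); rewrite !ev_lin.
- by move=> _ _ [t [-> ->]]; rewrite mul1r evI.
- move=> k ok; apply: word_total => _ [w ->]; apply: ok.
  by exists (ev s [:: (1, w)]), [:: (1, w)]; rewrite /ev !big_seq1 /= !scale1r act_id.
have [U UE] := blin_bop bf; exists U => w; rewrite UE; apply: fE.
by exists [:: (1, w)]; rewrite /ev !big_seq1 /= !scale1r act_id.
Qed.

Lemma free_map (s : nat -> nat) : exists F : FA -> FA,
  unital_star_hom F /\ forall i a, F (lam i a) = lam (s i) a.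
Proof.
have [_ /(_ FA (fun i => lam (s i)))[i|F [hF _]]] := lam_free.
  exact: (lam_free.1 (s i)).
by exists F.
Qed.

Lemma id_hom (X : starAlgType R) : unital_star_hom (@id X).
Proof. by []. Qed.

(** Permuting the indices of words preserves the inner products of the corresponding
    vectors, by symmetry of the state.  That the resulting unitary implements the
    automorphism on all of the free product, and not only on words, is the uniqueness
    part of the universal property applied to [U pi(x) U^* ] and [pi(b x)]. *)
Lemma permutation_implemented s : bijective s -> exists U, implements lam hat s U.
Proof.
move=> bs; have [s' ss' s's] := bs.
have bs' : bijective s' by exists s.
have [U UE] := act_op bs; have [U' U'E] := act_op bs'.
have actK (r r' : nat -> nat) w : cancel r r' -> act r' (act r w) = w.
  move=> rr'; rewrite /act -map_comp -[RHS]map_id; apply: eq_map => -[i a] /=.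
  by rewrite rr'.
have sU : U' = star U.
  apply: (total_eq word_total) => _ [w ->].
  apply/eqP; rewrite -subr_eq0; apply/eqP; apply: word_total => _ [w' ->].
  rewrite innerBr -bop_starE UE U'E.
  by rewrite -(inner_act w' (act s' w) bs) (actK _ _ _ s's) subrr.
have U'U : star U * U = 1.
  by rewrite -sU; apply: (total_eq word_total) => _ [w ->]; rewrite bopM UE U'E actK.
have UU' : U * star U = 1.
  by rewrite -sU; apply: (total_eq word_total) => _ [w ->]; rewrite bopM U'E UE actK.
have [b [hb bE]] := free_map s; have [b' [hb' b'E]] := free_map s'.
exists U; split; first by split.
exists b; split=> //.
  exists b'.
    apply: (hom_eq lam_free (unital_star_hom_comp hb hb') (id_hom FA)) => i a /=.
    by rewrite bE b'E ss'.
  apply: (hom_eq lam_free (unital_star_hom_comp hb' hb) (id_hom FA)) => i a /=.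
  by rewrite b'E bE s's.
have h := unitary_conj_hom gns_hom (conj U'U UU').
have agree i a : U * pi (lam i a) * star U = pi (b (lam i a)).
  rewrite bE; suff -> : U * pi (lam i a) = pi (lam (s i) a) * U.
    by rewrite -mulrA UU' mulr1.
  apply: (total_eq word_total) => _ [w ->].
  by rewrite !bopM pi_word_hat !UE pi_word_hat.
have UpE x := hom_eq lam_free h (unital_star_hom_comp hb gns_hom) agree x.
have Uxi : U xi = xi by have := UE [::]; rewrite /word /= !big_nil.
move=> x; rewrite -pi_hat -[RHS]pi_hat -{2}Uxi -[pi (b x)]UpE !bopM.
by rewrite -[star U (U _)]/((star U * U) _) U'U.
Qed.

Lemma implements_commute s U : implements lam hat s U ->
  exists b, [/\ unital_star_hom b, forall i a, b (lam i a) = lam (s i) a &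
    forall x, U * pi x = pi (b x) * U].
Proof.
move=> [_ [b [hb _ bE Ub]]]; exists b; split=> // x.
have [[_ bM _] _] := hb.
apply: (total_eq gns_total) => _ [y _ <-].
by rewrite !bopM !(gns_rep psi_gns) // !Ub (gns_rep psi_gns) // bM.
Qed.

Lemma implements_fix s U : implements lam hat s U -> U xi = xi.
Proof. by move=> [_ [b [[_ b1] _ _ Ub]]]; rewrite Ub b1. Qed.

Lemma conj_fixed (U x : bop H) : Defs.is_unitary U -> U * x * star U = x <-> U * x = x * U.
Proof.
move=> [u1 u2]; split=> [h|h]; first by rewrite -{2}h -!mulrA u1 mulr1.
by rewrite h -mulrA u2 mulr1.
Qed.

(** The shift of indices is not a permutation, but on a finite set it agrees with a
    cycle. *)
Lemma shift_perm n : exists2 s, finite_perm s & forall i, (i < n)%N -> s i = i.+1.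
Proof.
pose s i := if (i < n)%N then i.+1 else if i == n then 0%N else i.
pose s' i := if i is i'.+1 then (if (i <= n)%N then i' else i) else n.
exists s; last by move=> i h; rewrite /s h.
split; last by exists n.+1 => i h; rewrite /s ltnNge ltnW //= gtn_eqF.
exists s' => i.
  rewrite /s; case: ltnP => [h|h]; first by rewrite /s' h.
  have [->//|ni] := eqVneq i n; rewrite /s'.
  case: i h ni => [|i] h ni; first by move: ni h; rewrite leqn0 eq_sym => /negPf ->.
  by rewrite leqNgt ltn_neqAle eq_sym ni h.
rewrite /s; case: i => [|i] /=; first by rewrite ltnn eqxx.
case: (ltnP i n) => h; first by rewrite h.
by rewrite ltnNge (leq_trans h (leqnSn i)) /= gtn_eqF.
Qed.

End Symmetric.

(** * The shift and its limit *)

Section Shift.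
Context (R : realType) (A FA : cstarAlgType R) (lam : nat -> A -> FA).
Context (psi : FA -> R[i]) (H : hilbertType R) (hat : FA -> H) (pi : FA -> bop H).
Context (alpha G : bop H -> bop H).
Hypothesis lam_free : is_free_product lam.
Hypotheses (psi_symmetric : is_symmetric lam psi) (psi_gns : is_gns setT psi hat pi).
Hypotheses (alpha_shift : is_shift lam hat pi alpha).
Hypotheses (G_limit : is_shift_limit lam hat pi alpha G).

Let xi := hat 1.
Let M := gns_vn pi.
Let T := tail_algebra lam pi.
Let F := fixed_algebra lam hat pi.
Let Q := tail_cstar lam pi.
Let S := fixed_cstar lam hat pi.
Let XN N := \bigcup_(i in [set i | (N <= i)%N]) range (pi \o lam i).
Let YN N := XN N `|` star @` XN N.

Let pi_hom := gns_hom psi_gns.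
Let piL c x y : pi (c *: x + y) = c *: pi x + pi y.
Proof. by have [[h _ _] _] := pi_hom; rewrite h. Qed.
Let piM x y : pi (x * y) = pi x * pi y.
Proof. by have [[_ h _] _] := pi_hom; rewrite h. Qed.
Let piS x : pi (star x) = star (pi x).
Proof. by have [[_ _ h] _] := pi_hom; rewrite h. Qed.
Let pi1 : pi 1 = 1.
Proof. by have [] := pi_hom. Qed.

Let range_star : star_closed (range pi).
Proof. by move=> _ [x _ <-]; exists (star x). Qed.

Let hM : star_subalg M.
Proof. exact: bicommutant_subalg. Qed.

Let hS : star_subalg S.
Proof. exact: cstar_gen_subalg. Qed.

Let S_closed : norm_closed S.
Proof. exact: cstar_gen_closed. Qed.

Let pi_S x : S (pi x).
Proof. by apply: sub_cstar_gen; left; exists x. Qed.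

Let F_S : F `<=` S.
Proof. by move=> x Fx; apply: sub_cstar_gen; right. Qed.

Let S1 : S 1.
Proof. by rewrite -pi1. Qed.

(** Written as the commutant of a set, an algebra is its own bicommutant. *)
Lemma fixed_algebraE : F = commutant (commutant (range pi) `|`
  [set U | exists2 s, finite_perm s & implements lam hat s U]).
Proof.
apply/seteqP; split=> x.
  move=> [Mx xU] y [cy|[s hs hU]]; first exact: Mx.
  by have /(conj_fixed _ hU.1) := xU s y hs hU.
move=> hx; split; first by move=> y cy; apply: hx; left.
by move=> s U hs hU; apply/(conj_fixed _ hU.1); rewrite hx //; right; exists s.
Qed.

Lemma fixed_algebra_star : star_closed F.
Proof.
move=> x [Mx xU]; split; first exact: (star_subalgS hM).
move=> s U hs hU; rewrite -{2}(xU s U hs hU) !starM starK mulrA //.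
Qed.

Lemma tail_algebraE : T = commutant (\bigcup_N commutant (YN N)).
Proof.
apply/seteqP; split=> x hx; first by move=> y [N _ cy]; apply: (hx N).
by move=> N _ y cy; apply: hx; exists N.
Qed.

Let YN_star N : star_closed (YN N).
Proof.
move=> x [Xx|[y Xy <-]]; first by right; exists x.
by left; rewrite starK.
Qed.

Lemma tail_algebra_star : star_closed T.
Proof.
rewrite tail_algebraE; apply: commutant_star_closed => y [N _ cy]; exists N => //.
exact: (commutant_star_closed (@YN_star N)).
Qed.

Let YN_commute N y : (forall i a, (N <= i)%N -> y * pi (lam i a) = pi (lam i a) * y) ->
  commutant (YN N) y.
Proof.
move=> h x [[i Ni [a _ <-]]|[_ [i Ni [a _ <-]] <-]] /=; first exact: h.
by rewrite -piS lam_star // h.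
Qed.

Lemma tail_sub_fixed : T `<=` F.
Proof.
move=> x Tx; rewrite fixed_algebraE => y [cy|[s [bs [N sN]] hU]].
  by apply: (Tx 0%N) => //; apply: YN_commute => i a _; apply: cy; exists (lam i a).
apply: (Tx N) => //; apply: YN_commute => i a Ni.
have [b [_ bE ->]] := implements_commute psi_gns hU.
by rewrite bE sN.
Qed.

Let fixed_M : S `<=` M.
Proof.
apply: cstar_gen_min => //; first exact: commutant_norm_closed.
by move=> x [|[]//]; exact: sub_bicommutant.
Qed.

Lemma tail_cstar_sub : Q `<=` S.
Proof.
apply: cstar_gen_min => // x [[y _ <-]//|/tail_sub_fixed]; exact: F_S.
Qed.

Let bicommutant_between B : range pi `<=` B -> B `<=` M -> bicommutant B = M.
Proof.
move=> h1 h2; rewrite /M /gns_vn /bicommutant; congr commutant; apply/seteqP; split.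
  exact: commutantS.
by rewrite -(tricommutant (range pi)); exact: commutantS.
Qed.

Lemma fixed_cstar_bicommutant : bicommutant S = M.
Proof. by apply: bicommutant_between => // _ [x _ <-]. Qed.

Lemma tail_cstar_bicommutant : bicommutant Q = M.
Proof.
apply: bicommutant_between => [_ [x _ <-]|x /tail_cstar_sub/fixed_M //].
by apply: sub_cstar_gen; left; exists x.
Qed.

Let aS x : S x -> S (alpha x).
Proof. by have [_ h _ _] := alpha_shift; exact: h. Qed.
Let aL c x y : S x -> S y -> alpha (c *: x + y) = c *: alpha x + alpha y.
Proof. by have [[h _ _] _ _ _] := alpha_shift; exact: h. Qed.
Let aM x y : S x -> S y -> alpha (x * y) = alpha x * alpha y.
Proof. by have [[_ h _] _ _ _] := alpha_shift; exact: h. Qed.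
Let astar x : S x -> alpha (star x) = star (alpha x).
Proof. by have [[_ _ h] _ _ _] := alpha_shift; exact: h. Qed.
Let alam i a : alpha (pi (lam i a)) = pi (lam i.+1 a).
Proof. by have [_ _ h _] := alpha_shift; exact: h. Qed.
Let aF x : F x -> alpha x = x.
Proof. by have [_ _ _ h] := alpha_shift; exact: h. Qed.
Let a1 : alpha 1 = 1.
Proof. by have := alam 0%N 1; rewrite !(lam_one lam_free) pi1. Qed.

Let hS_iter n x : S x -> S (iter n alpha x).
Proof. by move=> Sx; elim: n => //= n IH; exact: aS. Qed.

Let iter_hom n : star_hom_on S (iter n alpha).
Proof.
elim: n => [//|n [hL hM' hs]]; split=> [c x y Sx Sy|x y Sx Sy|x Sx] /=.
- by rewrite hL // aL //; exact: hS_iter.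
- by rewrite hM' // aM //; exact: hS_iter.
- by rewrite hs // astar //; exact: hS_iter.
Qed.

Let iter1 n : iter n alpha 1 = 1.
Proof. by elim: n => //= n ->. Qed.

Let iterF n x : F x -> iter n alpha x = x.
Proof. by move=> Fx; elim: n => //= n ->; exact: aF. Qed.

Let iter_contractive n x : S x -> opnorm (iter n alpha x) <= opnorm x.
Proof. exact: (star_hom_contractive hS S_closed S1 (iter_hom n)). Qed.

Let iter_pi n : exists g, [/\ unital_star_hom g,
  forall i a, g (lam i a) = lam (i + n) a & forall x, iter n alpha (pi x) = pi (g x)].
Proof.
have [g [hg gE]] := free_map lam_free (addn^~ n).
exists g; split=> // x.
have [iL iM iS] := iter_hom n.
have h1 : unital_star_hom (fun x => iter n alpha (pi x)).
  split; last by rewrite pi1 iter1.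
  split=> [c a b _ _|a b _ _|a _]; first by rewrite piL iL.
    by rewrite piM iM.
  by rewrite piS iS.
apply: (hom_eq lam_free h1 (unital_star_hom_comp hg pi_hom)) => i a /=.
rewrite gE; elim: n {g hg gE iL iM iS h1} => [|n IH]; first by rewrite addn0.
by rewrite /= IH alam addnS.
Qed.

Let G_clim x h k : S x -> clim (fun n => inner (iter n alpha x h) k) (inner (G x h) k).
Proof. by move=> Sx; apply/climE; exact: (G_limit Sx). Qed.

(** The commutation of [alpha^n x] with an operator [y] only has to be tested,
    for large [n], on generators: the iterates are contractive, so the defect of
    commutation stays small near the algebra spanned by the generators. *)
Lemma limit_commutant (X Y : set (bop H)) : star_closed Y -> X `<=` S ->
  (forall x, X x -> exists N, forall n, (N <= n)%N -> commutant Y (iter n alpha x)) ->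
  forall x, cstar_gen X x -> commutant Y (G x).
Proof.
move=> sY XS hX x gx y Yy.
have hC := commutant_subalg sY.
pose B0 := [set x | S x /\ exists N, forall n, (N <= n)%N -> commutant Y (iter n alpha x)].
have hB0 : star_subalg B0.
  split.
  - split; first exact: star_subalg0.
    exists 0%N => n _; suff -> : iter n alpha 0 = 0 by exact: star_subalg0.
    by have [iL _ _] := iter_hom n; exact: (linear_on0 hS iL).
  - move=> c u v [Su [N hu]] [Sv [N' hv]]; split.
      by apply: (star_subalgD hS) => //; exact: (star_subalgZ _ hS).
    exists (maxn N N') => n; rewrite geq_max => /andP[Nn N'n].
    have [iL _ _] := iter_hom n; rewrite iL //.
    by apply: (star_subalgD hC); [apply: (star_subalgZ _ hC); exact: hu|exact: hv].
  - move=> u v [Su [N hu]] [Sv [N' hv]]; split; first exact: (star_subalgM hS).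
    exists (maxn N N') => n; rewrite geq_max => /andP[Nn N'n].
    have [_ iM _] := iter_hom n; rewrite iM //.
    by apply: (star_subalgM hC); [exact: hu|exact: hv].
  - move=> u [Su [N hu]]; split; first exact: (star_subalgS hS).
    exists N => n Nn; have [_ _ iS] := iter_hom n; rewrite iS //.
    by apply: (star_subalgS hC); exact: hu.
have XB0 : X `<=` B0 by move=> u Xu; split; [exact: XS|exact: hX].
have Sx : S x by exact: (cstar_gen_min hS S_closed XS).
apply: bopP => h; apply: inner_inj => k; rewrite innerC [RHS]innerC; congr (_^*).
apply: (@eq_of_small _ _ _ (2 + 2 * opnorm y * nr h * nr k)) => e e0.
have [b [Sb [N hb]] xb] := cstar_gen_approx hB0 XB0 gx e0.
have [N1 NP1] := G_clim (y h) k Sx e0.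
have [N2 NP2] := G_clim h (star y k) Sx e0.
pose n := maxn N (maxn N1 N2).
have Nn : (N <= n)%N by exact: leq_maxl.
have := NP1 n; have := NP2 n; rewrite !leq_max !leqnn !orbT /=.
move=> /(_ isT) l2 /(_ isT) l1.
set z := iter n alpha x in l1 l2 *.
pose w := iter n alpha b.
have zw : opnorm (z - w) <= e.
  have [iL _ _] := iter_hom n.
  have -> : z - w = iter n alpha (x - b) by rewrite (linear_onB iL).
  apply: (le_trans (iter_contractive n _)); first exact: (star_subalgB hS).
  exact: ltW.
have yw : y * w = w * y by rewrite hb.
have bd : cmod (inner (z (y h)) k - inner (z h) (star y k)) <=
    2 * opnorm y * nr h * nr k * e.
  rewrite -bop_starE -innerBl.
  have -> : z (y h) - y (z h) = ((z - w) * y - y * (z - w)) h.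
    by rewrite mulrBl mulrBr yw opprB addrA subrK bopB.
  rewrite (le_trans (cmod_inner _ _)) //.
  have -> : 2 * opnorm y * nr h * nr k * e = 2 * opnorm y * e * nr h * nr k by ring.
  rewrite ler_wpM2r ?nr_ge0 // (le_trans (opnormP _ _)) // ler_wpM2r ?nr_ge0 //.
  rewrite (le_trans (opnormD _ _)) // opnormN.
  have := opnormM (z - w) y; have := opnormM y (z - w).
  have : opnorm (z - w) * opnorm y <= e * opnorm y by rewrite ler_wpM2r ?opnorm_ge0.
  rewrite [opnorm y * opnorm _]mulrC.
  by move=> ? ? ?; lra.
rewrite [inner (y _) k]bop_starE.
rewrite (_ : _ - _ = (inner (z (y h)) k - inner (z h) (star y k))
  - (inner (z (y h)) k - inner (G x (y h)) k)
  + (inner (z h) (star y k) - inner (G x h) (star y k))); last by ring.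
have := cmodD (inner (z (y h)) k - inner (z h) (star y k)
  - (inner (z (y h)) k - inner (G x (y h)) k)) (inner (z h) (star y k) - inner (G x h) (star y k)).
have := cmodD (inner (z (y h)) k - inner (z h) (star y k))
  (- (inner (z (y h)) k - inner (G x (y h)) k)).
rewrite cmodN; move: bd l1 l2.
set a1' := cmod _; set a2 := cmod _; set a3 := cmod _; set a4 := cmod _; set a5 := cmod _.
move=> *; rewrite mulrDr [e * (2 * _ * _ * _)]mulrC; lra.
Qed.

(** For large [n] the indices occurring in [alpha^n (pi x)] are out of reach of a given
    finite permutation. *)
Lemma limit_in_fixed x : S x -> F (G x).
Proof.
move=> Sx; rewrite fixed_algebraE => y [cy|[s hs hU]].
  apply: (@limit_commutant _ (commutant (range pi)) _ _ _ x Sx) => //.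
  - exact: commutant_star_closed.
  - exact: sub_cstar_gen.
  - move=> u Xu; have Su : S u by exact: sub_cstar_gen.
    by exists 0%N => n _; exact: (fixed_M (hS_iter n Su)).
have [u1 u2] := hU.1.
apply: (@limit_commutant _ [set U | U = y \/ U = star y] _ _ _ x Sx); last by left.
- by move=> _ [->|->] /=; rewrite ?starK; [right|left].
- exact: sub_cstar_gen.
move=> u Xu.
suff [N hN] : exists N, forall n, (N <= n)%N -> y * iter n alpha u = iter n alpha u * y.
  exists N => n /hN h _ [->|->] //.
  by rewrite -[LHS]mul1r -u1 -!mulrA [y * (_ * _)]mulrA h -[_ * y * _]mulrA u2 mulr1.
case: Xu => [[v _ <-]|Fu].
  have [_ [N sN]] := hs; exists N => n Nn.
  have [g [hg gE ->]] := iter_pi n.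
  have [b [hb bE ->]] := implements_commute psi_gns hU.
  have -> // : b (g v) = g v.
  apply: (hom_eq lam_free (unital_star_hom_comp hg hb) hg) => i a /=.
  by rewrite gE bE sN // (leq_trans Nn) // leq_addl.
by exists 0%N => n _; rewrite iterF //; have [_ /(_ _ _ hs hU)/(conj_fixed _ hU.1)] := Fu.
Qed.

Lemma limit_in_tail x : Q x -> T (G x).
Proof.
move=> Qx N _.
apply: (@limit_commutant _ (commutant (YN N)) _ _ _ x Qx) => //.
- by apply: commutant_star_closed; exact: YN_star.
- by move=> u Xu; apply: tail_cstar_sub; exact: sub_cstar_gen.
move=> u [[v _ <-]|Tu]; last first.
  by exists 0%N => n _; rewrite iterF; [exact: Tu|exact: tail_sub_fixed].
exists N => n Nn; have [g [hg gE ->]] := iter_pi n.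
move=> y cy; apply/esym.
apply: (free_commute lam_free (unital_star_hom_comp hg pi_hom)) => i a /=.
rewrite gE; apply: cy; left; exists (i + n)%N; last by exists a.
by rewrite /= (leq_trans Nn) // leq_addl.
Qed.

Let U_inner (U : bop H) h k : Defs.is_unitary U -> inner (U h) (U k) = inner h k.
Proof. by move=> [u1 _]; rewrite bop_starE -bopM u1. Qed.

(** On finitely many generators the shift is conjugation by a permutation unitary. *)
Let local_shift x := exists K, forall s U, finite_perm s -> implements lam hat s U ->
  (forall i, (i < K)%N -> s i = i.+1) -> alpha x * U = U * x.

Let S0 := [set x | S x /\ local_shift x].

Let hS0 : star_subalg S0.
Proof.
split.
- split; first exact: star_subalg0.
  by exists 0%N => s U _ _ _; rewrite (linear_on0 hS aL) mul0r mulr0.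
- move=> c x y [Sx [K hx]] [Sy [K' hy]]; split.
    by apply: (star_subalgD hS) => //; exact: (star_subalgZ _ hS).
  exists (maxn K K') => s U hs hU sK; rewrite aL // mulrDl mulrDr -scalerAl -scalerAr.
  rewrite (hx s) // ?(hy s) // => i h; apply: sK; rewrite leq_max h ?orbT //.
- move=> x y [Sx [K hx]] [Sy [K' hy]]; split; first exact: (star_subalgM hS).
  exists (maxn K K') => s U hs hU sK; rewrite aM // -mulrA.
  rewrite (hy s) // ?mulrA ?(hx s) // => i h; apply: sK; rewrite leq_max h ?orbT //.
- move=> x [Sx [K hx]]; split; first exact: (star_subalgS hS).
  exists K => s U hs hU sK; have [u1 u2] := hU.1.
  have -> : alpha (star x) = U * star x * star U; last by rewrite -mulrA u1 mulr1.
  rewrite astar // -[alpha x]mulr1 -u2 mulrA (hx s) // !starM starK mulrA //.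
Qed.

Let S0_lam i a : S0 (pi (lam i a)).
Proof.
split=> //; exists i.+1 => s U _ hU si.
have [b' [_ bE bU]] := implements_commute psi_gns hU.
by rewrite alam bU bE si.
Qed.

Let S0_F x : F x -> S0 x.
Proof.
move=> Fx; split; first exact: F_S.
exists 0%N => s U hs hU _; rewrite aF //.
by have [_ /(_ _ _ hs hU)/(conj_fixed _ hU.1)] := Fx.
Qed.

Let S0_1 : S0 1.
Proof. by rewrite -pi1 -(lam_one lam_free 0%N). Qed.

Let S0_word (w : seq (nat * A)) : S0 (pi (\prod_(p <- w) lam p.1 p.2)).
Proof.
elim: w => [|p w IH]; first by rewrite big_nil pi1.
by rewrite big_cons piM; exact: (star_subalgM hS0).
Qed.

Let S0_total : is_total [set x | exists2 z, S0 z & x = z xi].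
Proof.
move=> k ok; apply: (word_total lam_free psi_gns) => _ [w ->]; apply: ok.
by exists (pi (\prod_(p <- w) lam p.1 p.2)) => //; rewrite (pi_hat psi_gns).
Qed.

Let local_inner x y : S0 x -> S0 y ->
  inner (alpha x xi) (alpha y xi) = inner (x xi) (y xi).
Proof.
move=> [_ [K hx]] [_ [K' hy]].
have [s hs sE] := shift_perm (maxn K K').
have [U hU] := permutation_implemented lam_free psi_symmetric psi_gns hs.1.
have sx i : (i < K)%N -> s i = i.+1 by move=> h; apply: sE; rewrite leq_max h.
have sy i : (i < K')%N -> s i = i.+1 by move=> h; apply: sE; rewrite leq_max h orbT.
have Uxi : U xi = xi by exact: (implements_fix hU).
rewrite -{1}Uxi -{2}Uxi -bopM (hx s U hs hU sx) -[alpha y _]bopM (hy s U hs hU sy).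
by rewrite !bopM U_inner //; exact: hU.1.
Qed.

(** On words, the existence of an isometry [V] is the symmetry of the state.  The
    extension of [V x = alpha x V] from words to every [pi x] is a use of the
    universal property, for [x |-> V pi(x) V^* + (1 - p) pi(g x)], where [g] shifts
    the copies and [p = V V^* ]; this homomorphism agrees with [pi(g x)] on each
    copy. *)
Lemma shift_isometry : exists V : bop H,
  [/\ star V * V = 1, V xi = xi & forall x, S x -> V * x = alpha x * V].
Proof.
pose D x y := exists2 z, S0 z & x = z xi /\ y = alpha z xi.
have [||||f bf fE] := @graph_ext R H H D 1 ler01.
- exists 0; first exact: star_subalg0.
  by rewrite (linear_on0 hS aL).
- move=> a _ _ _ _ [z Sz [-> ->]] [z' Sz' [-> ->]]; exists (a *: z + z').
    by apply: (star_subalgD hS0) => //; exact: (star_subalgZ _ hS0).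
  by split=> //; case: Sz => Sz _; case: Sz' => Sz' _; rewrite aL.
- move=> _ _ [z Sz [-> ->]]; rewrite mul1r le_eqVlt; apply/orP; left.
  rewrite -(@eqrXn2 _ 2) ?nr_ge0 //; apply/eqP/complexI.
  by rewrite -!inner_nr local_inner.
- move=> k ok; apply: S0_total => _ [z Sz ->]; apply: ok.
  by exists (alpha z xi), z.
have [V VE'] := blin_bop bf.
have VE z : S0 z -> V (z xi) = alpha z xi by move=> Sz; rewrite VE'; apply: fE; exists z.
have VV : star V * V = 1.
  apply: (total_eq S0_total) => _ [z Sz ->].
  apply/eqP; rewrite -subr_eq0; apply/eqP; apply: S0_total => _ [z' Sz' ->].
  by rewrite innerBr bopM -bop_starE !VE // local_inner // subrr.
have Vxi : V xi = xi by have := VE _ S0_1; rewrite a1.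
have VS0 z : S0 z -> V * z = alpha z * V.
  move=> Sz; apply: (total_eq S0_total) => _ [z' Sz' ->].
  rewrite !bopM -[z (z' xi)]bopM !VE //; last exact: (star_subalgM hS0).
  by case: Sz => Sz _; case: Sz' => Sz' _; rewrite aM.
have [g [hg gE ga]] := iter_pi 1.
have {}ga x : alpha (pi x) = pi (g x) by exact: ga.
pose rho x := pi (g x); pose p := V * star V.
have hr : unital_star_hom rho by exact: (unital_star_hom_comp hg pi_hom).
have [[rL rM rS] r1] := hr.
have VSs z : S0 z -> z * star V = star V * alpha z.
  move=> Sz; apply: (can_inj (@starK _ _)); rewrite !starM starK.
  have Szs := star_subalgS hS0 Sz; rewrite VS0 //.
  by case: Sz => Sz _; rewrite astar.
have pr x : p * rho x = rho x * p.
  apply: (free_commute lam_free hr) => i a.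
  rewrite /rho -ga /p -mulrA -VSs; last exact: S0_lam.
  by rewrite mulrA VS0 // -mulrA.
have pV : p * V = V by rewrite /p -mulrA VV mulr1.
have Vp : star V * p = star V by rewrite /p mulrA VV mul1r.
have sp : star p = p by rewrite /p starM starK.
have pp : p * p = p by rewrite {2}/p mulrA pV.
pose rho2 x := V * pi x * star V + (1 - p) * rho x.
have qr x : (1 - p) * rho x = rho x * (1 - p) by rewrite mulrBl mulrBr mul1r mulr1 pr.
have qV : (1 - p) * V = 0 by rewrite mulrBl mul1r pV subrr.
have Vq : star V * (1 - p) = 0 by rewrite mulrBr mulr1 Vp subrr.
have qq : (1 - p) * (1 - p) = 1 - p by rewrite mulrBr mulr1 mulrBl mul1r pp subrr subr0.
have h2 : unital_star_hom rho2.
  split; last by rewrite /rho2 pi1 mulr1 r1 mulr1 addrC subrK.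
  split=> [c x y _ _|x y _ _|x _].
  - rewrite /rho2 piL rL //; move: (1 - p) => q.
    by rewrite !mulrDr mulrDl -!scalerAr -scalerAl scalerDr addrACA.
  - rewrite /rho2 rM // piM; move: (1 - p) qr qV Vq qq => q qr qV Vq qq.
    have e1 : V * pi x * star V * (V * pi y * star V) = V * (pi x * pi y) * star V.
      by rewrite -!mulrA [star V * (V * _)]mulrA VV mul1r.
    have e2 : V * pi x * star V * (q * rho y) = 0.
      by rewrite -mulrA [star V * _]mulrA Vq mul0r mulr0.
    have e3 : q * rho x * (V * pi y * star V) = 0.
      by rewrite qr -!mulrA [q * (V * _)]mulrA qV mul0r mulr0.
    have e4 : q * rho x * (q * rho y) = q * (rho x * rho y).
      by rewrite qr -mulrA [q * (q * _)]mulrA qq mulrA -qr mulrA.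
    by rewrite mulrDl !mulrDr e1 e2 e3 e4 addr0 add0r.
  - rewrite /rho2 starD !starM starK -piS mulrA; congr (_ + _).
    by rewrite starB star1 sp -rS // qr.
have agree i a : rho2 (lam i a) = rho (lam i a).
  rewrite /rho2 VS0 // -mulrA -/p ga -/(rho _) qr -mulrDr addrC subrK mulr1 //.
have Vpi x : V * pi x = alpha (pi x) * V.
  rewrite ga -/(rho x) -(hom_eq lam_free h2 hr agree x) /rho2 mulrDl qr -!mulrA qV.
  by rewrite mulr0 addr0 VV mulr1.
exists V; split=> //.
pose C := [set x | [/\ S x, V * x = alpha x * V & V * star x = alpha (star x) * V]].
suff : S `<=` C by move=> h x /h[].
apply: cstar_gen_min.
- split.
  + by have h0 := star_subalg0 hS0; rewrite /C /= star0; split;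
      rewrite ?VS0 //; exact: star_subalg0.
  + move=> c x y [Sx vx vx'] [Sy vy vy']; split.
    * by apply: (star_subalgD hS) => //; exact: (star_subalgZ _ hS).
    * by rewrite aL // mulrDl mulrDr -scalerAl -scalerAr vx vy.
    * rewrite starD starZ aL; try exact: (star_subalgS hS).
      by rewrite mulrDl mulrDr -scalerAl -scalerAr vx' vy'.
  + move=> x y [Sx vx vx'] [Sy vy vy']; split.
    * exact: (star_subalgM hS).
    * by rewrite aM // mulrA vx -mulrA vy mulrA.
    * rewrite starM aM; try exact: (star_subalgS hS).
      by rewrite mulrA vy' -mulrA vx' mulrA.
  + by move=> x [Sx vx vx']; split; rewrite ?starK //; exact: (star_subalgS hS).
- move=> x hx.
  have Sx : S x by apply: S_closed => e e0; have [y [Sy _ _] xy] := hx e e0; exists y.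
  have key z : (forall e : R, 0 < e ->
      exists2 y, S y /\ V * y = alpha y * V & opnorm (z - y) < e) ->
      S z -> V * z = alpha z * V.
    move=> hz Sz; apply: (@op_eq_small _ _ _ _ (2 * opnorm V)) => e e0.
    have [y [Sy vy] zy] := hz e e0.
    have azy : alpha (z - y) = alpha z - alpha y by exact: (linear_onB aL).
    have -> : V * z - alpha z * V = V * (z - y) - alpha (z - y) * V.
      by rewrite azy mulrBr mulrBl vy opprB addrA subrK.
    have ac := star_hom_contractive hS S_closed S1 (iter_hom 1) (star_subalgB hS Sz Sy).
    rewrite (le_trans (opnormD _ _)) // opnormN.
    have := opnormM V (z - y); have := opnormM (alpha (z - y)) V.
    have m1 : opnorm (alpha (z - y)) * opnorm V <= e * opnorm V.
      by rewrite ler_wpM2r ?opnorm_ge0 // (le_trans ac) // ltW.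
    have m2 : opnorm V * opnorm (z - y) <= e * opnorm V.
      by rewrite mulrC ler_wpM2r ?opnorm_ge0 // ltW.
    by move=> ? ?; lra.
  split=> //; first by apply: key => // e e0; have [y [Sy vy _] xy] := hx e e0; exists y.
  apply: key; last exact: (star_subalgS hS).
  move=> e e0; have [y [Sy _ vy] xy] := hx e e0; exists (star y).
    by split=> //; exact: (star_subalgS hS).
  by rewrite -starB opnorm_star.
- move=> x [[y _ <-]|Fx]; first by split=> //; rewrite -piS.
  have := S0_F Fx => s0; have := star_subalgS hS0 s0 => s0'.
  by split; [exact: F_S|exact: VS0|exact: VS0].
Qed.

(** [V] fixes the vectors [a xi] with [a] in [F], so that
    [<alpha(x) a xi, b xi> = <V x a xi, V b xi> = <x a xi, b xi>]. *)
Lemma limit_compress x a b : S x -> F a -> F b ->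
  inner (G x (a xi)) (b xi) = inner (x (a xi)) (b xi).
Proof.
move=> Sx Fa Fb; have [V [VV Vxi VS]] := shift_isometry.
have Vf c : F c -> V (c xi) = c xi.
  by move=> Fc; rewrite -bopM VS ?aF //; [rewrite bopM Vxi|exact: F_S].
have step z : S z -> inner (alpha z (a xi)) (b xi) = inner (z (a xi)) (b xi).
  move=> Sz; rewrite -{1}(Vf _ Fa) -{1}(Vf _ Fb) -[alpha z _]bopM -VS // bopM.
  by rewrite bop_starE -[star V _]bopM VV.
have hl := G_clim (a xi) (b xi) Sx.
apply: (clim_uniq hl) => e e0; exists 0%N => n _.
suff -> : inner (iter n alpha x (a xi)) (b xi) = inner (x (a xi)) (b xi).
  by rewrite subrr cmod0.
by elim: n => //= n IH; rewrite step; [exact: IH|exact: hS_iter].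
Qed.

End Shift.

(** * Expectations on the tail and fixed point algebras *)

Section LimitExpectation.
Context (R : realType) (A FA : cstarAlgType R) (lam : nat -> A -> FA).
Context (psi : FA -> R[i]) (H : hilbertType R) (hat : FA -> H) (pi : FA -> bop H).
Context (alpha G : bop H -> bop H).
Hypothesis lam_free : is_free_product lam.
Hypotheses (psi_symmetric : is_symmetric lam psi) (psi_gns : is_gns setT psi hat pi).
Hypotheses (alpha_shift : is_shift lam hat pi alpha).
Hypotheses (G_limit : is_shift_limit lam hat pi alpha G).

Let M := gns_vn pi.
Let S := fixed_cstar lam hat pi.
Let F := fixed_algebra lam hat pi.

(** The pair [(B, D)] is [(Q, T)] or [(S, F)]. *)
Context (B D : set (bop H)).
Hypotheses (hB : star_subalg B) (piB : range pi `<=` B) (BS : B `<=` S).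
Hypotheses (DB : D `<=` B) (DF : D `<=` F) (hD : bicommutant D = D).
Hypotheses (sD : star_closed D) (GD : forall x, B x -> D (G x)).
Hypothesis BM : bicommutant B = M.
Hypothesis faithD : has_faithful_gns D (vec_state hat).

Let B1 : B 1.
Proof. by have [_ <-] := gns_hom psi_gns; apply: piB; exists 1. Qed.

Let Dalg : star_subalg D.
Proof. by rewrite -hD; exact: bicommutant_subalg. Qed.

Let Gxi x a b : B x -> D a -> D b ->
  inner (G x (a (hat 1))) (b (hat 1)) = inner (x (a (hat 1))) (b (hat 1)).
Proof.
move=> /BS Sx /DF Fa /DF Fb.
exact: (limit_compress lam_free psi_symmetric psi_gns alpha_shift G_limit).
Qed.

Let faith a : D a -> (forall b, D b -> a (b (hat 1)) = 0) -> a = 0.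
Proof.
have [K [hat' [rep [hg inj]]]] := faithD.
exact: (faithful_gns_cyclic Dalg hg inj).
Qed.

Lemma normal_limit_expectation : exists E, [/\ cond_exp M D E, normal_on M E,
  (forall x, B x -> E x = G x) &
  forall u v : ell2 H, exists u' v' : ell2 H, forall T, M T ->
    inner (diag (E T) u) v = inner (diag T u') v'].
Proof.
have [e eX] := proj_exists (cyclic_subspace (hat 1) Dalg).
rewrite -BM.
exact: (normal_expectation_ex hB B1 DB hD sD GD Gxi faith eX).
Qed.

Lemma limit_induced_iso (V W : hilbertType R) (kappa : bop H -> bop V)
    (sigma : bop H -> bop W) :
  normal_faithful_rep D kappa -> is_induced_rep B D G kappa sigma ->
  extends_to_normal_iso M B sigma.
Proof.
move=> hk hs.
have [e eX] := proj_exists (cyclic_subspace (hat 1) Dalg).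
have cyc : is_total [set x | exists2 b, B b & x = b (hat 1)].
  move=> k ok; apply: (gns_total psi_gns) => _ [x _ <-]; apply: ok.
  by exists (pi x); [apply: piB; exists x|rewrite (pi_hat psi_gns)].
rewrite -BM.
exact: (induced_rep_iso hB B1 DB hD sD GD Gxi faith eX cyc hk hs).
Qed.

End LimitExpectation.

Theorem proposition5p2p4 (R : realType) (A FA : cstarAlgType R)
    (lam : nat -> A -> FA) (psi : FA -> R[i])
    (H : hilbertType R) (hat : FA -> H) (pi : FA -> bop H)
    (alpha G : bop H -> bop H)
    (lam_free : is_free_product lam)
    (psi_state : is_state psi)
    (psi_symmetric : is_symmetric lam psi)
    (psi_gns : is_gns setT psi hat pi)
    (alpha_shift : is_shift lam hat pi alpha)
    (G_limit : is_shift_limit lam hat pi alpha G) :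
  let M := gns_vn pi in
  let T := tail_algebra lam pi in
  let F := fixed_algebra lam hat pi in
  let Q := tail_cstar lam pi in
  let S := fixed_cstar lam hat pi in
  let psihat := vec_state hat in
  [/\ has_faithful_gns T psihat ->
        (forall (V W : hilbertType R)
           (kappa : bop H -> bop V) (sigma : bop H -> bop W),
           normal_faithful_rep T kappa -> is_induced_rep Q T G kappa sigma ->
           extends_to_normal_iso M Q sigma) /\
        extends_to_normal_cond_exp M Q T G,
      has_faithful_gns F psihat ->
        (forall (V W : hilbertType R)
           (kappa : bop H -> bop V) (eta : bop H -> bop W),
           normal_faithful_rep F kappa -> is_induced_rep S F G kappa eta ->
           extends_to_normal_iso M S eta) /\
        extends_to_normal_cond_exp M S F G,
      has_faithful_gns F psihat -> has_faithful_gns T psihat -> T = F &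
      faithful_on F psihat ->
        has_faithful_gns F psihat /\ has_faithful_gns T psihat].

Proof.
move=> M T F Q S psihat.
have xi0 := xi_neq0 psi_state psi_gns.
have TF : T `<=` F := tail_sub_fixed lam_free psi_gns.
have QS : Q `<=` S := tail_cstar_sub lam_free psi_gns.
have hQ : star_subalg Q := cstar_gen_subalg _.
have hS : star_subalg S := cstar_gen_subalg _.
have piQ : range pi `<=` Q by move=> x px; apply: sub_cstar_gen; left.
have piS : range pi `<=` S by move=> x px; apply: sub_cstar_gen; left.
have TQ : T `<=` Q by move=> x px; apply: sub_cstar_gen; right.
have FS : F `<=` S by move=> x px; apply: sub_cstar_gen; right.
have TT : bicommutant T = T.
  by rewrite /T tail_algebraE /bicommutant tricommutant.
have FF : bicommutant F = F.
  by rewrite /F fixed_algebraE /bicommutant tricommutant.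
have sT : star_closed T := @tail_algebra_star R A FA lam H pi.
have sF : star_closed F := fixed_algebra_star psi_gns.
have GT x : Q x -> T (G x) :=
  @limit_in_tail _ _ _ _ _ _ _ _ _ _ lam_free psi_gns alpha_shift G_limit x.
have GF x : S x -> F (G x) :=
  @limit_in_fixed _ _ _ _ _ _ _ _ _ _ lam_free psi_gns alpha_shift G_limit x.
have QM : bicommutant Q = M := tail_cstar_bicommutant lam_free psi_gns.
have SM : bicommutant S = M := fixed_cstar_bicommutant lam psi_gns.
have ET := normal_limit_expectation lam_free psi_symmetric psi_gns alpha_shift G_limit
  hQ piQ QS TQ TF TT sT GT QM.
have EF := normal_limit_expectation lam_free psi_symmetric psi_gns alpha_shift G_limit
  hS piS (@subset_refl _ S) FS (@subset_refl _ F) FF sF GF SM.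
split.
- move=> fT; split; last by have [E [h1 h2 h3 _]] := ET fT; exists E.
  move=> V W kappa sigma; exact: (limit_induced_iso lam_free psi_symmetric psi_gns
    alpha_shift G_limit hQ piQ QS TQ TF TT sT GT QM fT).
- move=> fF; split; last by have [E [h1 h2 h3 _]] := EF fF; exists E.
  move=> V W kappa sigma; exact: (limit_induced_iso lam_free psi_symmetric psi_gns
    alpha_shift G_limit hS piS (@subset_refl _ S) FS (@subset_refl _ F) FF sF GF SM fF).
- move=> fF fT; apply/seteqP; split=> // x Fx.
  have [E1 [c1 _ e1 n1]] := ET fT; have [E2 [c2 _ e2 n2]] := EF fF.
  have Mx : M x by rewrite -SM; apply: sub_bicommutant; exact: FS.
  (* Both expectations extend the restriction of G to Q, which is weakly dense. *)
  suff e : E2 x = E1 x.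
    by rewrite -(cond_exp_id c2 Fx) e; exact: (cond_exp_range c1).
  apply: bopP => h; apply: inner_inj => k; rewrite innerC [RHS]innerC; congr (_^*).
  rewrite (functional_single (E2 x)) (functional_single (E1 x)).
  have [u1 [v1 uv1]] := n1 (single 0%N h) (single 0%N k).
  have [u2 [v2 uv2]] := n2 (single 0%N h) (single 0%N k).
  rewrite uv1 // uv2 //.
  have Q1 : Q 1 by have [_ <-] := gns_hom psi_gns; apply: piQ; exists 1.
  have MQ y : Q y -> M y by rewrite -QM; exact: sub_bicommutant.
  apply: (bicommutant_functional_eq hQ Q1); last by rewrite QM.
  move=> b Qb; rewrite -(uv1 _ (MQ _ Qb)) -(uv2 _ (MQ _ Qb)).
  by rewrite (e1 _ Qb) (e2 _ (QS _ Qb)).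
- move=> fF.
  have F1 : F 1 by rewrite -FF; exact: commutant_one.
  have T1 : T 1 by rewrite -TT; exact: commutant_one.
  have hF : star_subalg F by rewrite -FF; exact: bicommutant_subalg.
  have hT : star_subalg T by rewrite -TT; exact: bicommutant_subalg.
  split; first exact: (faithful_state_gns hF).
  apply: (faithful_state_gns hT) => // x Tx; apply: fF; exact: TF.
Qed.
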